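(* For each $N$, let $\bm U\in\mathcal U(N)$ be a Haar-distributed unitary matrix, and let $\bm A,\bm D\in\{0,1\}^{N\times N}$ be random diagonal matrices, with all diagonal entries independent (of each other and of $\bm U$), $A_{ii}\sim\mathsf{Ber}(\alpha)$ for a fixed $\alpha\in(0,1)$ and $D_{ii}\sim\mathsf{Ber}(\frac12)$. Then $\lambda_{\max}(\bm A\bm U\bm D\bm U^*\bm A)=\|\bm A\bm U\bm D\|^2$ converges in probability to $\mathsf{edge}(\alpha,\frac12)$ as $N\to\infty$.
   Context: $\mathsf{Ber}(p)$ is the law of a $\{0,1\}$-valued variable equal to $1$ with probability $p$. With $r_+(\alpha,\beta)=\big(\sqrt{\alpha(1-\beta)}+\sqrt{\beta(1-\alpha)}\big)^2$, define $\mathsf{edge}(\alpha,\beta)=1$ if $\alpha+\beta>1$ and $\mathsf{edge}(\alpha,\beta)=r_+(\alpha,\beta)$ if $\alpha+\beta\le1$. $\lambda_{\max}$ denotes the largest eigenvalue and $\|\cdot\|$ the operator norm. *)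

(* Defs.v *)
From HB Require Import structures.
From mathcomp Require Import all_boot all_order all_algebra.
From mathcomp Require Import all_classical all_reals all_analysis.
From mathcomp Require Import complex.
Set Implicit Arguments. Unset Strict Implicit. Unset Printing Implicit Defensive.
Import Order.TTheory GRing.Theory Num.Theory.
Local Open Scope classical_set_scope.
Local Open Scope ring_scope.

Section Defs.
Context {R : realType}.
Local Notation C := (complex R).

Definition adjmx m n (M : 'M[C]_(m, n)) : 'M[C]_(n, m) := (map_mx Num.conj M)^T.

Definition vnorm n (v : 'cV[C]_n) : R :=
  Num.sqrt (\sum_(i < n) (complex.Re (v i ord0) ^+ 2 + complex.Im (v i ord0) ^+ 2)).

Definition opnorm m n (M : 'M[C]_(m, n)) : R :=
  sup [set vnorm (M *m v) | v in [set v : 'cV[C]_n | vnorm v <= 1]].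

(* largest eigenvalue (of a Hermitian matrix, whose eigenvalues are real) *)
Definition lambda_max n (M : 'M[C]_n) : R :=
  sup [set x : R | eigenvalue M (x%:C)%C].

Definition r_plus (a b : R) : R :=
  (Num.sqrt (a * (1 - b)) + Num.sqrt (b * (1 - a))) ^+ 2.
Definition edge (a b : R) : R := if 1 < a + b then 1 else r_plus a b.

Definition bdiag n (b : 'I_n -> bool) : 'M[C]_n := diag_mx (\row_i (b i)%:R).

(* Borel-type sigma-algebra on complex n x n matrices: generated by the real and
   imaginary parts of the entries (i.e. the Borel sigma-algebra of C^(n*n) = R^(2n^2)) *)
Definition mx_gen n : set (set 'M[C]_n) :=
  [set E | exists (i j : 'I_n) (B : set R), measurable B /\
     (E = (fun M : 'M[C]_n => complex.Re (M i j)) @^-1` B \/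
      E = (fun M : 'M[C]_n => complex.Im (M i j)) @^-1` B)].
Definition mx_measurable n : set (set 'M[C]_n) := <<s (@mx_gen n) >>.

(* U is a Haar-distributed unitary random matrix under P: U is a measurable random
   matrix, almost surely unitary, whose law is invariant under left multiplication by
   every fixed unitary matrix (this characterizes the Haar probability on U(n)). *)
Definition haar_unitary d (T : measurableType d) (P : probability T R) n
    (U : T -> 'M[C]_n) : Prop :=
  [/\ (forall E, mx_measurable E -> measurable (U @^-1` E)),
      P [set w | ~~ (U w \is unitarymx)] = 0%E
    & forall V : 'M[C]_n, V \is unitarymx -> forall E, mx_measurable E ->
        P (U @^-1` E) = P ((fun w => V *m U w) @^-1` E)].

Definition bernoulli_bit d (T : measurableType d) (P : probability T R) (p : R)
    (b : T -> bool) : Prop :=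
  measurable [set w | b w] /\ P [set w | b w] = p%:E.

Definition indep_U_bits d (T : measurableType d) (P : probability T R) n
    (U : T -> 'M[C]_n) (a b : T -> 'I_n -> bool) : Prop :=
  forall (E : set 'M[C]_n) (Ea Eb : 'I_n -> set bool), mx_measurable E ->
    P [set w | E (U w) /\ (forall i, Ea i (a w i)) /\ (forall i, Eb i (b w i))] =
    (P (U @^-1` E) * \prod_(i < n) P [set w | Ea i (a w i)]
                   * \prod_(i < n) P [set w | Eb i (b w i)])%E.

End Defs.

(* Main.v *)
(** Write A and D for the two diagonal projections, W = U (2D - 1) U^*,
    s = sqrt (alpha (1 - alpha)), c = (A - alpha) / s, Y = c W, and tr for the
    normalized trace. Then W^2 = 1, c^2 = kap c + 1 and X = A (1 + W) A / 2.

    Upper edge, alpha <= 1/2: by an Ihara-Bass type identity an eigenvalue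
    1/2 + s + delta of X forces an eigenvalue of Y above 1 + delta, so it suffices that
    |Y^k|_F^2 grows subexponentially for some k much larger than log N. Differentiating
    the invariance of the law of U along unitary curves 1 + z(t) x x^* gives loop
    (Schwinger-Dyson) equations for tau_k = tr Y^k. Up to small coefficients they express
    E[tau_k Z] through products with one more factor (splitting) or, with a factor
    1/N^2, one factor less (merging). A contraction argument yields
    |E[tau_(k_1) ... tau_(k_r)]| <= eps^r as long as k_1 + ... + k_r is at most a small
    power of N, and |Y^k|_F^2 / N is 1 plus a combination of few tau_j.

    Lower edge: the matrices A (W c)^j are asymptotically orthogonal, by the same
    estimates, and A W A acts on them as s (shift + shift^* ), which gives a Rayleigh
    quotient close to 1/2 + s.

    For alpha > 1/2 the ranges of A and U D U^* intersect with high probability and the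
    largest eigenvalue is 1. In both cases one conditions on the random bits, whose
    proportions concentrate by Chebyshev's inequality. *)

Require Import Defs.
From HB Require Import structures.
From mathcomp Require Import all_boot all_order all_algebra.
From mathcomp Require Import all_classical all_reals all_analysis.
From mathcomp Require Import measurable_realfun complex.
From mathcomp Require Import zify ring lra.
Set Implicit Arguments. Unset Strict Implicit. Unset Printing Implicit Defensive.
Import Order.TTheory GRing.Theory Num.Theory.
Local Open Scope classical_set_scope.
Local Open Scope ring_scope.

(** * Moments determined by the loop recursion *)

(** The loop equations do not close on single traces: splitting turns tau_k into products of two.
    Hence all mixed moments are estimated together, in a norm that charges one eps per factor.
    Splitting creates two small factors where one would do; merging loses one but carries 1/N^2. The
    recursion therefore contracts from any finite a priori bound, however badly it depends on N.
    Concentration comes along for free, since E[tau_k^2] is itself one of the moments. Smallness has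
    its origin in the centring: tr c and tr W vanish up to the bit fluctuations, of order N^(-1/2),
    and in the limit c and W are free, so that every tau_k with k > 0 vanishes. Parameter 1/2 for D
    is what gives W^2 = 1 without a linear term. An eigenvalue of Y above 1 + delta forces |Y^k|_F^2
    >= (1 + delta)^(2k), to be compared with N times a polynomial in k. For k of order N^(1/40) the
    exponential wins, polynomial losses in k are harmless, and eps of order k^(-3) stays far above
    the noise of the bits. *)

Ltac nlia := repeat match goal with
  | H : is_true (@Order.le _ _ _ _) |- _ => clear H
  | H : is_true (@Order.lt _ _ _ _) |- _ => clear H
  | H : context [@GRing.mul] |- _ => clear H
  end; lia.

Section LoopRecursion.
Variable (R : archiRealFieldType).
Variables (kap gam om : R).

(* With m l = E[prod_i tau_(l_i)], the forms below are E[u_k Z_l], E[w_(k,a) Z_l] and the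
   merging terms, where u_k = tr (Y^k c) and w_(k,a) = tr (Y^k (W c)^a) have been
   expanded linearly in the tau_j. *)
Fixpoint tail_form (g : seq nat -> R) (k : nat) (l : seq nat) : R :=
  match k with
  | 0 => gam * g l
  | k'.+1 => kap * g (k :: l) +
      match k' with 0 => om * g l | k''.+1 => tail_form g k'' l end
  end.

Fixpoint fold_form (m : seq nat -> R) (k a : nat) (l : seq nat) : R :=
  match k, a with
  | 0, 0 => m l
  | 0, _ => m (a :: l)
  | _, 0 => m (k :: l)
  | k'.+1, a'.+1 => kap * tail_form m (k' + a')%N l + fold_form m k' a' l
  end.

Fixpoint merge_form (m : seq nat -> R) (k : nat) (l' l : seq nat) : R :=
  match l with
  | [::] => 0
  | a :: l0 =>
      a%:R * (fold_form m k a (catrev l' l0) - m ((k + a)%N :: catrev l' l0))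
      + merge_form m k (a :: l') l0
  end.

Definition split_form (m : seq nat -> R) (k : nat) (l : seq nat) : R :=
  om * tail_form m k l +
  \sum_(j < k) (tail_form (tail_form m (k - j.+1)) j l - m [:: j.+1, (k - j)%N & l]).

Definition loop_eq (q : R) (m : seq nat -> R) : Prop :=
  forall k l, all (ltn 0) l ->
    m (k.+1 :: l) = split_form m k l + q * merge_form m k.+1 [::] l.

Variables (K : nat) (k0 eps : R).
Hypotheses (k0_ge1 : 1 <= k0) (kap_le : `|kap| <= k0) (eps_gt0 : 0 < eps)
  (eps_le1 : eps <= 1) (gam_le : `|gam| <= eps) (om_le : `|om| <= eps).

Let eps_ge0 : 0 <= eps := ltW eps_gt0.

(** A weighted sup norm: every factor tau contributes one eps. The offset d records how much of the
    degree budget K is already spent, since a form at l evaluates g at lists of larger sum. Entries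
    are positive because tau_0 = 1 carries no eps. *)
Definition bounded_by (d : nat) (e : R) (g : seq nat -> R) : Prop :=
  forall l, all (ltn 0) l -> (sumn l + d <= K)%N -> `|g l| <= e * eps ^+ size l.

(** Each of the at most k + 1 terms gains a factor eps, from gam, from om, or from the extra entry
    put in front of l. *)
Lemma bounded_by_tail d e g k : 0 <= e -> bounded_by d e g ->
  bounded_by (d + k) ((k.+1)%:R * k0 * eps * e) (tail_form g k).
Proof.
move=> e0 gP; have k00 : 0 <= k0 := le_trans ler01 k0_ge1.
elim/ltn_ind: k => k IH l lp lK.
have S (x : nat) : (0 < x)%N -> (x <= k)%N ->
    `|kap * g (x :: l)| <= k0 * eps * (e * eps ^+ size l).
  move=> x0 xk; rewrite normrM.
  have := gP (x :: l); rewrite /= x0 lp => /(_ isT); have -> : (x + sumn l + d <= K)%N by nlia.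
  move=> /(_ isT) h; rewrite exprS in h.
  apply: (le_trans (ler_pM _ _ kap_le h)) => //.
  by rewrite le_eqVlt; apply/orP; left; apply/eqP; ring.
have G : `|g l| <= e * eps ^+ size l by apply: gP => //; nlia.
have M : 0 <= e * eps ^+ size l by rewrite mulr_ge0 // exprn_ge0.
have A (x : R) : `|x| <= eps -> `|x * g l| <= k0 * eps * (e * eps ^+ size l).
  move=> h; rewrite normrM; apply: le_trans (ler_pM _ _ h G) _ => //.
  by rewrite -[leRHS]mulrA ler_peMl // mulr_ge0 ?exprn_ge0 //.
set M' := k0 * eps * (e * eps ^+ size l) in S A.
have M'0 : 0 <= M' by rewrite /M' !mulr_ge0 ?exprn_ge0 //.
have E (j : nat) : j.+1%:R * k0 * eps * e * eps ^+ size l = j.+1%:R * M' by rewrite /M'; ring.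
rewrite E.
case: k lK IH S => [|[|k]] lK IH S /=.
- rewrite mul1r; apply: A; exact: gam_le.
- apply: le_trans (ler_normD _ _) _.
  have := S 1%N isT (leqnn _); have := A _ om_le; lra.
- apply: le_trans (ler_normD _ _) _.
  have := S k.+2 isT (leqnn _) => h1.
  have h2 : `|tail_form g k l| <= k.+1%:R * M'.
    by rewrite -E; apply: IH => //; nlia.
  have -> : k.+3 = (k.+1 + 2)%N by nlia.
  rewrite natrD mulrDl; move: h1 h2; move: (k.+1%:R * M') (kap * _) (tail_form _ _ _) => x y z.
  by move=> h1 h2; lra.
Qed.

Lemma bounded_by_cons d e g k : (0 < k)%N -> bounded_by d e g ->
  bounded_by (d + k) (e * eps) (fun l => g (k :: l)).
Proof.
move=> k0' gP l lp lK; have := gP (k :: l); rewrite /= k0' lp exprS mulrA; apply => //; nlia.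
Qed.

Lemma bounded_byW d e d' e' g : (d <= d')%N -> e <= e' ->
  bounded_by d e g -> bounded_by d' e' g.
Proof.
move=> dd ee gP l lp lK; apply: le_trans (gP l lp _) _; first nlia.
by rewrite ler_wpM2r // exprn_ge0.
Qed.

Lemma bounded_byD d e e' g g' : bounded_by d e g -> bounded_by d e' g' ->
  bounded_by d (e + e') (fun l => g l + g' l).
Proof.
move=> gP g'P l lp lK; rewrite mulrDl (le_trans (ler_normD _ _)) // lerD //; auto.
Qed.

Lemma bounded_byM d e x g : bounded_by d e g -> bounded_by d (`|x| * e) (fun l => x * g l).
Proof. by move=> gP l lp lK; rewrite normrM -mulrA ler_wpM2l //; apply: gP. Qed.

Variables (q : R) (m : seq nat -> R).
Hypothesis q_ge0 : 0 <= q.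

(** No eps is gained here: for k = a the recursion ends in m l itself, which is the leading term 1
    of |Y^k|_F^2 / N. *)
Lemma bounded_by_fold B k a : 0 <= B -> bounded_by 0 B m -> (k + a <= K)%N ->
  bounded_by (k + a) (k.+1%:R * K.+1%:R * k0 ^+ 2 * B) (fold_form m k a).
Proof.
have k01 := k0_ge1; have k00 : 0 <= k0 by lra.
have e_0 := eps_gt0; have e_1 := eps_le1.
move=> B0 mP; elim: k a => [|k IH] [|a] kK.
- apply: bounded_byW mP => //; rewrite ler_peMl // mul1r.
  by rewrite mulr_ege1 ?ler1n // expr_ge1 //; lra.
- have := bounded_by_cons (ltn0Sn a) mP; apply: bounded_byW => //.
  rewrite mulrC ler_wpM2r // mul1r (le_trans eps_le1) //.
  by rewrite mulr_ege1 ?ler1n // expr_ge1 //; lra.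
- have := bounded_by_cons (ltn0Sn k) mP; apply: bounded_byW; first by rewrite addn0.
  rewrite mulrC ler_wpM2r // (le_trans eps_le1) //.
  by rewrite !mulr_ege1 ?ler1n // expr_ge1 //; lra.
- rewrite /=.
  have H1 := bounded_byM kap (bounded_by_tail (k := (k + a)%N) B0 mP).
  have H2 := IH a ltac:(nlia).
  apply: bounded_byW (bounded_byD H1 H2); first by nlia.
  rewrite -[in leRHS]natr1 !mulrDl mul1r [leRHS]addrC lerD2r.
    have : (k + a).+1%:R <= K.+1%:R :> R by rewrite ler_nat; nlia.
    move=> h; rewrite -mulrA.
    have -> : `|kap| * ((k + a).+1%:R * k0 * (eps * B)) =
              (k + a).+1%:R * (`|kap| * k0) * (eps * B) by ring.
    rewrite expr2; apply: ler_pM => //.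
    * by rewrite !mulr_ge0 //; lra.
    * by rewrite mulr_ge0 ?exprn_ge0 //.
    * by apply: ler_pM => //; rewrite ?mulr_ge0 // ?ler_wpM2r //; lra.
    * by rewrite ler_piMl.
Qed.

Lemma sumn_catrev l' l : sumn (catrev l' l) = (sumn l' + sumn l)%N.
Proof. by rewrite catrevE sumn_cat sumn_rev. Qed.

(** Merging absorbs one entry of l, so one power of eps is lost; the factor eps on the left restores
    it without a division. The accumulator l' holds the factors already passed, in reverse order. *)
Lemma bounded_merge B k l' l : 0 <= B -> bounded_by 0 B m -> (0 < k)%N ->
  all (ltn 0) l' -> all (ltn 0) l -> (k + sumn l' + sumn l <= K)%N ->
  eps * `|merge_form m k l' l| <=
  (sumn l)%:R * (2 * K.+1%:R ^+ 2 * k0 ^+ 2) * B * eps ^+ (size l' + size l).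
Proof.
have k01 := k0_ge1; have k00 : 0 <= k0 by lra.
have e_0 := eps_gt0; have e_1 := eps_le1.
move=> B0 mP kp; elim: l l' => [|a l IH] l' l'p /=.
  by move=> _ _; rewrite normr0 mulr0 !mul0r.
move=> /andP[ap lp] kK.
have := IH (a :: l'); rewrite /= ap l'p lp => /(_ isT isT ltac:(nlia)).
rewrite addSnnS => IH'.
have W := bounded_by_fold (k := k) (a := a) B0 mP ltac:(nlia).
have cp : all (ltn 0) (catrev l' l) by rewrite catrevE all_cat all_rev l'p.
have {}W := W _ cp ltac:(rewrite sumn_catrev; nlia).
have M := bounded_by_cons (k := (k + a)%N) ltac:(nlia) mP cp ltac:(rewrite sumn_catrev; nlia).
have sz : size (catrev l' l) = (size l' + size l)%N by rewrite catrevE size_cat size_rev.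
rewrite sz in W M.
set F := fold_form _ _ _ _ in W *; set G := m _ in M *; set H := merge_form _ _ _ _ in IH' *.
set E := eps ^+ (size l' + size l) in W M *.
have E0 : 0 <= E by rewrite exprn_ge0.
have -> : eps ^+ (size l' + (size l).+1) = eps * E by rewrite addnS exprS.
rewrite addnS [eps ^+ _.+1]exprS -/E in IH'.
have step : `|F - G| <= 2 * K.+1%:R ^+ 2 * k0 ^+ 2 * B * E.
  apply: le_trans (ler_normB _ _) _.
  have kK1 : k.+1%:R <= K.+1%:R :> R by rewrite ler_nat; nlia.
  have K1 : 1 <= K.+1%:R :> R by rewrite ler1n.
  have k02 : 1 <= k0 ^+ 2 by rewrite expr_ge1 //; lra.
  have T1 : 1 <= K.+1%:R ^+ 2 * k0 ^+ 2 by rewrite mulr_ege1 // expr_ge1 // ler0n.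
  have h1 : `|F| <= K.+1%:R ^+ 2 * k0 ^+ 2 * (B * E).
    apply: le_trans W _; rewrite -mulrA ler_wpM2r ?mulr_ge0 // ler_wpM2r ?exprn_ge0 //.
    by rewrite expr2 ler_wpM2r.
  have h2 : `|G| <= K.+1%:R ^+ 2 * k0 ^+ 2 * (B * E).
    apply: le_trans M _; rewrite -mulrA.
    have : eps * E <= E by rewrite ler_piMl.
    move=> h; apply: le_trans (_ : B * E <= _); first by rewrite ler_wpM2l.
    by rewrite ler_peMl // mulr_ge0.
  lra.
apply: (@le_trans _ _ (eps * (a%:R * `|F - G|) + eps * `|H|)).
  rewrite -mulrDr ler_wpM2l // (le_trans (ler_normD _ _)) // normrM.
  by rewrite (ger0_norm (ler0n _ _)).
rewrite natrD.
have : eps * (a%:R * `|F - G|) <= eps * (a%:R * (2 * K.+1%:R ^+ 2 * k0 ^+ 2 * B * E)).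
  by rewrite ler_wpM2l // ler_wpM2l.
lra.
Qed.

Hypotheses (m_nil : m [::] = 1) (m_loop : loop_eq q m)
  (K_eps : 12 * K%:R ^+ 3 * k0 ^+ 2 * eps <= 1)
  (K_q : 8 * K%:R * K.+1%:R ^+ 2 * k0 ^+ 2 * q <= eps ^+ 2).

(** Every term contains two small quantities: om and a tail, two nested tails, or two new entries.
    This gives eps^2, while the target norm asks for a single eps. *)
Lemma split_bound B k l : 0 <= B -> bounded_by 0 B m -> all (ltn 0) l ->
  (k.+1 + sumn l <= K)%N ->
  `|split_form m k l| <= 3 * K%:R ^+ 3 * k0 ^+ 2 * eps ^+ 2 * B * eps ^+ size l.
Proof.
have k01 := k0_ge1; have k00 : 0 <= k0 by lra.
have e_0 := eps_gt0; have e_1 := eps_le1.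
move=> B0 mP lp kK; rewrite /split_form.
have K1 : 1 <= K%:R :> R by rewrite ler1n; nlia.
set E := eps ^+ size l; have E0 : 0 <= E by rewrite exprn_ge0.
have T1 : `|om * tail_form m k l| <= K%:R * (k0 ^+ 2 * eps ^+ 2 * B * E).
  have := bounded_by_tail (k := k) B0 mP lp ltac:(nlia) => h.
  rewrite normrM; apply: le_trans (ler_pM _ _ om_le h) _ => //.
  have -> : eps * (k.+1%:R * k0 * eps * B * eps ^+ size l) =
     (k.+1%:R * k0) * (eps ^+ 2 * B * E) by rewrite /E; ring.
  have -> : K%:R * (k0 ^+ 2 * eps ^+ 2 * B * E) = (K%:R * k0 ^+ 2) * (eps ^+ 2 * B * E) by ring.
  rewrite ler_wpM2r ?mulr_ge0 ?exprn_ge0 //.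
  by rewrite ler_pM // ?ler_nat; [nlia | rewrite expr2 ler_peMl].
apply: le_trans (ler_normD _ _) _.
have T2 : `|\sum_(j < k) (tail_form (tail_form m (k - j.+1)) j l - m [:: j.+1, (k - j)%N & l])|
   <= \sum_(j < k) (2 * K%:R ^+ 2 * (k0 ^+ 2 * eps ^+ 2 * B * E)).
  apply: le_trans (ler_norm_sum _ _ _) _; apply: ler_sum => j _.
  apply: le_trans (ler_normB _ _) _.
  have jk := ltn_ord j.
  have h1 := bounded_by_tail (k := (k - j.+1)%N) B0 mP.
  have h10 : 0 <= (k - j.+1).+1%:R * k0 * eps * B by rewrite !mulr_ge0 //; lra.
  have {}h1 := bounded_by_tail (k := j) h10 h1 lp ltac:(nlia).
  have h2 := mP [:: j.+1, (k - j)%N & l].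
  rewrite /= lp subn_gt0 jk /= in h2; have {}h2 := h2 isT ltac:(nlia).
  have C0 : 0 <= k0 ^+ 2 * eps ^+ 2 * B * E by rewrite !mulr_ge0 ?exprn_ge0 // ?ltW.
  have g1 : `|tail_form (tail_form m (k - j.+1)) j l| <= K%:R ^+ 2 * (k0 ^+ 2 * eps ^+ 2 * B * E).
    apply: le_trans h1 _.
    have -> : j.+1%:R * k0 * eps * ((k - j.+1).+1%:R * k0 * eps * B) * eps ^+ size l =
      (j.+1%:R * (k - j.+1).+1%:R) * (k0 ^+ 2 * eps ^+ 2 * B * E) by rewrite /E; ring.
    by rewrite ler_wpM2r // expr2 ler_pM // ler_nat; nlia.
  have g2 : `|m [:: j.+1, (k - j)%N & l]| <= K%:R ^+ 2 * (k0 ^+ 2 * eps ^+ 2 * B * E).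
    apply: le_trans h2 _; rewrite !exprS.
    have -> : B * (eps * (eps * eps ^+ size l)) = eps ^+ 2 * B * E by rewrite /E; ring.
    have -> : K%:R * (K%:R * K%:R ^+ 0) * (k0 * (k0 * k0 ^+ 0) * (eps * (eps * eps ^+ 0)) * B * E) =
     (K%:R ^+ 2 * k0 ^+ 2) * (eps ^+ 2 * B * E) by ring.
    by rewrite ler_peMl ?mulr_ge0 ?exprn_ge0 // mulr_ege1 // ?expr_ge1.
  lra.
rewrite sumr_const card_ord -mulr_natl in T2.
set C := k0 ^+ 2 * eps ^+ 2 * B * E in T1 T2.
have C0 : 0 <= C by rewrite /C !mulr_ge0 ?exprn_ge0 // ?ltW.
have -> : 3 * K%:R ^+ 3 * k0 ^+ 2 * eps ^+ 2 * B * E = 3 * K%:R ^+ 3 * C by rewrite /C; ring.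
apply: le_trans (lerD T1 T2) _.
have h3 : k%:R * (2 * K%:R ^+ 2 * C) <= K%:R * (2 * K%:R ^+ 2 * C).
  by rewrite ler_wpM2r ?ler_nat ?mulr_ge0 ?exprn_ge0 ?ler0n //; nlia.
have h4 : K%:R * C <= K%:R ^+ 3 * C.
  by rewrite ler_wpM2r // [leRHS]exprS ler_peMr // expr_ge1.
lra.
Qed.

(** The constants 12 and 8 in [K_eps] and [K_q] are four times the 3 of [split_bound] and the 2 of
    [bounded_merge], so that each half of the loop equation costs at most B / 4 in the weighted
    norm. The 1 in the maximum accounts for the empty list. *)
Lemma moment_contract B : 0 <= B -> bounded_by 0 B m -> bounded_by 0 (Num.max 1 (B / 2)) m.
Proof.
have k01 := k0_ge1; have k00 : 0 <= k0 by lra.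
have e_0 := eps_gt0; have e_1 := eps_le1.
move=> B0 mP l lp lK.
case: l lp lK => [|k l] /=.
  by move=> _ _; rewrite m_nil normr1 expr0 mulr1 le_max lexx.
move=> /andP[kp lp] kK; case: k kp kK => // k _ kK.
have Mx : B / 2 <= Num.max 1 (B / 2) by rewrite le_max lexx orbT.
have E0 : 0 <= eps ^+ size l by rewrite exprn_ge0.
rewrite m_loop // exprS.
apply: le_trans (_ : B / 2 * (eps * eps ^+ size l) <= _); last first.
  by rewrite ler_wpM2r // mulr_ge0 ?exprn_ge0 //.
apply: le_trans (ler_normD _ _) _.
have h1 := split_bound (k := k) B0 mP lp ltac:(nlia).
have h1' : `|split_form m k l| <= B / 4 * (eps * eps ^+ size l).
  apply: le_trans h1 _.
  have -> : 3 * K%:R ^+ 3 * k0 ^+ 2 * eps ^+ 2 * B * eps ^+ size l =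
    (12 * K%:R ^+ 3 * k0 ^+ 2 * eps) * (B / 4 * (eps * eps ^+ size l)) by field.
  by rewrite ler_piMl // !mulr_ge0 ?exprn_ge0 ?invr_ge0 ?ler0n //.
have h2 := @bounded_merge B k.+1 [::] l B0 mP isT isT lp ltac:(simpl; nlia).
have h2' : `|q * merge_form m k.+1 [::] l| <= B / 4 * (eps * eps ^+ size l).
  rewrite -(ler_pM2l eps_gt0) normrM (ger0_norm q_ge0).
  have -> : eps * (q * `|merge_form m k.+1 [::] l|) =
            q * (eps * `|merge_form m k.+1 [::] l|) by ring.
  apply: le_trans (ler_wpM2l q_ge0 h2) _; rewrite add0n.
  have -> : eps * (B / 4 * (eps * eps ^+ size l)) =
    eps ^+ 2 * (B / 4 * eps ^+ size l) by ring.
  have BE : 0 <= B / 4 * eps ^+ size l by rewrite !mulr_ge0 ?exprn_ge0 ?invr_ge0 ?ler0n //.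
  apply: le_trans (ler_wpM2r BE K_q).
  have -> : 8 * K%:R * K.+1%:R ^+ 2 * k0 ^+ 2 * q * (B / 4 * eps ^+ size l) =
   q * (K%:R * (2 * K.+1%:R ^+ 2 * k0 ^+ 2) * B * eps ^+ size l) by field.
  rewrite ler_wpM2l // ler_wpM2r // ler_wpM2r // ler_wpM2r ?ler_nat ?mulr_ge0 ?exprn_ge0 ?ler0n //; nlia.
lra.
Qed.

(* The quadratic and merging terms of the loop equation gain a small factor, so
   any a priori bound improves by a factor 2 until it reaches 1. *)
Lemma moment_bound B : bounded_by 0 B m -> bounded_by 0 1 m.
Proof.
move=> mP; have B0 : 0 <= B.
  have := mP [::] isT isT; rewrite m_nil normr1 expr0 mulr1; exact: le_trans.
have H j : bounded_by 0 (Num.max 1 (B / 2 ^+ j)) m.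
  elim: j => [|j IH]; first by apply: bounded_byW mP; rewrite // expr0 divr1 le_max lexx orbT.
  have := moment_contract _ IH; rewrite le_max ler01 => /(_ isT).
  apply: bounded_byW => //; rewrite ge_max le_max lexx /=.
  case: (lerP 1 (B / 2 ^+ j)) => h.
    by rewrite le_max exprS invfM mulrCA mulrC lexx orbT.
  by rewrite le_max; apply/orP; left; lra.
move: (H (Num.truncn B).+1); apply: bounded_byW => //.
rewrite ge_max lexx /= ler_pdivrMr ?exprn_gt0 // mul1r.
apply: ltW; apply: lt_le_trans (_ : (2 ^ (Num.truncn B).+1)%:R <= _); last by rewrite natrX.
apply: lt_le_trans (_ : ((Num.truncn B).+1)%:R <= _); last by rewrite ler_nat ltnW // ltn_expl.
by apply: truncnS_gt.
Qed.

End LoopRecursion.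

(** * Complex matrices and the largest eigenvalue of a Gram matrix *)

Section ComplexMatrices.
Context {R : realType}.
Local Notation C := (complex R).

Definition rc (x : R) : C := (x%:C)%C.

Lemma rcD : {morph rc : x y / x + y}. Proof. exact: rmorphD. Qed.
Lemma rcB : {morph rc : x y / x - y}. Proof. exact: rmorphB. Qed.
Lemma rcM : {morph rc : x y / x * y}. Proof. exact: rmorphM. Qed.
Lemma rcV : {morph rc : x / x^-1}. Proof. exact: fmorphV. Qed.
Lemma rcX k : {morph rc : x / x ^+ k}. Proof. exact: rmorphXn. Qed.
Lemma rc_nat k : rc k%:R = k%:R. Proof. exact: rmorph_nat. Qed.
Lemma rc1 : rc 1 = 1. Proof. by []. Qed.
Lemma rc_inj : injective rc. Proof. by move=> x y []. Qed.
Lemma rc_sum I (r : seq I) (P : pred I) (F : I -> R) :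
  rc (\sum_(i <- r | P i) F i) = \sum_(i <- r | P i) rc (F i).
Proof. exact: rmorph_sum. Qed.
Lemma conj_rc x : Num.conj (rc x) = rc x.
Proof. by rewrite conj_Creal //; apply/complex_realP; exists x. Qed.

Lemma cReD (x y : C) : complex.Re (x + y) = complex.Re x + complex.Re y.
Proof. by case: x y => ? ? []. Qed.
Lemma cImD (x y : C) : complex.Im (x + y) = complex.Im x + complex.Im y.
Proof. by case: x y => ? ? []. Qed.
Lemma cReM (x y : C) :
  complex.Re (x * y) = complex.Re x * complex.Re y - complex.Im x * complex.Im y.
Proof. by case: x y => ? ? []. Qed.
Lemma cImM (x y : C) :
  complex.Im (x * y) = complex.Re x * complex.Im y + complex.Im x * complex.Re y.
Proof. by case: x y => ? ? []. Qed.
Lemma conjE (x : C) : Num.conj x = (complex.Re x -i* complex.Im x)%C.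
Proof. by case: x. Qed.

Lemma adjmxE m n (M : 'M[C]_(m, n)) i j : adjmx M i j = Num.conj (M j i).
Proof. by rewrite /adjmx !mxE. Qed.

Lemma adjmxM m n p (M : 'M[C]_(m, n)) (L : 'M[C]_(n, p)) :
  adjmx (M *m L) = adjmx L *m adjmx M.
Proof. by rewrite /adjmx map_mxM trmx_mul. Qed.

Lemma adjmxK m n (M : 'M[C]_(m, n)) : adjmx (adjmx M) = M.
Proof. by apply/matrixP => i j; rewrite !adjmxE conjCK. Qed.

Lemma adjmxD m n (M L : 'M[C]_(m, n)) : adjmx (M + L) = adjmx M + adjmx L.
Proof. by apply/matrixP => i j; rewrite /adjmx !mxE rmorphD. Qed.

Lemma adjmxN m n (M : 'M[C]_(m, n)) : adjmx (- M) = - adjmx M.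
Proof. by apply/matrixP => i j; rewrite /adjmx !mxE rmorphN. Qed.

Lemma adjmxZ m n (x : C) (M : 'M[C]_(m, n)) : adjmx (x *: M) = Num.conj x *: adjmx M.
Proof. by apply/matrixP => i j; rewrite /adjmx !mxE rmorphM. Qed.

Lemma adjmx1 n : adjmx (1%:M : 'M[C]_n) = 1%:M.
Proof. by apply/matrixP => i j; rewrite adjmxE !mxE eq_sym conjC_nat. Qed.

Lemma adjmx_trC m n (M : 'M[C]_(m, n)) : adjmx M = (M ^t Num.conj)%sesqui.
Proof. by rewrite /adjmx map_trmx. Qed.

Lemma unitary_adj n (V : 'M[C]_n) : V \is unitarymx -> V *m adjmx V = 1%:M.
Proof. by move/unitarymxP; rewrite adjmx_trC. Qed.

Lemma unitary_adjl n (V : 'M[C]_n) : V \is unitarymx -> adjmx V *m V = 1%:M.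
Proof. by move/unitary_adj/mulmx1C. Qed.

Lemma unitary_of_adj n (V : 'M[C]_n) : V *m adjmx V = 1%:M -> V \is unitarymx.
Proof. by move=> h; apply/unitarymxP; rewrite -adjmx_trC. Qed.

Lemma mul_col m n p (M : 'M[C]_(m, n)) (L : 'M[C]_(n, p)) j :
  col j (M *m L) = M *m col j L.
Proof. by apply/colP => i; rewrite !mxE; apply: eq_bigr => k _; rewrite !mxE. Qed.

(** Real-valued and rectangular, so that one function serves as squared norm of columns and as
    squared Frobenius norm, and can be compared in R. *)
Definition frob2 m n (M : 'M[C]_(m, n)) : R :=
  \sum_i \sum_j (complex.Re (M i j) ^+ 2 + complex.Im (M i j) ^+ 2).

Lemma frob2_ge0 m n (M : 'M[C]_(m, n)) : 0 <= frob2 M.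
Proof. by apply: sumr_ge0 => i _; apply: sumr_ge0 => j _; rewrite addr_ge0 ?sqr_ge0. Qed.

Lemma rc_sqr2 (z : C) : rc (complex.Re z ^+ 2 + complex.Im z ^+ 2) = Num.conj z * z.
Proof. by rewrite /rc add_Re2_Im2 normCKC. Qed.

Lemma frob2_tr m n (M : 'M[C]_(m, n)) : rc (frob2 M) = \tr (adjmx M *m M).
Proof.
rewrite /frob2 exchange_big /= rc_sum /mxtrace.
apply: eq_bigr => i _; rewrite mxE rc_sum; apply: eq_bigr => j _.
by rewrite rc_sqr2 adjmxE.
Qed.

Lemma frob2_adj m n (M : 'M[C]_(m, n)) : frob2 (adjmx M) = frob2 M.
Proof. by apply: rc_inj; rewrite !frob2_tr adjmxK mxtrace_mulC. Qed.

Lemma frob2_eq0 m n (M : 'M[C]_(m, n)) : frob2 M = 0 -> M = 0.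
Proof.
move=> /eqP; rewrite psumr_eq0 => [/allP h|i _]; last first.
  by apply: sumr_ge0 => j _; rewrite addr_ge0 ?sqr_ge0.
apply/matrixP => i j; rewrite mxE.
have /eqP := h i (mem_index_enum _).
move=> /eqP; rewrite psumr_eq0 => [/allP g|k _]; last by rewrite addr_ge0 ?sqr_ge0.
have := g j (mem_index_enum _); rewrite /= paddr_eq0 ?sqr_ge0 // !sqrf_eq0.
by case: (M i j) => x y /= /andP[/eqP -> /eqP ->].
Qed.

Lemma frob2_gt0 m n (M : 'M[C]_(m, n)) : M != 0 -> 0 < frob2 M.
Proof. by move=> M0; rewrite lt_def frob2_ge0 andbT; apply: contraNneq M0 => /frob2_eq0 ->. Qed.

Lemma frob2Z m n (x : C) (M : 'M[C]_(m, n)) :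
  frob2 (x *: M) = (complex.Re x ^+ 2 + complex.Im x ^+ 2) * frob2 M.
Proof.
rewrite /frob2 mulr_sumr; apply: eq_bigr => i _; rewrite mulr_sumr; apply: eq_bigr => j _.
by rewrite mxE cReM cImM; ring.
Qed.

Lemma frob2Zr m n (x : R) (M : 'M[C]_(m, n)) : frob2 (rc x *: M) = x ^+ 2 * frob2 M.
Proof. by rewrite frob2Z /= expr0n addr0. Qed.

Lemma frob2_unitary n p (V : 'M[C]_n) (M : 'M[C]_(n, p)) :
  adjmx V *m V = 1%:M -> frob2 (V *m M) = frob2 M.
Proof.
move=> h; apply: rc_inj; rewrite !frob2_tr adjmxM -mulmxA (mulmxA (adjmx V)) h mul1mx //.
Qed.

Lemma cauchy_schwarz_row n (u : 'rV[C]_n) (v : 'cV[C]_n) :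
  complex.Re ((u *m v) ord0 ord0) ^+ 2 + complex.Im ((u *m v) ord0 ord0) ^+ 2
  <= frob2 u * frob2 v.
Proof.
have h : `|dotmx u (adjmx v)| ^+ 2 <= dotmx u u * dotmx (adjmx v) (adjmx v).
  by have [] := CauchySchwarz (@dotmx C n) u (adjmx v).
rewrite !dotmxE -!adjmx_trC adjmxK in h.
rewrite -add_Re2_Im2 in h.
have e1 : (u *m adjmx u) 0 0 = rc (frob2 u).
  by rewrite -frob2_adj frob2_tr adjmxK /mxtrace big_ord_recl big_ord0 addr0.
have e2 : (adjmx v *m v) 0 0 = rc (frob2 v).
  by rewrite frob2_tr /mxtrace big_ord_recl big_ord0 addr0.
by rewrite e1 e2 -rcM -[leLHS]/(rc _) /rc lecR in h.
Qed.

Lemma frob2_mul m n p (M : 'M[C]_(m, n)) (L : 'M[C]_(n, p)) :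
  frob2 (M *m L) <= frob2 M * frob2 L.
Proof.
have rowE q (K : 'M[C]_(q, n)) : frob2 K = \sum_i frob2 (row i K).
  rewrite /frob2; apply: eq_bigr => i _; rewrite big_ord_recl big_ord0 addr0.
  by apply: eq_bigr => j _; rewrite !mxE.
have colE q (K : 'M[C]_(n, q)) : frob2 K = \sum_i frob2 (col i K).
  rewrite /frob2 exchange_big; apply: eq_bigr => i _.
  by apply: eq_bigr => j _; rewrite big_ord_recl big_ord0 addr0 !mxE.
rewrite [frob2 M]rowE [frob2 L]colE mulr_suml; apply: ler_sum => i _.
rewrite mulr_sumr; apply: ler_sum => j _.
have := cauchy_schwarz_row (row i M) (col j L).
have -> // : (row i M *m col j L) ord0 ord0 = (M *m L) i j.
by rewrite !mxE; apply: eq_bigr => k _; rewrite !mxE.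
Qed.

Lemma vnormE n (v : 'cV[C]_n) : vnorm v = Num.sqrt (frob2 v).
Proof.
by rewrite /vnorm /frob2; congr Num.sqrt; apply: eq_bigr => i _; rewrite big_ord_recl big_ord0 addr0.
Qed.

Lemma cauchy_schwarz_col n (u v : 'cV[C]_n) :
  complex.Re ((adjmx u *m v) ord0 ord0) ^+ 2 <= frob2 u * frob2 v.
Proof.
apply: le_trans (_ : _ <= frob2 (adjmx u) * frob2 v) _; last by rewrite frob2_adj.
by apply: le_trans (cauchy_schwarz_row _ _); rewrite lerDl sqr_ge0.
Qed.

Section TopEigenvalue.
Variables (n p : nat) (B : 'M[C]_(n.+1, p)).
Let X := B *m adjmx B.

Lemma gram_spectral : exists (P : 'M[C]_n.+1) (d : 'I_n.+1 -> R),
  [/\ P *m adjmx P = 1%:M, adjmx P *m P = 1%:M &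
      X = adjmx P *m diag_mx (\row_i rc (d i)) *m P].
Proof.
have Xh : X \is hermsymmx.
  by rewrite is_hermitianmxE expr0 scale1r -adjmx_trC /X adjmxM adjmxK.
have Xn := hermitian_normalmx Xh.
have Xr := hermitian_spectral_diag_real Xh.
have Pu := spectral_unitarymx X.
exists (spectralmx X), (fun i => complex.Re (spectral_diag X 0 i)).
split; [exact: unitary_adj | exact: unitary_adjl |].
have -> : adjmx (spectralmx X) = invmx (spectralmx X).
  by rewrite adjmx_trC (invmx_unitary Pu).
have {1}-> := orthomx_spectralP Xn.
congr (_ *m diag_mx _ *m _).
apply/rowP => i; rewrite mxE; have /mxOverP/(_ 0 i) := Xr.
by move=> /RRe_real.
Qed.

(** The Rayleigh bound is stated for q columns at once because the test objects of the lower edge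
    are square matrices. *)
Lemma top_eigen : exists (lam : R) (x : 'cV[C]_n.+1),
  [/\ x != 0, X *m x = rc lam *: x &
      forall q (y : 'M[C]_(n.+1, q)), frob2 (adjmx B *m y) <= lam * frob2 y].
Proof.
have [P [d [PP' P'P XE]]] := gram_spectral.
pose i0 := [arg max_(i > ord0) d i]%O.
have i0P i : d i <= d i0 by rewrite /i0; case: arg_maxP => // j _; apply.
exists (d i0), (col i0 (adjmx P)); split.
- apply/eqP => /(congr1 (fun y => P *m y)); rewrite mulmx0 -mul_col PP' => h.
  have := congr1 (fun y : 'cV[C]_n.+1 => y i0 ord0) h; rewrite !mxE eqxx.
  by move/eqP; rewrite oner_eq0.
- rewrite XE -mulmxA -mul_col PP' -mulmxA.
  have -> : diag_mx (\row_i rc (d i)) *m col i0 (1%:M : 'M[C]_n.+1) =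
            rc (d i0) *: col i0 1%:M.
    apply/colP => j; rewrite mul_diag_mx !mxE; case: eqVneq => [->//|_]; by rewrite !mulr0.
  by rewrite -scalemxAr -mul_col mulmx1.
- move=> q y.
  have -> : frob2 y = frob2 (P *m y) by rewrite frob2_unitary.
  have -> : frob2 (adjmx B *m y) =
      \sum_i d i * \sum_j (complex.Re ((P *m y) i j) ^+ 2 + complex.Im ((P *m y) i j) ^+ 2).
    apply: rc_inj; rewrite frob2_tr adjmxM adjmxK mulmxA -(mulmxA _ B) -/X XE.
    rewrite -!mulmxA (mulmxA (adjmx y)) -adjmxM.
    rewrite mul_diag_mx rc_sum mxtrace_mulC /mxtrace.
    apply: eq_bigr => i _; rewrite mxE rcM rc_sum mulr_sumr; apply: eq_bigr => j _.
    by rewrite rc_sqr2 mxE adjmxE mxE; ring.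
  rewrite /frob2 mulr_sumr; apply: ler_sum => i _; rewrite ler_wpM2r //.
  by apply: sumr_ge0 => j _; rewrite addr_ge0 ?sqr_ge0.
Qed.

Lemma gram_form q (y : 'M[C]_(n.+1, q)) : rc (frob2 (adjmx B *m y)) = \tr (adjmx y *m (X *m y)).
Proof. by rewrite frob2_tr adjmxM adjmxK /X !mulmxA. Qed.

Lemma lambda_max_top lam (x : 'cV[C]_n.+1) :
  x != 0 -> X *m x = rc lam *: x ->
  (forall q (y : 'M[C]_(n.+1, q)), frob2 (adjmx B *m y) <= lam * frob2 y) ->
  lambda_max X = lam.
Proof.
move=> x0 Xx ub; rewrite /lambda_max; set E := [set _ | _].
have XX : adjmx X = X by rewrite /X adjmxM adjmxK.
(* [eigenvalue] refers to row vectors; X being Hermitian, the adjoint carries column eigenvectors to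
   row eigenvectors. *)
have Elam : E lam.
  apply/eigenvalueP; exists (adjmx x).
    by rewrite -{1}XX -adjmxM Xx adjmxZ conj_rc.
  by apply: contra x0 => /eqP h; rewrite -(adjmxK x) h; apply/eqP/matrixP=> i j; rewrite adjmxE !mxE conjC0.
have Eub : ubound E lam.
  move=> a /eigenvalueP[v va v0].
  have Xv : X *m adjmx v = rc a *: adjmx v by rewrite -{1}XX -adjmxM va adjmxZ conj_rc.
  have v0' : adjmx v != 0.
    apply: contra v0 => /eqP h; rewrite -(adjmxK v) h; apply/eqP/matrixP=> i j.
    by rewrite adjmxE !mxE conjC0.
  have := ub _ (adjmx v).
  have -> : frob2 (adjmx B *m adjmx v) = a * frob2 (adjmx v).
    apply: rc_inj; rewrite gram_form Xv rcM frob2_tr -scalemxAr mxtraceZ //.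
  by rewrite ler_pM2r // frob2_gt0.
apply/eqP; rewrite eq_le; apply/andP; split; first by apply: ge_sup => //; exists lam.
by apply: ub_le_sup => //; exists lam.
Qed.

Lemma lambda_maxP : exists x : 'cV[C]_n.+1,
  [/\ x != 0, X *m x = rc (lambda_max X) *: x &
      forall q (y : 'M[C]_(n.+1, q)), frob2 (adjmx B *m y) <= lambda_max X * frob2 y].
Proof.
have [lam [x [x0 Xx ub]]] := top_eigen.
by exists x; rewrite (lambda_max_top x0 Xx ub).
Qed.

Lemma lambda_max_ge0 : 0 <= lambda_max X.
Proof.
have [x [x0 _ ub]] := lambda_maxP.
by have := ub _ x; rewrite -(pmulr_lge0 _ (frob2_gt0 x0)); apply: le_trans; apply: frob2_ge0.
Qed.

(** Passage from the adjoint of B to B: by Cauchy-Schwarz |Bv|^4 is at most |v|^2 times the squared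
    norm of the adjoint of B applied to Bv, which is at most lam |Bv|^2; then |Bv|^2 cancels.
    Columns are treated one by one. *)
Lemma lambda_max_mul_le q (z : 'M[C]_(p, q)) : frob2 (B *m z) <= lambda_max X * frob2 z.
Proof.
have [x [_ _ ub]] := lambda_maxP.
have colP (v : 'cV[C]_p) : frob2 (B *m v) <= lambda_max X * frob2 v.
  have h := cauchy_schwarz_col v (adjmx B *m (B *m v)).
  have e : (adjmx v *m (adjmx B *m (B *m v))) ord0 ord0 = rc (frob2 (B *m v)).
    by rewrite frob2_tr adjmxM -!mulmxA /mxtrace big_ord_recl big_ord0 addr0.
  rewrite {}e /= in h.
  have := ub _ (B *m v); have := frob2_ge0 (B *m v); have := frob2_ge0 v.
  have l0 := lambda_max_ge0.
  set Y := frob2 (B *m v) in h *; set Z := frob2 v in h *; set w := frob2 _ in h *.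
  move=> z0 y0 hw.
  have [->|y1] := eqVneq Y 0; first by rewrite mulr_ge0.
  have yp : 0 < Y by rewrite lt_def y1.
  rewrite -(ler_pM2r yp) -expr2; apply: le_trans h _.
  by rewrite [leRHS]mulrAC [leRHS]mulrC ler_wpM2l.
have colE m (K : 'M[C]_(m, q)) : frob2 K = \sum_i frob2 (col i K).
  rewrite /frob2 exchange_big; apply: eq_bigr => i _.
  by apply: eq_bigr => j _; rewrite big_ord_recl big_ord0 addr0 !mxE.
by rewrite !colE mulr_sumr; apply: ler_sum => i _; rewrite mul_col.
Qed.

Lemma lambda_max_opnorm : lambda_max X = opnorm B ^+ 2.
Proof.
have [x [x0 Xx ub]] := lambda_maxP; have l0 := lambda_max_ge0.
set lam := lambda_max X in Xx ub l0 *.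
have Bub (v : 'cV[C]_p) : frob2 (B *m v) <= lam * frob2 v := lambda_max_mul_le v.
have -> : opnorm B = Num.sqrt lam.
  rewrite /opnorm; set E := [set _ | _ in _].
  have Eub : ubound E (Num.sqrt lam).
    move=> _ [v /= v1 <-]; rewrite vnormE.
    rewrite vnormE -[1]sqrtr1 ler_sqrt // in v1.
    rewrite ler_sqrt //; apply: le_trans (Bub v) _; rewrite ler_piMr //.
  have E0 : E 0.
    exists 0; rewrite /= ?mulmx0 vnormE /frob2 big1 ?sqrtr0 // => i _; rewrite big1 // => j _;
    by rewrite mxE /= expr0n addr0.
  apply/eqP; rewrite eq_le; apply/andP; split; first by apply: ge_sup => //; exists 0.
  have hsup : has_ubound E by exists (Num.sqrt lam).
  (* For lam = 0 the maximising vector constructed below would vanish and could not be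
     normalised. *)
  have [l00|l1] := eqVneq lam 0; first by rewrite l00 sqrtr0; apply: ub_le_sup.
  have lp : 0 < lam by rewrite lt_def l1.
  apply: ub_le_sup => //.
  have fx := frob2_gt0 x0.
  have fBx : frob2 (adjmx B *m x) = lam * frob2 x.
    by apply: rc_inj; rewrite gram_form Xx rcM frob2_tr -scalemxAr mxtraceZ.
  pose c := Num.sqrt (lam * frob2 x).
  have c0 : 0 < c by rewrite sqrtr_gt0 mulr_gt0.
  have c2 : c ^+ 2 = lam * frob2 x by rewrite sqr_sqrtr // mulr_ge0 // ltW.
  (* The norm is attained at the image of the top eigenvector under the adjoint of B, whose length
     is c. *)
  exists (rc c^-1 *: (adjmx B *m x)).
    rewrite /= vnormE frob2Zr fBx -c2 -exprMn mulVf ?gt_eqF // expr1n sqrtr1 //.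
  rewrite -scalemxAr mulmxA -/X Xx scalerA -rcM vnormE frob2Zr.
  congr Num.sqrt; rewrite exprMn exprVn c2; field.
  by rewrite !gt_eqF.
by rewrite sqr_sqrtr.
Qed.

(** The Frobenius norm dominates every eigenvalue, also for a non-normal matrix such as a power of
    cW. *)
Lemma frob2_eigen_ge (M : 'M[C]_n.+1) (mu : C) (y : 'cV[C]_n.+1) :
  y != 0 -> M *m y = mu *: y -> complex.Re mu ^+ 2 + complex.Im mu ^+ 2 <= frob2 M.
Proof.
move=> y0 My; have := frob2_mul M y; rewrite My frob2Z ler_pM2r // frob2_gt0 //.
Qed.

Lemma eigen_exp (M : 'M[C]_n.+1) (mu : C) (y : 'cV[C]_n.+1) k :
  M *m y = mu *: y -> (M ^+ k) *m y = mu ^+ k *: y.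
Proof.
move=> My; elim: k => [|k IH]; first by rewrite !expr0 mul1mx scale1r.
by rewrite !exprSr -mulmxA My -scalemxAr IH scalerA mulrC.
Qed.

(* With [frob2_pow_le], a sandwich that makes lambda_max a countable combination of
   polynomials in the entries, hence measurable. *)
Lemma lambda_max_pow_le k : lambda_max X ^+ k.*2 <= frob2 (X ^+ k).
Proof.
have [x [x0 Xx _]] := lambda_maxP.
have := frob2_eigen_ge x0 (eigen_exp k Xx); rewrite -rcX /= expr0n addr0.
by rewrite -exprM muln2.
Qed.

Lemma frob2_pow_le k : frob2 (X ^+ k) <= n.+1%:R * lambda_max X ^+ k.*2.
Proof.
have [x [_ _ ub]] := lambda_maxP; have l0 := lambda_max_ge0.
have Xub q (y : 'M[C]_(n.+1, q)) : frob2 (X *m y) <= lambda_max X ^+ 2 * frob2 y.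
  rewrite /X -mulmxA expr2 -mulrA; apply: le_trans (lambda_max_mul_le _) _.
  by rewrite ler_wpM2l.
elim: k => [|k IH].
  rewrite expr0 mulr1 /frob2.
  have -> : \sum_i \sum_j (complex.Re ((1 : 'M[C]_n.+1) i j) ^+ 2 +
     complex.Im ((1 : 'M[C]_n.+1) i j) ^+ 2) = \sum_(i < n.+1) (1 : R).
    apply: eq_bigr => i _; rewrite (bigD1 i) //= big1 ?addr0 => [|j ji].
      by rewrite mxE eqxx /= expr1n expr0n addr0.
    by rewrite mxE eq_sym (negbTE ji) /= expr0n addr0.
  by rewrite sumr_const card_ord.
rewrite exprS; apply: le_trans (Xub _ _) _.
apply: le_trans (ler_wpM2l (sqr_ge0 _) IH) _.
by rewrite mulrCA -exprD doubleS.
Qed.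

End TopEigenvalue.
End ComplexMatrices.

(** * Words in c and W *)

Section Words.
Variables (F : numFieldType) (n : nat).
Local Notation Mx := 'M[F]_n.+1.
Implicit Types (M c W H : Mx).

Definition ntrace M : F := (n.+1%:R)^-1 * \tr M.

Lemma ntraceD M M' : ntrace (M + M') = ntrace M + ntrace M'.
Proof. by rewrite /ntrace mxtraceD mulrDr. Qed.
Lemma ntraceB M M' : ntrace (M - M') = ntrace M - ntrace M'.
Proof. by rewrite /ntrace raddfB mulrBr. Qed.
Lemma ntrace_sum (I : finType) (G : I -> Mx) : ntrace (\sum_i G i) = \sum_i ntrace (G i).
Proof. by rewrite /ntrace raddf_sum mulr_sumr. Qed.
Lemma ntraceZ x M : ntrace (x *: M) = x * ntrace M.
Proof. by rewrite /ntrace mxtraceZ mulrCA. Qed.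
Lemma ntraceC M M' : ntrace (M * M') = ntrace (M' * M).
Proof. by rewrite /ntrace; congr (_ * _); exact: mxtrace_mulC. Qed.
Lemma ntrace1 : ntrace 1 = 1.
Proof. by rewrite /ntrace mxtrace1 mulVf // pnatr_eq0. Qed.

Variables (kap : F) (c W : Mx).
Hypotheses (c_sq : c * c = kap *: c + 1) (W_sq : W * W = 1).

(** [word_tr], [tail_tr] and [fold_tr] are the tau_k, u_k and w_(k,l) whose expectations the forms
    of the loop recursion encode. *)
Definition word_tr k := ntrace ((c * W) ^+ k).
Definition tail_tr k := ntrace ((c * W) ^+ k * c).
Definition fold_tr k l := ntrace ((c * W) ^+ k * (W * c) ^+ l).

Lemma word_swap k : c * (W * c) ^+ k = (c * W) ^+ k * c.
Proof.
elim: k => [|k IH]; first by rewrite !expr0 mulr1 mul1r.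
by rewrite exprSr mulrA IH !exprSr -!mulrA.
Qed.

Lemma word_swapW k : W * (c * W) ^+ k = (W * c) ^+ k * W.
Proof.
elim: k => [|k IH]; first by rewrite !expr0 mulr1 mul1r.
by rewrite exprSr mulrA IH !exprSr -!mulrA.
Qed.

Lemma word_tr0 : word_tr 0 = 1. Proof. by rewrite /word_tr expr0 ntrace1. Qed.

Lemma word_tr_flip k : ntrace ((W * c) ^+ k) = word_tr k.
Proof.
case: k => [|k]; first by rewrite /word_tr !expr0.
by rewrite /word_tr exprS -mulrA word_swap mulrA ntraceC mulrA -exprS.
Qed.

Lemma ntraceW_word k : ntrace (W * (c * W) ^+ k.+1) = tail_tr k.
Proof.
by rewrite ntraceC exprSr -mulrA -[c * W * W]mulrA W_sq mulr1.
Qed.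

Lemma tail_tr1 : tail_tr 1 = kap * word_tr 1 + ntrace W.
Proof.
rewrite /tail_tr /word_tr expr1 -mulrA ntraceC -mulrA c_sq mulrDr mulr1 -scalerAr ntraceD ntraceZ.
by rewrite ntraceC.
Qed.

(** Read cyclically, the two end letters c meet. The reduction of c c leaves kap times a full word,
    plus a word in which two letters W meet and cancel; the index drops by two. *)
Lemma tail_trS k : tail_tr k.+2 = kap * word_tr k.+2 + tail_tr k.
Proof.
rewrite [LHS]ntraceC exprS.
have -> : c * (c * W * (c * W) ^+ k.+1) = (c * c) * (W * (c * W) ^+ k.+1) by rewrite !mulrA.
rewrite c_sq mulrDl mul1r -scalerAl ntraceD ntraceZ ntraceW_word; congr (_ * ntrace _ + _).
by rewrite [in RHS]exprS !mulrA.
Qed.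

Lemma fold_tr0l l : fold_tr 0 l = word_tr l.
Proof. by rewrite /fold_tr expr0 mul1r word_tr_flip. Qed.
Lemma fold_tr0r k : fold_tr k 0 = word_tr k.
Proof. by rewrite /fold_tr expr0 mulr1. Qed.

(** Here the cancellation happens in the middle: W W = 1, after which c c is reduced. *)
Lemma fold_trS k l : fold_tr k.+1 l.+1 = kap * tail_tr (k + l) + fold_tr k l.
Proof.
rewrite /fold_tr exprSr exprS -!mulrA (mulrA W W) W_sq mul1r (mulrA c c) c_sq.
rewrite mulrDl mul1r mulrDr ntraceD -scalerAl -scalerAr ntraceZ word_swap.
by congr (_ * ntrace _ + _); rewrite mulrA -exprD.
Qed.

Definition word_prod l := \prod_(a <- l) word_tr a.

Lemma word_prod_cons a l : word_prod (a :: l) = word_tr a * word_prod l.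
Proof. by rewrite /word_prod big_cons. Qed.

(* Derivatives along [W -> W + t [H, W] ], H an arbitrary direction. *)
Definition dpow (Y Y1 : Mx) k : Mx := \sum_(j < k) Y ^+ j * Y1 * Y ^+ (k - j.+1).

Lemma dpowS Y Y1 k : dpow Y Y1 k.+1 = Y1 * Y ^+ k + Y * dpow Y Y1 k.
Proof.
rewrite /dpow big_ord_recl expr0 mul1r subn1; congr (_ + _).
rewrite mulr_sumr; apply: eq_bigr => j _; rewrite lift0 subSS exprS.
by rewrite -!mulrA.
Qed.

Definition dword H := c * (H * W - W * H).
Definition dword_tr H k := ntrace (dpow (c * W) (dword H) k).

Fixpoint dword_prod H (l : seq nat) : F :=
  match l with
  | [::] => 0
  | a :: l' => dword_tr H a * word_prod l' + word_tr a * dword_prod H l'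
  end.

(** Product rule for the entry (a, b) of Y^k times a product of traces. Taking H to be the matrix
    unit at (a, b) and summing over a and b contracts the open indices into traces. *)
Definition dentry H (a b : 'I_n.+1) k l : F :=
  dpow (c * W) (dword H) k a b * word_prod l + ((c * W) ^+ k) a b * dword_prod H l.

(** By cyclicity all k positions of the differentiated letter give the same trace. *)
Lemma dword_trE H k :
  dword_tr H k = k%:R * ntrace (H * ((W * c) ^+ k - (c * W) ^+ k)).
Proof.
rewrite /dword_tr; case: k => [|k].
  by rewrite /dpow big_ord0 mul0r /ntrace mxtrace0 mulr0.
have E (j : 'I_k.+1) : ntrace ((c * W) ^+ j * dword H * (c * W) ^+ (k.+1 - j.+1)) =
     ntrace (H * ((W * c) ^+ k.+1 - (c * W) ^+ k.+1)).
  rewrite ntraceC mulrA -exprD subSS subnK ?leq_ord // ntraceC /dword.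
  rewrite mulrBr mulrBl [H * (_ - _)]mulrBr !ntraceB; congr (_ - _).
    have -> : c * (H * W) * (c * W) ^+ k = c * (H * W * (c * W) ^+ k) by rewrite !mulrA.
    by rewrite [LHS]ntraceC exprSr (mulrA _ W c) -word_swapW !mulrA.
  have -> : c * (W * H) * (c * W) ^+ k = (c * W) * (H * (c * W) ^+ k) by rewrite !mulrA.
  by rewrite [LHS]ntraceC exprSr !mulrA.
rewrite /dpow ntrace_sum.
under eq_bigr => j _ do rewrite E.
by rewrite sumr_const card_ord mulr_natl.
Qed.

Fixpoint merge_tr k (l : seq nat) : F :=
  match l with
  | [::] => 0
  | a :: l' => a%:R * (fold_tr k a - word_tr (k + a)) * word_prod l'
      + word_tr a * merge_tr k l'
  end.

(** Source of splitting: one open word becomes a product of two traces. *)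
Lemma sum_delta (A B : Mx) :
  \sum_a \sum_b (A * delta_mx a b * B) a b = \tr A * \tr B.
Proof.
rewrite /mxtrace mulr_suml; apply: eq_bigr => a _; rewrite mulr_sumr; apply: eq_bigr => b _.
rewrite -mulrA -[delta_mx a b * B]/(delta_mx a b *m B).
rewrite mxE (bigD1 a) //= big1 ?addr0 => [|i ia].
  rewrite mxE (bigD1 b) //= big1 ?addr0 => [|j jb].
    by rewrite mxE !eqxx mul1r.
  by rewrite mxE (negbTE jb) andbF mul0r.
rewrite mxE big1 ?mulr0 // => j _; by rewrite mxE (negbTE ia) mul0r.
Qed.

(** Source of merging: an open word and a trace become a single trace. *)
Lemma sum_delta_tr (A B : Mx) :
  \sum_a \sum_b A a b * \tr (delta_mx a b * B) = \tr (A * B).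
Proof.
rewrite {2}/mxtrace; apply: eq_bigr => a _; rewrite mxE; apply: eq_bigr => b _.
congr (_ * _); rewrite mxtrace_mulC /mxtrace (bigD1 b) //= big1 ?addr0 => [|i ib].
  rewrite mxE (bigD1 a) //= big1 ?addr0 => [|i ia]; first by rewrite mxE !eqxx mulr1.
  by rewrite mxE (negbTE ia) mulr0.
rewrite mxE big1 // => j _; by rewrite mxE (negbTE ib) andbF mulr0.
Qed.

Lemma trE M : \tr M = n.+1%:R * ntrace M.
Proof. by rewrite /ntrace mulVKf // pnatr_eq0. Qed.

(** The 1/N of the differentiated trace normalises the merged trace, so no power of the dimension
    remains. Against the N^2 of [sum_dpow] this is the factor 1/N^2 of the merging terms. *)
Lemma sum_dword_prod k l :
  \sum_a \sum_b ((c * W) ^+ k) a b * dword_prod (delta_mx a b) l = merge_tr k l.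
Proof.
elim: l => [|x l IH] /=.
  by rewrite big1 // => a _; rewrite big1 // => b _; rewrite mulr0.
rewrite -IH !mulr_sumr.
transitivity (\sum_a (\sum_b ((c * W) ^+ k) a b * dword_tr (delta_mx a b) x * word_prod l
   + \sum_b word_tr x * (((c * W) ^+ k) a b * dword_prod (delta_mx a b) l))).
  by apply: eq_bigr => a _; rewrite -big_split; apply: eq_bigr => b _ /=; ring.
rewrite big_split /=; congr (_ + _); last first.
  by apply: eq_bigr => a _; rewrite mulr_sumr.
transitivity ((\sum_a \sum_b ((c * W) ^+ k) a b *
    \tr (delta_mx a b * ((W * c) ^+ x - (c * W) ^+ x))) * (x%:R / n.+1%:R * word_prod l)).
  rewrite mulr_suml; apply: eq_bigr => a _; rewrite mulr_suml; apply: eq_bigr => b _.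
  by rewrite dword_trE /ntrace; ring.
rewrite sum_delta_tr mulrBr -exprD raddfB /= !trE -/(fold_tr k x) -/(word_tr _).
by field; rewrite ?nat1r ?natr1 pnatr_eq0.
Qed.

Lemma sum_dpow k :
  \sum_a \sum_b dpow (c * W) (dword (delta_mx a b)) k.+1 a b =
  n.+1%:R ^+ 2 * (ntrace W * tail_tr k - word_tr k.+1
    + \sum_(j < k) (tail_tr j * tail_tr (k - j.+1) - word_tr j.+1 * word_tr (k - j))).
Proof.
have E (j : 'I_k.+1) : \sum_a \sum_b ((c * W) ^+ j * dword (delta_mx a b) *
      (c * W) ^+ (k.+1 - j.+1)) a b =
   n.+1%:R ^+ 2 * (tail_tr j * ntrace (W * (c * W) ^+ (k - j)) - word_tr j.+1 * word_tr (k - j)).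
  transitivity (\sum_a \sum_b (((c * W) ^+ j * c) * delta_mx a b * (W * (c * W) ^+ (k - j))) a b
      - \sum_a \sum_b ((c * W) ^+ j.+1 * delta_mx a b * (c * W) ^+ (k - j)) a b).
    rewrite -sumrB; apply: eq_bigr => a _; rewrite -sumrB; apply: eq_bigr => b _.
    rewrite subSS /dword exprSr.
    have -> : (c * W) ^+ j * (c * (delta_mx a b * W - W * delta_mx a b)) * (c * W) ^+ (k - j) =
      (c * W) ^+ j * c * delta_mx a b * (W * (c * W) ^+ (k - j)) -
      (c * W) ^+ j * (c * W) * delta_mx a b * (c * W) ^+ (k - j).
      by rewrite !mulrBr mulrBl !mulrA.
    by rewrite [LHS]mxE; congr (_ + _); rewrite mxE.
  by rewrite !sum_delta !trE /tail_tr /word_tr; ring.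
transitivity (\sum_(j < k.+1) n.+1%:R ^+ 2 *
   (tail_tr j * ntrace (W * (c * W) ^+ (k - j)) - word_tr j.+1 * word_tr (k - j))).
  under [RHS]eq_bigr => j _ do rewrite -E.
  rewrite [RHS]exchange_big; apply: eq_bigr => a _ /=.
  rewrite [RHS]exchange_big; apply: eq_bigr => b _ /=.
  by rewrite /dpow summxE.
(* The last position j = k has nothing to its right; it yields tr W times a tail and the term -
   tau_(k+1) for which the loop equation is solved. *)
rewrite -mulr_sumr; congr (_ * _); rewrite big_ord_recr /= subnn expr0 mulr1 word_tr0 mulr1.
rewrite addrC mulrC; congr (_ + _); apply: eq_bigr => j _.
congr (_ * _ - _).
have -> : (k - j = (k - j.+1).+1)%N by have := ltn_ord j; lia.
by rewrite ntraceW_word.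
Qed.

Lemma sum_dentry k l :
  \sum_a \sum_b dentry (delta_mx a b) a b k.+1 l =
  n.+1%:R ^+ 2 * (ntrace W * tail_tr k - word_tr k.+1
    + \sum_(j < k) (tail_tr j * tail_tr (k - j.+1) - word_tr j.+1 * word_tr (k - j)))
    * word_prod l + merge_tr k.+1 l.
Proof.
rewrite -sum_dpow -sum_dword_prod mulr_suml -big_split; apply: eq_bigr => a _ /=.
by rewrite mulr_suml -big_split.
Qed.

End Words.

(** * Expectations of bounded functions *)

Section BoundedExpectation.
Context {R : realType} d (T : measurableType d) (P : probability T R) (D : set T).
Hypotheses (mD : measurable D) (PD : P D = 1%E).
Local Notation C := (complex R).

(** Measurability is global but the bound holds only on D, an event of full probability: the random
    matrix is unitary, hence bounded, only almost surely. *)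
Definition bounded_real (f : T -> R) : Prop :=
  measurable_fun setT f /\ exists k : R, forall w, D w -> `|f w| <= k.

Definition expect (f : T -> R) : R := \int[P]_(w in D) f w.

Lemma bounded_real_integrable f : bounded_real f -> P.-integrable D (EFin \o f).
Proof.
move=> [mf [k fk]]; apply: measurable_bounded_integrable => //.
- by apply: (@eq_ind_r _ 1%E (fun x => (x < +oo)%E)) PD; exact: ltry.
- exact: measurable_funS mf.
- exists k; split; first exact: num_real.
  by move=> x kx w Dw; apply: le_trans (fk w Dw) (ltW kx).
Qed.

Lemma bounded_real_cst x : bounded_real (fun=> x).
Proof. by split; [exact: measurable_cst | exists `|x|]. Qed.

Lemma bounded_realD f g : bounded_real f -> bounded_real g -> bounded_real (fun w => f w + g w).
Proof.
move=> [mf [k fk]] [mg [l gl]]; split; first exact: measurable_funD.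
by exists (k + l) => w Dw; rewrite (le_trans (ler_normD _ _)) // lerD; auto.
Qed.

Lemma bounded_realM f g : bounded_real f -> bounded_real g -> bounded_real (fun w => f w * g w).
Proof.
move=> [mf [k fk]] [mg [l gl]]; split; first exact: measurable_funM.
by exists (k * l) => w Dw; rewrite normrM ler_pM; auto.
Qed.

Lemma bounded_realZ x f : bounded_real f -> bounded_real (fun w => x * f w).
Proof. by move=> bf; apply: bounded_realM => //; exact: bounded_real_cst. Qed.

Lemma bounded_realN f : bounded_real f -> bounded_real (fun w => - f w).
Proof.
move=> /(bounded_realZ (-1)); congr bounded_real; apply/funext => w; by rewrite mulN1r.
Qed.

Lemma bounded_realB f g : bounded_real f -> bounded_real g -> bounded_real (fun w => f w - g w).
Proof. by move=> bf bg; apply: bounded_realD => //; exact: bounded_realN. Qed.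

Lemma expectD f g : bounded_real f -> bounded_real g -> expect (fun w => f w + g w) = expect f + expect g.
Proof. by move=> bf bg; apply: RintegralD => //; exact: bounded_real_integrable. Qed.

Lemma expectZ x f : bounded_real f -> expect (fun w => x * f w) = x * expect f.
Proof. by move=> bf; apply: RintegralZl => //; exact: bounded_real_integrable. Qed.

Lemma expectN f : bounded_real f -> expect (fun w => - f w) = - expect f.
Proof.
by move=> bf; rewrite -mulN1r -expectZ //; congr expect; apply/funext => w; rewrite mulN1r.
Qed.

Lemma expect_cst x : expect (fun=> x) = x.
Proof.
rewrite /expect Rintegral_cst //.
by transitivity (x * fine (P D)); rewrite // PD mulr1.
Qed.

Lemma expect_eq f g : (forall w, D w -> f w = g w) -> expect f = expect g.
Proof. by move=> fg; apply: eq_Rintegral => w; rewrite inE => /fg. Qed.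

Lemma expect_le f g : bounded_real f -> bounded_real g -> (forall w, D w -> f w <= g w) -> expect f <= expect g.
Proof. by move=> bf bg h; apply: le_Rintegral => //; exact: bounded_real_integrable. Qed.

Lemma expect_norm_le f k : bounded_real f -> (forall w, D w -> `|f w| <= k) -> `|expect f| <= k.
Proof.
move=> bf h; rewrite ler_norml; apply/andP; split.
  rewrite -[- k]expect_cst; apply: expect_le => //; first exact: bounded_real_cst.
  by move=> w Dw; have := h w Dw; rewrite ler_norml => /andP[].
rewrite -[leRHS]expect_cst; apply: expect_le => //; first exact: bounded_real_cst.
by move=> w Dw; have := h w Dw; rewrite ler_norml => /andP[].
Qed.

Lemma bounded_real_sum (I : Type) (r : seq I) (f : I -> T -> R) :
  (forall i, bounded_real (f i)) -> bounded_real (fun w => \sum_(i <- r) f i w).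
Proof.
move=> bf; elim: r => [|i r IH].
  by under eq_fun do rewrite big_nil; exact: bounded_real_cst.
by under eq_fun do rewrite big_cons; exact: bounded_realD.
Qed.

Lemma expect_sum (I : Type) (r : seq I) (f : I -> T -> R) : (forall i, bounded_real (f i)) ->
  expect (fun w => \sum_(i <- r) f i w) = \sum_(i <- r) expect (f i).
Proof.
move=> bf; elim: r => [|i r IH].
  by under eq_fun do rewrite big_nil; rewrite expect_cst big_nil.
under eq_fun do rewrite big_cons; rewrite expectD ?IH ?big_cons //; exact: bounded_real_sum.
Qed.

Lemma bounded_real_markov f (x : R) : bounded_real f -> (forall w, D w -> 0 <= f w) -> 0 < x ->
  (P ([set w | (x <= f w)%R] `&` D) <= (expect f / x)%:E)%E.
Proof.
move=> bf f0 x0; have mf := bf.1.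
set A := [set w | _] `&` D.
have mA : measurable A.
  apply: measurableI => //; rewrite -[X in measurable X]setTI.
  have -> : [set w | x <= f w] = f @^-1` `[x, +oo[%classic.
    by apply/seteqP; split=> w /=; rewrite in_itv /= andbT.
  exact: mf.
have iA : bounded_real (\1_A : T -> R).
  split; first exact: measurable_indic.
  by exists 1 => w _; rewrite indicE; case: (_ \in _); rewrite ?normr0 ?normr1.
have h : expect (fun w => x * \1_A w) <= expect f.
  apply: expect_le => //; first exact: bounded_realZ.
  move=> w Dw; rewrite indicE; case: (boolP (w \in A)) => [|_].
    by rewrite inE => -[/= xf _]; rewrite mulr1.
  by rewrite mulr0 f0.
rewrite expectZ // in h.
have hA : expect (\1_A : T -> R) = fine (P A).
  rewrite /expect /Rintegral; congr fine; rewrite integral_indic //.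
  by congr (P _); rewrite setIidl // /A => w [].
have PAfin : P A \is a fin_num.
  by rewrite fin_num_measure.
rewrite -(fineK PAfin) lee_fin -hA ler_pdivlMr // mulrC //.
Qed.

Definition bounded_cplx (f : T -> C) : Prop :=
  [/\ measurable_fun setT (fun w => complex.Re (f w)),
      measurable_fun setT (fun w => complex.Im (f w)) &
      exists k : R, forall w, D w -> `|f w| <= rc k].

Lemma normc_Re_le (z : C) k : `|z| <= rc k -> `|complex.Re z| <= k.
Proof. by move=> h; have := le_trans (normc_ge_Re z) h; rewrite /rc lecR. Qed.

Lemma normc_Im_le (z : C) k : `|z| <= rc k -> `|complex.Im z| <= k.
Proof.
move=> h; rewrite -normrN -ReiNIm; apply: normc_Re_le; rewrite normrM.
by rewrite (_ : `|'i%C : C| = 1) ?mulr1 // normc_def /= expr0n expr1n add0r sqrtr1.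
Qed.

Lemma bounded_cplx_Re f : bounded_cplx f -> bounded_real (fun w => complex.Re (f w)).
Proof. by move=> [mr _ [k fk]]; split=> //; exists k => w /fk /normc_Re_le. Qed.
Lemma bounded_cplx_Im f : bounded_cplx f -> bounded_real (fun w => complex.Im (f w)).
Proof. by move=> [_ mi [k fk]]; split=> //; exists k => w /fk /normc_Im_le. Qed.

Lemma bounded_cplx_cst z : bounded_cplx (fun=> z).
Proof.
split; try exact: measurable_cst.
by exists (Num.sqrt (complex.Re z ^+ 2 + complex.Im z ^+ 2)) => w _; rewrite /rc -normc_def.
Qed.

Lemma bounded_cplxD f g : bounded_cplx f -> bounded_cplx g -> bounded_cplx (fun w => f w + g w).
Proof.
move=> [mr mi [k fk]] [mr' mi' [l gl]]; split.
- by under eq_fun do rewrite cReD; exact: measurable_funD.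
- by under eq_fun do rewrite cImD; exact: measurable_funD.
- by exists (k + l) => w Dw; rewrite rcD (le_trans (ler_normD _ _)) // lerD; auto.
Qed.

Lemma bounded_cplxM f g : bounded_cplx f -> bounded_cplx g -> bounded_cplx (fun w => f w * g w).
Proof.
move=> [mr mi [k fk]] [mr' mi' [l gl]]; split.
- by under eq_fun do rewrite cReM; apply: measurable_funB; exact: measurable_funM.
- by under eq_fun do rewrite cImM; apply: measurable_funD; exact: measurable_funM.
- by exists (k * l) => w Dw; rewrite rcM normrM ler_pM; auto.
Qed.

Lemma bounded_cplxZ z f : bounded_cplx f -> bounded_cplx (fun w => z * f w).
Proof. by move=> bf; apply: bounded_cplxM => //; exact: bounded_cplx_cst. Qed.

Lemma bounded_cplx_sum (I : Type) (r : seq I) (f : I -> T -> C) :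
  (forall i, bounded_cplx (f i)) -> bounded_cplx (fun w => \sum_(i <- r) f i w).
Proof.
move=> bf; elim: r => [|i r IH].
  by under eq_fun do rewrite big_nil; exact: bounded_cplx_cst.
by under eq_fun do rewrite big_cons; exact: bounded_cplxD.
Qed.

Lemma bounded_cplxB f g : bounded_cplx f -> bounded_cplx g -> bounded_cplx (fun w => f w - g w).
Proof.
move=> bf bg; have := bounded_cplxD bf (bounded_cplxZ (-1) bg); congr bounded_cplx.
by apply/funext => w; rewrite mulN1r.
Qed.

Definition expectC (f : T -> C) : C :=
  (expect (fun w => complex.Re (f w)) +i* expect (fun w => complex.Im (f w)))%C.

Lemma expectC_eq f g : (forall w, D w -> f w = g w) -> expectC f = expectC g.
Proof. by move=> fg; rewrite /expectC; congr Complex; apply: expect_eq => w /fg ->. Qed.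

Lemma expectCD f g : bounded_cplx f -> bounded_cplx g -> expectC (fun w => f w + g w) = expectC f + expectC g.
Proof.
move=> bf bg; rewrite /expectC.
under eq_fun do rewrite cReD; under [X in (_ +i* expect X)%C]eq_fun do rewrite cImD.
by rewrite !expectD //; first [exact: bounded_cplx_Re | exact: bounded_cplx_Im].
Qed.

Lemma expectCZ z f : bounded_cplx f -> expectC (fun w => z * f w) = z * expectC f.
Proof.
move=> bf; rewrite /expectC; have br := bounded_cplx_Re bf; have bi := bounded_cplx_Im bf.
under eq_fun do rewrite cReM; under [X in (_ +i* expect X)%C]eq_fun do rewrite cImM.
rewrite !expectD ?expectN ?expectZ //; try exact: bounded_realZ; first by case: z.
by apply: bounded_realN; exact: bounded_realZ.
Qed.

Lemma expectC0 : expectC (fun=> 0) = 0.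
Proof. by rewrite /expectC /= !expect_cst. Qed.

Lemma expectCB f g : bounded_cplx f -> bounded_cplx g -> expectC (fun w => f w - g w) = expectC f - expectC g.
Proof.
move=> bf bg; rewrite -[- expectC g]mulN1r -expectCZ // -expectCD //; last exact: bounded_cplxZ.
by congr expectC; apply/funext => w; rewrite mulN1r.
Qed.

Lemma expectC_sum (I : Type) (r : seq I) (f : I -> T -> C) : (forall i, bounded_cplx (f i)) ->
  expectC (fun w => \sum_(i <- r) f i w) = \sum_(i <- r) expectC (f i).
Proof.
move=> bf; elim: r => [|i r IH].
  by under eq_fun do rewrite big_nil; rewrite big_nil expectC0.
under eq_fun do rewrite big_cons; rewrite big_cons expectCD ?IH //; exact: bounded_cplx_sum.
Qed.

(** An expansion at t = 0 whose remainder is bounded uniformly on D. It is stable under sums and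
    products and lets a derivative pass under the expectation by an elementary estimate. *)
Definition first_order (f : R -> T -> C) (f0 f1 : T -> C) : Prop :=
  [/\ bounded_cplx f0, bounded_cplx f1, (forall t, bounded_cplx (f t)) &
   exists r : R -> T -> C, exists k : R, forall t w, `|t| <= 1 -> D w ->
     f t w = f0 w + rc t * f1 w + rc t ^+ 2 * r t w /\ `|r t w| <= rc k].

Lemma first_order_cst f : bounded_cplx f -> first_order (fun=> f) f (fun=> 0).
Proof.
move=> bf; split=> //; first exact: bounded_cplx_cst.
exists (fun _ _ => 0), 0 => t w _ _; rewrite normr0; split=> //; ring.
Qed.

Lemma first_orderD f f0 f1 g g0 g1 : first_order f f0 f1 -> first_order g g0 g1 ->
  first_order (fun t w => f t w + g t w) (fun w => f0 w + g0 w) (fun w => f1 w + g1 w).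
Proof.
move=> [a b c [r [k rk]]] [a' b' c' [s [l sl]]]; split; try (by apply: bounded_cplxD).
  by move=> t; apply: bounded_cplxD.
exists (fun t w => r t w + s t w), (k + l) => t w t1 Dw.
have [-> h] := rk t w t1 Dw; have [-> h'] := sl t w t1 Dw; split; first ring.
by rewrite rcD (le_trans (ler_normD _ _)) // lerD.
Qed.

Lemma first_orderM f f0 f1 g g0 g1 : first_order f f0 f1 -> first_order g g0 g1 ->
  first_order (fun t w => f t w * g t w) (fun w => f0 w * g0 w)
      (fun w => f1 w * g0 w + f0 w * g1 w).
Proof.
move=> [a b c [r [k rk]]] [a' b' c' [s [l sl]]]; split; first exact: bounded_cplxM.
- by apply: bounded_cplxD; apply: bounded_cplxM.
- by move=> t; apply: bounded_cplxM.
have [_ _ [k0 h0]] := a; have [_ _ [k1 h1]] := b.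
have [_ _ [l0 g0']] := a'; have [_ _ [l1 g1']] := b'.
exists (fun t w => f0 w * s t w + r t w * g0 w + f1 w * g1 w
   + rc t * (f1 w * s t w + r t w * g1 w) + rc t ^+ 2 * (r t w * s t w)).
exists (k0 * l + k * l0 + k1 * l1 + 1 * (k1 * l + k * l1) + 1 ^+ 2 * (k * l)).
move=> t w t1 Dw.
have [-> h] := rk t w t1 Dw; have [-> h'] := sl t w t1 Dw; split; first ring.
have tt : `|rc t| <= rc 1 by rewrite normc_def /= expr0n addr0 sqrtr_sqr /rc lecR.
have M (z z' : C) (x y : R) : `|z| <= rc x -> `|z'| <= rc y -> `|z * z'| <= rc (x * y).
  by move=> *; rewrite normrM rcM ler_pM.
have A (z z' : C) (x y : R) : `|z| <= rc x -> `|z'| <= rc y -> `|z + z'| <= rc (x + y).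
  by move=> *; rewrite rcD (le_trans (ler_normD _ _)) // lerD.
have := h0 w Dw; have := h1 w Dw; have := g0' w Dw; have := g1' w Dw => ? ? ? ?.
apply: (A); last by rewrite !expr2; apply: (M); apply: (M).
apply: (A); last by apply: (M) => //; apply: (A); apply: (M).
by apply: (A); [apply: (A)|]; apply: (M).
Qed.

Lemma first_order_sum (I : Type) (r : seq I) f f0 f1 : (forall i : I, first_order (f i) (f0 i) (f1 i)) ->
  first_order (fun t w => \sum_(i <- r) f i t w) (fun w => \sum_(i <- r) f0 i w)
      (fun w => \sum_(i <- r) f1 i w).
Proof.
move=> h; elim: r => [|i r IH].
  have := first_order_cst (bounded_cplx_cst 0); congr first_order; do ?apply/funext => ?; by rewrite big_nil.
have := first_orderD (h i) IH; congr first_order; do ?apply/funext => ?; by rewrite big_cons.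
Qed.

Lemma first_order_eq f f0 f1 g0 g1 : (forall w, f0 w = g0 w) -> (forall w, f1 w = g1 w) ->
  first_order f f0 f1 -> first_order f g0 g1.
Proof. by move=> /funext -> /funext ->. Qed.

(** Dividing the expansion by t leaves |E f1| <= t k for every small t > 0. *)
Lemma first_order_expectC0 f f0 f1 : first_order f f0 f1 -> (forall t, expectC (f t) = expectC f0) -> expectC f1 = 0.
Proof.
move=> [b0 b1 bt [r [k rk]]] fE.
have key t : 0 < t <= 1 -> `|complex.Re (expectC f1)| <= t * k /\ `|complex.Im (expectC f1)| <= t * k.
  move=> /andP[t0 t1].
  have tn : `|t| <= 1 by rewrite gtr0_norm.
  (* On D this is t times the remainder, written through functions already known to be
     measurable. *)
  pose g w := (rc t)^-1 * (f t w - f0 w) - f1 w.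
  have bg : bounded_cplx g by apply: bounded_cplxB => //; apply: bounded_cplxZ; apply: bounded_cplxB.
  have eg : expectC g = - expectC f1.
    by rewrite expectCB ?expectCZ ?expectCB ?fE ?subrr ?mulr0 ?sub0r //; try apply: bounded_cplxZ; apply: bounded_cplxB.
  have gk w : D w -> `|g w| <= rc (t * k).
    move=> Dw; have [E h] := rk t w tn Dw.
    have tC : rc t != 0 by apply/eqP => /rc_inj t00; rewrite t00 ltxx in t0.
    have -> : g w = rc t * r t w by rewrite /g E; field.
    rewrite normrM rcM ler_pM //.
    by rewrite normc_def /= expr0n addr0 sqrtr_sqr gtr0_norm.
  have n1 : `|expect (fun w => complex.Re (g w))| <= t * k.
    by apply: expect_norm_le; [exact: bounded_cplx_Re | move=> w /gk /normc_Re_le].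
  have n2 : `|expect (fun w => complex.Im (g w))| <= t * k.
    by apply: expect_norm_le; [exact: bounded_cplx_Im | move=> w /gk /normc_Im_le].
  move: eg; rewrite {1}/expectC; case: (expectC f1) => x y [e1 e2] /=.
  by rewrite -[`|x|]normrN -e1 -[`|y|]normrN -e2.
have z (x : R) : (forall t, 0 < t <= 1 -> `|x| <= t * k) -> x = 0.
  move=> h; apply/eqP; rewrite -normr_le0; apply/ler_addgt0Pl => e e0; rewrite addr0.
  have k0 : 0 <= k by have := h 1; rewrite ltr01 lexx mul1r => /(_ isT); apply: le_trans.
  (* The denominator k + 1 rather than k covers a vanishing remainder bound. *)
  pose t := Num.min 1 (e / (k + 1)).
  have kp : 0 < k + 1 by lra.
  have tp : 0 < t <= 1 by rewrite lt_min ltr01 divr_gt0 //= ge_min lexx.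
  apply: le_trans (h t tp) _.
  apply: le_trans (_ : e / (k + 1) * (k + 1) <= _); last by rewrite divfK // gt_eqF.
  rewrite ler_pM //; [by case/andP: tp => /ltW | by rewrite ge_min lexx orbT | lra].
have h1 := z _ (fun t ht => (key t ht).1); have h2 := z _ (fun t ht => (key t ht).2).
by move: h1 h2; case: (expectC f1) => x y /= -> ->.
Qed.

End BoundedExpectation.

(** * The loop equation *)

Section DirectionLinearity.
Variables (F : numFieldType) (n : nat) (c W : 'M[F]_n.+1).

Lemma dword_lin x (H H' : 'M[F]_n.+1) :
  dword c W (x *: H + H') = x *: dword c W H + dword c W H'.
Proof.
rewrite /dword mulrDl [W * (_ + _)]mulrDr -scalerAl -(scalerAr x W) opprD addrACA -scalerBr.
by rewrite [LHS]mulrDr -scalerAr.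
Qed.

Lemma dpow_lin x (Y H H' : 'M[F]_n.+1) k :
  dpow Y (x *: H + H') k = x *: dpow Y H k + dpow Y H' k.
Proof.
rewrite /dpow scaler_sumr -big_split; apply: eq_bigr => j _ /=.
by rewrite mulrDr mulrDl -scalerAr -scalerAl.
Qed.

Lemma dword_tr_lin x (H H' : 'M[F]_n.+1) k :
  dword_tr c W (x *: H + H') k = x * dword_tr c W H k + dword_tr c W H' k.
Proof. by rewrite /dword_tr dword_lin dpow_lin ntraceD ntraceZ. Qed.

Lemma dword_prod_lin x (H H' : 'M[F]_n.+1) l :
  dword_prod c W (x *: H + H') l = x * dword_prod c W H l + dword_prod c W H' l.
Proof.
elim: l => [|a l IH] /=; first by rewrite mulr0 addr0.
by rewrite IH dword_tr_lin; ring.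
Qed.

Lemma dentry_lin x (H H' : 'M[F]_n.+1) a b k l :
  dentry c W (x *: H + H') a b k l = x * dentry c W H a b k l + dentry c W H' a b k l.
Proof.
by rewrite /dentry dword_prod_lin dword_lin dpow_lin !mxE; ring.
Qed.

Lemma dentryZ x (H : 'M[F]_n.+1) a b k l :
  dentry c W (x *: H) a b k l = x * dentry c W H a b k l.
Proof.
have h0 : dentry c W 0 a b k l = 0.
  by have := dentry_lin (-1) 0 0 a b k l; rewrite scaler0 addr0 mulN1r addNr.
by rewrite -[x *: H]addr0 dentry_lin h0 addr0.
Qed.

End DirectionLinearity.

Lemma conj_i (R : realType) : Num.conj ('i%C : complex R) = - 'i%C.
Proof. by rewrite conjE /=; apply/eqP; rewrite eq_complex /= ?oppr0 !eqxx. Qed.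

(** * Rank-one curves in the unitary group (Cayley transforms) *)

Section UnitaryCurve.
Context {R : realType}.
Local Notation C := (complex R).
Variables (n : nat) (x : 'cV[C]_n.+1).

Definition outer : 'M[C]_n.+1 := x *m adjmx x.
Let N := frob2 x.
Let q (t : R) := (1 + t ^+ 2 * N ^+ 2 / 4)^-1.

(* [z = i t / (1 - i t N / 2)], so that [1 + z x x^*] is unitary when N = |x|^2. *)
Definition curve_coef (t : R) : C := (- (q t * t ^+ 2 * N / 2) +i* (q t * t))%C.

Let q_den t : 0 < 1 + t ^+ 2 * N ^+ 2 / 4.
Proof.
have : 0 <= t ^+ 2 * N ^+ 2 by rewrite mulr_ge0 ?sqr_ge0.
lra.
Qed.

Lemma outer_adj : adjmx outer = outer.
Proof. by rewrite /outer adjmxM adjmxK. Qed.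

Lemma outer_sq : outer *m outer = rc N *: outer.
Proof.
rewrite /outer mulmxA -(mulmxA x).
have -> : adjmx x *m x = (rc N)%:M.
  by rewrite [LHS]mx11_scalar; congr _%:M; rewrite frob2_tr /mxtrace big_ord_recl big_ord0 addr0.
by rewrite mul_mx_scalar -scalemxAl.
Qed.

Definition curve (t : R) : 'M[C]_n.+1 := 1%:M + curve_coef t *: outer.

Lemma curve_unitary t : curve t \is unitarymx.
Proof.
apply: unitary_of_adj; rewrite /curve adjmxD adjmx1 adjmxZ outer_adj.
rewrite mulmxDl mul1mx mulmxDr mulmx1 -scalemxAl -scalemxAr outer_sq !scalerA.
rewrite -[RHS]addr0 -addrA; congr (_ + _); rewrite -!scalerDl.
rewrite (_ : _ + _ = 0) ?scale0r // conjE /curve_coef /=.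
have h := q_den t; have qE : q t * (1 + t ^+ 2 * N ^+ 2 / 4) = 1 by rewrite mulVf // gt_eqF.
set Q := q t in qE *.
rewrite /rc; apply/eqP; rewrite eq_complex /=; apply/andP; split; apply/eqP; last ring.
transitivity (Q * t ^+ 2 * N * (Q * (1 + t ^+ 2 * N ^+ 2 / 4) - 1)); last by rewrite qE subrr mulr0.
by field.
Qed.

Context d (T : measurableType d) (D : set T).

(** The coefficient is i t + O(t^2), with an explicit rational remainder. Its conjugate is expanded
    as well because conjugation of W also involves the adjoint of the curve. *)
Lemma first_order_curve_coef :
  first_order D (fun t _ => curve_coef t) (fun=> 0) (fun=> 'i%C) /\
  first_order D (fun t _ => Num.conj (curve_coef t)) (fun=> 0) (fun=> - 'i%C).
Proof.
have N0 : 0 <= N := frob2_ge0 x.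
pose r t : C := (- (q t * N / 2) +i* (- (q t * t * N ^+ 2 / 4)))%C.
have rE t : curve_coef t = rc t * 'i%C + rc t ^+ 2 * r t.
  have h := q_den t; have qE : q t * (1 + t ^+ 2 * N ^+ 2 / 4) = 1 by rewrite mulVf // gt_eqF.
  rewrite /curve_coef /r; set Q := q t in qE *.
  rewrite -rcX /rc; apply/eqP; rewrite eq_complex /=; apply/andP; split; apply/eqP; first by field.
  transitivity (t * (1 - (Q * (1 + t ^+ 2 * N ^+ 2 / 4) - Q))); last by field.
  by rewrite qE; ring.
have rk t : `|t| <= 1 -> `|r t| <= rc (N + N ^+ 2).
  move=> t1.
  have -> : r t = rc (- (q t * N / 2)) + 'i%C * rc (- (q t * t * N ^+ 2 / 4)).
    by rewrite [LHS]complexE.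
  have q0 : 0 <= q t by rewrite invr_ge0 ltW.
  have q1 : q t <= 1.
    rewrite invf_le1 // lerDl; apply: mulr_ge0 => //; by rewrite mulr_ge0 ?sqr_ge0.
  have nrc y : `|rc y| = rc `|y| by rewrite normc_def /= expr0n addr0 sqrtr_sqr.
  apply: le_trans (ler_normD _ _) _; rewrite normrM !nrc.
  have -> : `|'i%C : C| = 1 by rewrite normc_def /= expr0n expr1n add0r sqrtr1.
  have N2 : 0 <= N ^+ 2 / 4 by have := sqr_ge0 N; lra.
  have e1 : `|q t * N / 2| = q t * (N / 2) by rewrite -mulrA ger0_norm // mulr_ge0 //; lra.
  have e2 : `|q t * t * N ^+ 2 / 4| = q t * `|t| * (N ^+ 2 / 4).
    by rewrite -mulrA normrM (ger0_norm N2) normrM (ger0_norm q0).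
  rewrite mul1r -rcD /rc lecR !normrN e1 e2.
  apply: lerD.
    apply: le_trans (_ : 1 * (N / 2) <= _); last by lra.
    by rewrite ler_wpM2r //; lra.
  have h : q t * `|t| <= 1 by rewrite mulr_ile1.
  apply: le_trans (_ : 1 * (N ^+ 2 / 4) <= _); first by rewrite ler_wpM2r.
  have := sqr_ge0 N; lra.
split; (split; [exact: bounded_cplx_cst | exact: bounded_cplx_cst | move=> t; exact: bounded_cplx_cst |]).
  by exists (fun t _ => r t), (N + N ^+ 2) => t w t1 _; rewrite add0r rE; split=> //; exact: rk.
exists (fun t _ => Num.conj (r t)), (N + N ^+ 2) => t w t1 _; split; last first.
  by rewrite norm_conjC; exact: rk.
by rewrite add0r rE rmorphD /= !rmorphM /= conj_i ?rmorphXn /= ?conj_rc.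
Qed.

End UnitaryCurve.

Section LoopEquation.
Context {R : realType} d (T : measurableType d) (P : probability T R) (D : set T).
Hypotheses (mD : measurable D) (PD : P D = 1%E).
Local Notation C := (complex R).
Variable (n : nat).
Local Notation Mx := 'M[C]_n.+1.

Definition first_order_mx (M : R -> T -> Mx) (M0 M1 : T -> Mx) : Prop := forall i j,
  first_order D (fun t w => M t w i j) (fun w => M0 w i j) (fun w => M1 w i j).
Definition bounded_mx (M : T -> Mx) : Prop := forall i j, bounded_cplx D (fun w => M w i j).

Lemma first_order_mx_cst M : bounded_mx M -> first_order_mx (fun=> M) M (fun=> 0).
Proof.
by move=> bM i j; apply: first_order_eq (first_order_cst (bM i j)) => // w; rewrite mxE.
Qed.

Lemma first_order_mx_eq M M0 M1 M0' M1' : (forall w, M0 w = M0' w) -> (forall w, M1 w = M1' w) ->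
  first_order_mx M M0 M1 -> first_order_mx M M0' M1'.
Proof. by move=> /funext -> /funext ->. Qed.

Lemma first_order_mx_mul M M0 M1 L L0 L1 : first_order_mx M M0 M1 -> first_order_mx L L0 L1 ->
  first_order_mx (fun t w => M t w * L t w) (fun w => M0 w * L0 w)
    (fun w => M1 w * L0 w + M0 w * L1 w).
Proof.
move=> dM dL i j.
have := @first_order_sum _ _ _ D _ (index_enum 'I_n.+1) _ _ _ (fun k => first_orderM (dM i k) (dL k j)).
congr first_order; do ?(apply/funext => ?); rewrite ?mxE //.
by rewrite big_split.
Qed.

Lemma bounded_mx_cst M : bounded_mx (fun=> M). Proof. by move=> i j; exact: bounded_cplx_cst. Qed.

Lemma bounded_mx_mul M L : bounded_mx M -> bounded_mx L -> bounded_mx (fun w => M w * L w).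
Proof.
move=> bM bL i j.
have := @bounded_cplx_sum _ _ _ D _ (index_enum 'I_n.+1) _ (fun k => bounded_cplxM (bM i k) (bL k j)).
by congr bounded_cplx; apply/funext => w; rewrite mxE.
Qed.

Lemma bounded_mx_exp M k : bounded_mx M -> bounded_mx (fun w => M w ^+ k).
Proof.
move=> bM; elim: k => [|k IH].
  by under eq_fun do rewrite expr0; exact: bounded_mx_cst.
by under eq_fun do rewrite exprS; exact: bounded_mx_mul.
Qed.

Lemma bounded_cplx_ntrace M : bounded_mx M -> bounded_cplx D (fun w => ntrace (M w)).
Proof. by move=> bM; apply: bounded_cplxZ; apply: bounded_cplx_sum => i; exact: bM. Qed.

Lemma first_order_mx_exp M M0 M1 k : first_order_mx M M0 M1 ->
  first_order_mx (fun t w => M t w ^+ k) (fun w => M0 w ^+ k) (fun w => dpow (M0 w) (M1 w) k).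
Proof.
move=> dM; elim: k => [|k IH].
  apply: first_order_mx_eq (first_order_mx_cst (bounded_mx_cst 1)) => w; rewrite ?expr0 //.
  by rewrite /dpow big_ord0.
have := first_order_mx_mul dM IH.
have -> : (fun t w => M t w * M t w ^+ k) = (fun t w => M t w ^+ k.+1).
  by apply/funext => t; apply/funext => w; rewrite exprS.
by apply: first_order_mx_eq => w; rewrite ?exprS ?dpowS.
Qed.

Lemma first_order_ntrace M M0 M1 : first_order_mx M M0 M1 ->
  first_order D (fun t w => ntrace (M t w)) (fun w => ntrace (M0 w)) (fun w => ntrace (M1 w)).
Proof.
move=> dM.
have h := @first_order_sum _ _ _ D _ (index_enum 'I_n.+1) _ _ _ (fun k => dM k k).
apply: first_order_eq (first_orderM (first_order_cst (bounded_cplx_cst D (n.+1%:R)^-1)) h) => w //.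
by rewrite mul0r add0r.
Qed.

Variables (c : Mx) (W : T -> Mx).
Hypothesis W_bounded : bounded_mx W.

(** The two outer factors contribute an anti-Hermitian direction, tangent to the unitary group, and
    its negative; together they form a commutator. *)
Lemma first_order_mx_curve x : first_order_mx (fun t w => curve x t * W w * adjmx (curve x t))
  W (fun w => ('i%C *: outer x) * W w - W w * ('i%C *: outer x)).
Proof.
have [dz dz'] := first_order_curve_coef x D.
have dV : first_order_mx (fun t w => curve x t) (fun=> 1) (fun=> 'i%C *: outer x).
  move=> i j; have := first_orderD (first_order_cst (bounded_cplx_cst D ((1 : Mx) i j)))
    (first_orderM dz (first_order_cst (bounded_cplx_cst D (outer x i j)))).
  rewrite (_ : (fun t w => _ + _) = (fun t w => curve x t i j)); last first.
    by apply/funext => t; apply/funext => w; rewrite /curve !mxE.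
  by apply: first_order_eq => w; rewrite ?mxE ?mul0r ?addr0 ?add0r.
have dV' : first_order_mx (fun t w => adjmx (curve x t)) (fun=> 1) (fun=> - 'i%C *: outer x).
  move=> i j; have := first_orderD (first_order_cst (bounded_cplx_cst D ((1 : Mx) i j)))
    (first_orderM dz' (first_order_cst (bounded_cplx_cst D (outer x i j)))).
  rewrite (_ : (fun t w => _ + _) = (fun t w => adjmx (curve x t) i j)); last first.
    apply/funext => t; apply/funext => w.
    by rewrite /curve adjmxD adjmx1 adjmxZ outer_adj !mxE.
  by apply: first_order_eq => w; rewrite ?mxE ?mul0r ?addr0 ?add0r.
have := first_order_mx_mul (first_order_mx_mul dV (first_order_mx_cst W_bounded)) dV'.
apply: first_order_mx_eq => w; first by rewrite mulr1 mul1r.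
by rewrite mulr0 addr0 mulr1 mul1r scaleNr mulrN.
Qed.

Lemma first_order_word_prod M M0 H l : first_order_mx M M0 (fun w => H * M0 w - M0 w * H) ->
  first_order D (fun t w => word_prod c (M t w) l) (fun w => word_prod c (M0 w) l)
    (fun w => dword_prod c (M0 w) H l).
Proof.
move=> dM.
have dY := first_order_mx_mul (first_order_mx_cst (bounded_mx_cst c)) dM.
have {}dY : first_order_mx (fun t w => c * M t w) (fun w => c * M0 w) (fun w => dword c (M0 w) H).
  by apply: first_order_mx_eq dY => w //; rewrite mul0r add0r.
elim: l => [|a l IH].
  rewrite (_ : (fun t w => _) = fun t w => 1); last first.
    by apply/funext => t; apply/funext => w; rewrite /word_prod big_nil.
  by apply: first_order_eq (first_order_cst (bounded_cplx_cst D 1)) => w; rewrite /word_prod ?big_nil.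
rewrite (_ : (fun t w => word_prod c (M t w) (a :: l)) =
  (fun t w => ntrace ((c * M t w) ^+ a) * word_prod c (M t w) l)); last first.
  by apply/funext => t; apply/funext => w; rewrite word_prod_cons.
by apply: first_order_eq (first_orderM (first_order_ntrace (first_order_mx_exp a dY)) IH) => w; rewrite ?word_prod_cons.
Qed.

Hypothesis W_inv : forall (V : Mx) (G : Mx -> C), V \is unitarymx ->
  bounded_cplx D (fun w => G (W w)) -> bounded_cplx D (fun w => G (V * W w * adjmx V)) ->
  expectC P D (fun w => G (V * W w * adjmx V)) = expectC P D (fun w => G (W w)).

(** Invariance makes the expectation of the entry times the traces constant along the curve, so its
    first-order coefficient has mean zero. *)
Lemma dentry_outer x a b k l :
  let g w := dentry c (W w) ('i%C *: outer x) a b k l in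
  bounded_cplx D g /\ expectC P D g = 0.
Proof.
move=> g.
have dW := first_order_mx_curve x.
have dY := first_order_mx_mul (first_order_mx_cst (bounded_mx_cst c)) dW.
have {}dY : first_order_mx (fun t w => c * (curve x t * W w * adjmx (curve x t)))
   (fun w => c * W w) (fun w => dword c (W w) ('i%C *: outer x)).
  by apply: first_order_mx_eq dY => w //; rewrite mul0r add0r.
have dF := first_orderM (first_order_mx_exp k dY a b) (first_order_word_prod l dW).
have gE : first_order D
  (fun t w => ((c * (curve x t * W w * adjmx (curve x t))) ^+ k) a b *
     word_prod c (curve x t * W w * adjmx (curve x t)) l)
  (fun w => ((c * W w) ^+ k) a b * word_prod c (W w) l) g by exact: dF.
split; first by case: gE.
apply: (first_order_expectC0 mD PD gE) => t.
have [b0 _ bt _] := gE.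
exact (W_inv (G := fun M => ((c * M) ^+ k) a b * word_prod c M l) (curve_unitary x t) b0 (bt t)).
Qed.

(** Polarisation with p, y, r, s standing for the products u u', u v', v u', v v' of columns with
    adjoints. The inner factor i is kept because admissible directions are i times Hermitian
    matrices. *)
Lemma polarize (p y r s : Mx) :
  y = (- 'i%C / 4) *: ('i%C *: (p + y + r + s))
    + ((1 / 4) *: ('i%C *: (p - 'i%C *: y + 'i%C *: r + s))
    + (('i%C / 4) *: ('i%C *: (p - y - r + s))
    + (- 1 / 4) *: ('i%C *: (p + 'i%C *: y - 'i%C *: r + s)))).
Proof.
have ii : 'i%C * 'i%C = -1 :> C by rewrite -expr2 sqr_i.
apply/matrixP => i j; rewrite !mxE.
move: (p i j) (y i j) (r i j) (s i j) => p' y' r' s'.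
transitivity (- ('i%C * 'i%C) * y'); first by rewrite ii opprK mul1r.
by field.
Qed.

Lemma outerD (u v : 'cV[C]_n.+1) (z : C) :
  outer (u + z *: v) = u *m adjmx u + Num.conj z *: (u *m adjmx v)
    + z *: (v *m adjmx u) + (z * Num.conj z) *: (v *m adjmx v).
Proof.
rewrite /outer adjmxD adjmxZ mulmxDl !mulmxDr -!scalemxAl -!scalemxAr !scalerA.
exact: addrA.
Qed.

Lemma delta_outer (a b : 'I_n.+1) :
  let u : 'cV[C]_n.+1 := delta_mx a 0 in let v : 'cV[C]_n.+1 := delta_mx b 0 in
  delta_mx a b =
    (- 'i%C / 4) *: ('i%C *: outer (u + v)) + ((1 / 4) *: ('i%C *: outer (u + 'i%C *: v))
  + (('i%C / 4) *: ('i%C *: outer (u - v)) + (- 1 / 4) *: ('i%C *: outer (u - 'i%C *: v)))) :> Mx.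
Proof.
move=> u v.
have -> : delta_mx a b = u *m adjmx v.
  apply/matrixP => i j; rewrite !mxE big_ord_recl big_ord0 addr0 adjmxE !mxE eqxx.
  rewrite !andbT conjC_nat; by case: eqP; case: eqP; rewrite ?mulr1 ?mulr0 ?mul0r.
have ii : 'i%C * 'i%C = -1 :> C by rewrite -expr2 sqr_i.
have E1 := outerD u v 1; have E2 := outerD u v 'i%C.
have E3 := outerD u v (-1); have E4 := outerD u v (- 'i%C).
rewrite scale1r rmorph1 mulr1 !scale1r in E1.
rewrite conj_i mulrN ii opprK scale1r scaleNr in E2.
rewrite rmorphN rmorph1 mulrNN mulr1 !scaleN1r scale1r in E3.
rewrite rmorphN /= conj_i mulNr opprK ii opprK scale1r !scaleNr in E4.
rewrite E1 E2 E3 E4; exact: polarize.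
Qed.

Lemma expectC_comb0 (h1 h2 h3 h4 : T -> C) (z1 z2 z3 z4 : C) :
  bounded_cplx D h1 -> bounded_cplx D h2 -> bounded_cplx D h3 -> bounded_cplx D h4 ->
  expectC P D h1 = 0 -> expectC P D h2 = 0 -> expectC P D h3 = 0 -> expectC P D h4 = 0 ->
  let g w := z1 * h1 w + (z2 * h2 w + (z3 * h3 w + z4 * h4 w)) in
  bounded_cplx D g /\ expectC P D g = 0.
Proof.
move=> b1 b2 b3 b4 e1 e2 e3 e4 g.
have c1 := bounded_cplxZ z1 b1; have c2 := bounded_cplxZ z2 b2; have c3 := bounded_cplxZ z3 b3; have c4 := bounded_cplxZ z4 b4.
have c34 := bounded_cplxD c3 c4; have c234 := bounded_cplxD c2 c34.
split; first exact: bounded_cplxD.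
by rewrite /g (expectCD mD PD c1 c234) (expectCD mD PD c2 c34) (expectCD mD PD c3 c4) !(expectCZ mD PD) // e1 e2 e3 e4 !mulr0 !addr0.
Qed.

(** The derivative is complex linear in the direction, and rank-one Hermitian matrices span all
    matrices over the complex numbers. So the identity extends to matrix units, although these are
    not tangent to the unitary group. *)
Lemma dentry_delta a b k l :
  let g w := dentry c (W w) (delta_mx a b) a b k l in
  bounded_cplx D g /\ expectC P D g = 0.
Proof.
move=> g.
pose h x w := dentry c (W w) ('i%C *: outer x) a b k l.
set u : 'cV[C]_n.+1 := delta_mx a 0; set v : 'cV[C]_n.+1 := delta_mx b 0.
have hP x := dentry_outer x a b k l.
have gE : g = fun w => (- 'i%C / 4) * h (u + v) w + ((1 / 4) * h (u + 'i%C *: v) w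
   + (('i%C / 4) * h (u - v) w + (- 1 / 4) * h (u - 'i%C *: v) w)).
  apply/funext => w; rewrite /g /h delta_outer -/u -/v.
  move: (outer (u + v)) (outer (u + 'i%C *: v)) (outer (u - v)) (outer (u - 'i%C *: v)).
  by move=> o1 o2 o3 o4; rewrite !dentry_lin (dentryZ _ _ (- 1 / 4)).
have bh x : bounded_cplx D (h x) := (hP x).1.
have eh x : expectC P D (h x) = 0 := (hP x).2.
rewrite gE.
exact (@expectC_comb0 (h (u + v)) (h (u + 'i%C *: v)) (h (u - v)) (h (u - 'i%C *: v)) _ _ _ _
  (bh _) (bh _) (bh _) (bh _) (eh _) (eh _) (eh _) (eh _)).
Qed.

Variables (kap gam om : R).
Hypotheses (c_sq : c * c = rc kap *: c + 1) (W_sq : forall w, D w -> W w * W w = 1)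
  (c_tr : ntrace c = rc gam) (W_tr : forall w, D w -> ntrace (W w) = rc om).

Lemma bounded_word_tr k : bounded_cplx D (fun w => word_tr c (W w) k).
Proof. by apply: bounded_cplx_ntrace; apply: bounded_mx_exp; apply: bounded_mx_mul => //; exact: bounded_mx_cst. Qed.

Lemma bounded_tail_tr k : bounded_cplx D (fun w => tail_tr c (W w) k).
Proof.
apply: bounded_cplx_ntrace; apply: bounded_mx_mul; last exact: bounded_mx_cst.
by apply: bounded_mx_exp; apply: bounded_mx_mul => //; exact: bounded_mx_cst.
Qed.

Lemma bounded_fold_tr k l : bounded_cplx D (fun w => fold_tr c (W w) k l).
Proof.
by apply: bounded_cplx_ntrace; apply: bounded_mx_mul; apply: bounded_mx_exp; apply: bounded_mx_mul => //; exact: bounded_mx_cst.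
Qed.

Lemma bounded_word_prod l : bounded_cplx D (fun w => word_prod c (W w) l).
Proof.
elim: l => [|a l IH].
  by under eq_fun do rewrite /word_prod big_nil; exact: bounded_cplx_cst.
by under eq_fun do rewrite word_prod_cons; apply: bounded_cplxM => //; exact: bounded_word_tr.
Qed.

Lemma bounded_merge_tr k l : bounded_cplx D (fun w => merge_tr c (W w) k l).
Proof.
elim: l => [|a l IH] /=; first exact: bounded_cplx_cst.
apply: bounded_cplxD; last by apply: bounded_cplxM => //; exact: bounded_word_tr.
apply: bounded_cplxM; last exact: bounded_word_prod.
by apply: bounded_cplxZ; apply: bounded_cplxB; [exact: bounded_fold_tr | exact: bounded_word_tr].
Qed.

(** Since kap, gam and om are real, real parts alone satisfy the recursion, and the moments become
    real numbers. *)
Definition expectRe (f : T -> C) : R := complex.Re (expectC P D f).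

Lemma expectReD f g : bounded_cplx D f -> bounded_cplx D g -> expectRe (fun w => f w + g w) = expectRe f + expectRe g.
Proof. by move=> bf bg; rewrite /expectRe (expectCD mD PD) // cReD. Qed.

Lemma expectReZ x f : bounded_cplx D f -> expectRe (fun w => rc x * f w) = x * expectRe f.
Proof. by move=> bf; rewrite /expectRe (expectCZ mD PD) // cReM /= mul0r subr0. Qed.

Lemma expectReB f g : bounded_cplx D f -> bounded_cplx D g -> expectRe (fun w => f w - g w) = expectRe f - expectRe g.
Proof.
by move=> bf bg; rewrite /expectRe (expectCB mD PD) //; case: (expectC P D f) => ? ?; case: (expectC P D g).
Qed.

Lemma expectRe_sum (I : Type) (r : seq I) (f : I -> T -> C) : (forall i, bounded_cplx D (f i)) ->
  expectRe (fun w => \sum_(i <- r) f i w) = \sum_(i <- r) expectRe (f i).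
Proof.
move=> bf; rewrite /expectRe (expectC_sum mD PD) //.
by elim: r => [|i r IH]; rewrite ?big_nil // !big_cons cReD IH.
Qed.

Lemma expectRe_eq f g : (forall w, D w -> f w = g w) -> expectRe f = expectRe g.
Proof. by move=> fg; rewrite /expectRe (expectC_eq P fg). Qed.

Definition moment (l : seq nat) : R := expectRe (fun w => word_prod c (W w) l).

(** A general factor G is carried along so that a second tail can play its role, which produces the
    nested tails of the splitting term. *)
Lemma expectRe_tail (G : T -> C) k l : bounded_cplx D G ->
  expectRe (fun w => G w * tail_tr c (W w) k * word_prod c (W w) l) =
  tail_form kap gam om (fun l => expectRe (fun w => G w * word_prod c (W w) l)) k l.
Proof.
move=> bG; have bp := bounded_word_prod.
have bGp l' : bounded_cplx D (fun w => G w * word_prod c (W w) l') by apply: bounded_cplxM.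
have bw := bounded_word_tr; have bt := bounded_tail_tr.
elim/ltn_ind: k => -[|[|k]] IH /=.
- rewrite -expectReZ //; apply: expectRe_eq => w Dw.
  by rewrite /tail_tr expr0 mul1r c_tr; ring.
- rewrite -!expectReZ // -expectReD; try exact: bounded_cplxZ.
  apply: expectRe_eq => w Dw; rewrite (tail_tr1 _ c_sq) W_tr // word_prod_cons; ring.
- rewrite -IH // -expectReZ // -expectReD; first last.
  + by apply: bounded_cplxM => //; apply: bounded_cplxM.
  + exact: bounded_cplxZ.
  apply: expectRe_eq => w Dw; rewrite (tail_trS c_sq) ?W_sq // word_prod_cons; ring.
Qed.

Lemma expectRe_tail1 k l :
  expectRe (fun w => tail_tr c (W w) k * word_prod c (W w) l) = tail_form kap gam om moment k l.
Proof.
have := expectRe_tail k l (bounded_cplx_cst D 1).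
under eq_fun do rewrite mul1r; move=> ->; congr tail_form.
by apply/funext => l'; under eq_fun do rewrite mul1r.
Qed.

Lemma expectRe_tail2 j k l :
  expectRe (fun w => tail_tr c (W w) j * tail_tr c (W w) k * word_prod c (W w) l) =
  tail_form kap gam om (tail_form kap gam om moment k) j l.
Proof.
have := expectRe_tail j l (bounded_tail_tr k).
under eq_fun do rewrite [tail_tr _ _ k * _]mulrC; move=> ->; congr tail_form.
by apply/funext => l'; rewrite expectRe_tail1.
Qed.

Lemma expectRe_fold k a l :
  expectRe (fun w => fold_tr c (W w) k a * word_prod c (W w) l) = fold_form kap gam om moment k a l.
Proof.
elim: k a => [|k IH] [|a] /=.
- by apply: expectRe_eq => w _; rewrite fold_tr0l word_tr0 mul1r.
- by apply: expectRe_eq => w _; rewrite fold_tr0l word_prod_cons.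
- by apply: expectRe_eq => w _; rewrite fold_tr0r word_prod_cons.
- have b1 : bounded_cplx D (fun w => tail_tr c (W w) (k + a) * word_prod c (W w) l).
    by apply: bounded_cplxM; [exact: bounded_tail_tr | exact: bounded_word_prod].
  have b2 : bounded_cplx D (fun w => fold_tr c (W w) k a * word_prod c (W w) l).
    by apply: bounded_cplxM; [exact: bounded_fold_tr | exact: bounded_word_prod].
  rewrite -IH -expectRe_tail1 -expectReZ // -expectReD //; last exact: bounded_cplxZ.
  apply: expectRe_eq => w Dw; rewrite (fold_trS c_sq) ?W_sq //; ring.
Qed.

Lemma word_prod_catrev w l' l :
  word_prod c (W w) (catrev l' l) = word_prod c (W w) l' * word_prod c (W w) l.
Proof.
rewrite catrevE /word_prod big_cat /=; congr (_ * _); apply: perm_big.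
by rewrite perm_rev.
Qed.

Lemma expectRe_merge k l' l :
  expectRe (fun w => word_prod c (W w) l' * merge_tr c (W w) k l) =
  merge_form kap gam om moment k l' l.
Proof.
have bp := bounded_word_prod; have bw := bounded_word_tr; have bf := bounded_fold_tr.
elim: l l' => [|a l IH] l' /=.
  by under eq_fun do rewrite mulr0; rewrite /expectRe expectC0.
rewrite -IH -expectRe_fold /moment.
have b1 : bounded_cplx D (fun w => fold_tr c (W w) k a * word_prod c (W w) (catrev l' l)) by apply: bounded_cplxM.
rewrite -expectReB // -(expectReZ a%:R); last exact: bounded_cplxB.
rewrite -expectReD; first last.
- by apply: bounded_cplxM => //; exact: bounded_merge_tr.
- by apply: bounded_cplxZ; apply: bounded_cplxB.
by apply: expectRe_eq => w _; rewrite !word_prod_cons word_prod_catrev rc_nat; ring.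
Qed.

Theorem moment_loop : loop_eq kap gam om (n.+1%:R ^- 2) moment.
Proof.
move=> k l _.
have bp := bounded_word_prod; have bw := bounded_word_tr; have bt := bounded_tail_tr.
pose S w := \sum_(j < k) (tail_tr c (W w) j * tail_tr c (W w) (k - j.+1) * word_prod c (W w) l
     - word_prod c (W w) [:: j.+1, (k - j)%N & l]).
have b_1 : bounded_cplx D (fun w => rc om * (tail_tr c (W w) k * word_prod c (W w) l)).
  by apply: bounded_cplxZ; apply: bounded_cplxM.
have bS : bounded_cplx D S.
  by apply: bounded_cplx_sum => j; apply: bounded_cplxB => //; apply: bounded_cplxM => //; apply: bounded_cplxM.
have bM : bounded_cplx D (fun w => rc (n.+1%:R ^- 2) * merge_tr c (W w) k.+1 l).
  by apply: bounded_cplxZ; exact: bounded_merge_tr.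
have key : expectRe (fun w => rc om * (tail_tr c (W w) k * word_prod c (W w) l) + S w
   + rc (n.+1%:R ^- 2) * merge_tr c (W w) k.+1 l - word_prod c (W w) (k.+1 :: l)) = 0.
  (* Zero is written as the mean of the derivative summed over all matrix units; its closed form
     [sum_dentry] is the loop equation before taking expectations. *)
  have -> : 0 = expectRe (fun w => rc (n.+1%:R ^- 2) *
      \sum_a \sum_b dentry c (W w) (delta_mx a b) a b k.+1 l).
    have bs a : bounded_cplx D (fun w => \sum_b dentry c (W w) (delta_mx a b) a b k.+1 l).
      by apply: bounded_cplx_sum => b; have [] := dentry_delta a b k.+1 l.
    rewrite expectReZ ?expectRe_sum // ?big1 ?mulr0 // => [a _|]; last exact: bounded_cplx_sum.
    rewrite expectRe_sum ?big1 // => b; last by have [] := dentry_delta a b k.+1 l.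
    by move=> _; rewrite /expectRe (dentry_delta a b k.+1 l).2.
  apply: expectRe_eq => w Dw; rewrite sum_dentry ?W_sq // W_tr //.
  have -> : S w = (\sum_(j < k) (tail_tr c (W w) j * tail_tr c (W w) (k - j.+1)
     - word_tr c (W w) j.+1 * word_tr c (W w) (k - j))) * word_prod c (W w) l.
    by rewrite mulr_suml; apply: eq_bigr => j _; rewrite !word_prod_cons; ring.
  have -> : rc (n.+1%:R ^- 2 : R) = n.+1%:R ^- 2 by rewrite rcV rcX rc_nat.
  rewrite word_prod_cons; set X := \sum_(j < k) _; set Z := word_prod _ _ _.
  field; by rewrite ?nat1r ?natr1 pnatr_eq0.
rewrite expectReB // in key; last by apply: bounded_cplxD => //; apply: bounded_cplxD.
rewrite expectReD // in key; last by apply: bounded_cplxD.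
rewrite expectReD // in key; rewrite !expectReZ // in key; last 2 first.
- exact: bounded_merge_tr.
- by apply: bounded_cplxM.
have M0 := expectRe_merge k.+1 [::] l.
rewrite (_ : (fun w => _ * _) = (fun w => merge_tr c (W w) k.+1 l)) in M0; last first.
  by apply/funext => w; rewrite /word_prod big_nil mul1r.
rewrite M0 expectRe_tail1 in key.
rewrite {1}/moment /split_form; move/eqP: key; rewrite subr_eq0 => /eqP <-; congr (_ + _ + _).
rewrite expectRe_sum; last by move=> j; apply: bounded_cplxB => //; apply: bounded_cplxM => //; apply: bounded_cplxM.
apply: eq_bigr => j _; rewrite expectReB // ?expectRe_tail2 //.
by apply: bounded_cplxM => //; apply: bounded_cplxM.
Qed.

End LoopEquation.

(** * Moment bounds *)

Section HermitianWords.
Context {R : realType}.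
Local Notation C := (complex R).
Variables (n : nat) (c W : 'M[C]_n.+1).
Hypotheses (c_herm : adjmx c = c) (W_herm : adjmx W = W).

Lemma adjmx_word k : adjmx ((c * W) ^+ k) = (W * c) ^+ k.
Proof.
elim: k => [|k IH]; first by rewrite !expr0 adjmx1.
by rewrite exprS [in RHS]exprSr -IH [LHS]adjmxM [adjmx (c * W)]adjmxM c_herm W_herm.
Qed.

Lemma trace_adj (M : 'M[C]_n.+1) : \tr (adjmx M) = Num.conj (\tr M).
Proof. by rewrite /mxtrace rmorph_sum; apply: eq_bigr => i _; rewrite adjmxE. Qed.

(** The adjoint of (cW)^k is (Wc)^k, which has the same trace. *)
Lemma word_tr_real k : word_tr c W k = rc (complex.Re (word_tr c W k)).
Proof.
have h : Num.conj (word_tr c W k) = word_tr c W k.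
  rewrite -[in RHS]word_tr_flip -adjmx_word /word_tr /ntrace trace_adj rmorphM /=.
  by rewrite fmorphV rmorph_nat.
by rewrite /rc RRe_real //; apply/CrealP.
Qed.

Lemma fold_tr_frob2 k : fold_tr c W k k = rc ((n.+1%:R)^-1 * frob2 ((c * W) ^+ k)).
Proof.
rewrite rcM rcV rc_nat -frob2_adj frob2_tr adjmxK /fold_tr /ntrace -adjmx_word //.
Qed.

End HermitianWords.

Section MomentBounds.
Context {R : realType} d (T : measurableType d) (P : probability T R) (D : set T).
Hypotheses (mD : measurable D) (PD : P D = 1%E).
Local Notation C := (complex R).
Variable (n : nat).
Local Notation Mx := 'M[C]_n.+1.
Variables (c : Mx) (W : T -> Mx).
Hypotheses (W_bounded : bounded_mx D W) (W_inv : forall (V : Mx) (G : Mx -> C), V \is unitarymx ->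
  bounded_cplx D (fun w => G (W w)) -> bounded_cplx D (fun w => G (V * W w * adjmx V)) ->
  expectC P D (fun w => G (V * W w * adjmx V)) = expectC P D (fun w => G (W w))).
Variables (kap gam om : R).
Hypotheses (c_sq : c * c = rc kap *: c + 1) (W_sq : forall w, D w -> W w * W w = 1)
  (c_tr : ntrace c = rc gam) (W_tr : forall w, D w -> ntrace (W w) = rc om)
  (c_herm : adjmx c = c) (W_herm : forall w, D w -> adjmx (W w) = W w).
Variables (K : nat) (k0 eps : R).
Hypotheses (k0_ge1 : 1 <= k0) (kap_le : `|kap| <= k0) (eps_gt0 : 0 < eps)
  (eps_le1 : eps <= 1) (gam_le : `|gam| <= eps) (om_le : `|om| <= eps)
  (K_eps : 12 * K%:R ^+ 3 * k0 ^+ 2 * eps <= 1)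
  (K_q : 8 * K%:R * K.+1%:R ^+ 2 * k0 ^+ 2 * n.+1%:R ^- 2 <= eps ^+ 2).

Local Notation mom := (moment P D c W).

(** Only finiteness of b matters: it may depend on N and K in any way, since the contraction removes
    it. *)
Lemma word_tr_bound : exists2 b : R, 1 <= b &
  forall k w, (k <= K)%N -> D w -> `|word_tr c (W w) k| <= rc b.
Proof.
elim: K => [|k [b b1 bP]].
  have [_ _ [b bP]] := bounded_word_tr c W_bounded 0.
  exists (Num.max 1 b); first by rewrite le_max lexx.
  move=> k w; rewrite leqn0 => /eqP -> Dw; apply: le_trans (bP w Dw) _.
  by rewrite /rc lecR le_max lexx orbT.
have [_ _ [b' b'P]] := bounded_word_tr c W_bounded k.+1.
exists (Num.max b b'); first by rewrite le_max b1.
move=> j w; rewrite leq_eqVlt => /predU1P[->|jk] Dw.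
  by apply: le_trans (b'P w Dw) _; rewrite /rc lecR le_max lexx orbT.
by apply: le_trans (bP j w _ Dw) _ => //; rewrite /rc lecR le_max lexx.
Qed.

Lemma size_le_sumn l : all (ltn 0) l -> (size l <= sumn l)%N.
Proof. by elim: l => //= a l IH /andP[a0 /IH]; nlia. Qed.

Lemma moment_apriori : exists B, bounded_by K eps 0 B mom.
Proof.
have [b b1 bP] := word_tr_bound.
(* A list of positive entries with sum at most K has at most K entries; with b >= 1 and eps <= 1 the
   powers with exponent K cover all lengths. *)
exists (b ^+ K / eps ^+ K) => l lp; rewrite addn0 => lK.
have sK : (size l <= K)%N by apply: leq_trans (size_le_sumn lp) lK.
have wp w : D w -> `|word_prod c (W w) l| <= rc (b ^+ size l).
  move=> Dw; elim: l lp lK {sK} => [|a l IH] /=.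
    by move=> _ _; rewrite /word_prod big_nil expr0 normr1.
  move=> /andP[a0 lp] lK; rewrite word_prod_cons normrM exprS rcM ler_pM //.
    by apply: bP => //; nlia.
  by apply: IH => //; nlia.
have h : `|mom l| <= b ^+ size l.
  rewrite /moment /expectRe /=; apply: (expect_norm_le mD PD).
    exact: bounded_cplx_Re (bounded_word_prod c W_bounded l).
  by move=> w /wp /normc_Re_le.
apply: le_trans h _.
have e0 : eps ^+ K != 0 by rewrite expf_neq0 // gt_eqF.
have bb : b ^+ size l <= b ^+ K by rewrite ler_weXn2l.
apply: le_trans bb _; rewrite -mulrA ler_peMr ?exprn_ge0 //; first lra.
rewrite mulrC ler_pdivlMr ?exprn_gt0 // mul1r.
by rewrite ler_wiXn2l // ltW.
Qed.

Lemma mom_nil : mom [::] = 1.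
Proof.
rewrite /moment /expectRe /=; transitivity (expect P D (fun=> 1)); last exact: expect_cst.
by apply: expect_eq => w _; rewrite /word_prod big_nil.
Qed.

Lemma mom_bound : bounded_by K eps 0 1 mom.
Proof.
have [B BP] := moment_apriori.
have q0 : 0 <= n.+1%:R ^- 2 :> R by rewrite invr_ge0 exprn_ge0.
exact: (moment_bound k0_ge1 kap_le eps_gt0 eps_le1 gam_le om_le q0 mom_nil
  (moment_loop mD PD W_bounded W_inv c_sq W_sq c_tr W_tr) K_eps K_q BP).
Qed.

(** As tau_k is real, its second moment is the moment of the list [:: k; k], bounded by eps^2. This
    list explains the condition on 2k. *)
Lemma word_tr_chebyshev k eta : (0 < k)%N -> (k.*2 <= K)%N -> 0 < eta ->
  (P ([set w | (eta <= `|complex.Re (word_tr c (W w) k)|)%R] `&` D)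
     <= (eps ^+ 2 / eta ^+ 2)%:E)%E.
Proof.
move=> kp kK e0.
have br : bounded_real D (fun w => complex.Re (word_tr c (W w) k)) := bounded_cplx_Re (bounded_word_tr c W_bounded k).
have b2 : bounded_real D (fun w => complex.Re (word_tr c (W w) k) ^+ 2).
  by under eq_fun do rewrite expr2; exact: bounded_realM.
have := bounded_real_markov mD PD b2 (fun w _ => sqr_ge0 _) (exprn_gt0 2 e0).
have -> : [set w | eta ^+ 2 <= complex.Re (word_tr c (W w) k) ^+ 2] =
          [set w | eta <= `|complex.Re (word_tr c (W w) k)|].
  apply/seteqP; split=> w /=.
    by rewrite -[X in _ <= X](real_normK (num_real _)) ler_pXn2r // ?nnegrE // ltW.
  by move=> h; rewrite -[X in _ <= X](real_normK (num_real _)) ler_pXn2r // ?nnegrE // ltW.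
move=> /le_trans; apply; rewrite lee_fin ler_wpM2r //.
  by rewrite invr_ge0 exprn_ge0 // ltW.
have := mom_bound (l := [:: k; k]); rewrite /= kp /= mul1r => /(_ isT ltac:(nlia)).
move=> h; apply: le_trans (le_trans (ler_norm _) h).
rewrite le_eqVlt; apply/orP; left; apply/eqP.
apply: expect_eq => w Dw; rewrite /word_prod !big_cons big_nil mulr1.
by rewrite (word_tr_real c_herm (W_herm Dw)) -rcM -expr2 /=.
Qed.

(** The mean of |Y^k|_F^2 / N is a [fold_form] at the empty list, of polynomial size in k and K;
    Markov's inequality does the rest. *)
Lemma frob2_word_markov k x : (k.*2 <= K)%N -> 0 < x ->
  (P ([set w | (x <= frob2 ((c * W w) ^+ k))%R] `&` D)
     <= (n.+1%:R * (k.+1%:R * K.+1%:R * k0 ^+ 2) / x)%:E)%E.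
Proof.
move=> kK x0.
have bf := bounded_cplx_Re (bounded_fold_tr c W_bounded k k).
have N0 : 0 < n.+1%:R :> R by rewrite ltr0n.
have fE w : D w -> complex.Re (fold_tr c (W w) k k) = n.+1%:R^-1 * frob2 ((c * W w) ^+ k).
  by move=> Dw; rewrite fold_tr_frob2 ?W_herm.
have f0 w : D w -> 0 <= complex.Re (fold_tr c (W w) k k).
  by move=> /fE ->; rewrite mulr_ge0 ?frob2_ge0 // invr_ge0 ltW.
have y0 : 0 < n.+1%:R^-1 * x by rewrite mulr_gt0 // invr_gt0.
have := bounded_real_markov mD PD bf f0 y0.
have -> : [set w | n.+1%:R^-1 * x <= complex.Re (fold_tr c (W w) k k)] `&` D =
          [set w | x <= frob2 ((c * W w) ^+ k)] `&` D.
  by apply/seteqP; split=> w [/= h Dw]; split=> //; move: h; rewrite fE // ler_pM2l // invr_gt0.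
move=> /le_trans; apply; rewrite lee_fin.
have B := @bounded_by_fold _ kap gam om K k0 eps k0_ge1 kap_le eps_gt0 eps_le1 gam_le om_le
  mom 1 k k ler01 mom_bound ltac:(nlia) [::] isT ltac:(simpl; nlia).
rewrite -(expectRe_fold mD PD W_bounded c_sq W_sq c_tr W_tr) mulr1 mulr1 in B.
have {}B : expect P D (fun w => complex.Re (fold_tr c (W w) k k)) <= k.+1%:R * K.+1%:R * k0 ^+ 2.
  apply: le_trans (le_trans (ler_norm _) B); rewrite le_eqVlt; apply/orP; left; apply/eqP.
  by apply: expect_eq => w _; rewrite /word_prod big_nil mulr1.
rewrite ler_pdivrMr //.
have -> : n.+1%:R * (k.+1%:R * K.+1%:R * k0 ^+ 2) / x * (n.+1%:R^-1 * x) =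
   k.+1%:R * K.+1%:R * k0 ^+ 2.
  have xn : x != 0 by rewrite gt_eqF.
  have yn : (n.+1%:R : R) != 0 by rewrite pnatr_eq0.
  move: (n.+1%:R : R) (_ * k0 ^+ 2) yn => y z yn.
  by field; rewrite xn yn.
by [].
Qed.

End MomentBounds.

(** * Haar-distributed matrices *)

(* Alias carrying a pointed structure, which turns [mx_measurable] into the
   measurable sets of a measurableType. *)
Definition cmx (R : realType) (n : nat) := 'M[complex R]_n.
HB.instance Definition _ R n := Choice.on (cmx R n).
HB.instance Definition _ R n := isPointed.Build (cmx R n) (0 : 'M[complex R]_n).
Definition cmxm (R : realType) n := g_sigma_algebraType (@mx_gen R n : set (set (cmx R n))).
HB.instance Definition _ R n := Measurable.on (cmxm R n).

Section MatrixSpace.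
Context {R : realType} (n : nat).
Local Notation C := (complex R).
Local Notation MM := (cmxm R n.+1).
Local Notation Mx := 'M[C]_n.+1.

(* Boundedness on the empty set is vacuous: [bounded_cplx set0] and [bounded_mx set0] only say
   "measurable". *)
Lemma bounded_cplx_set0 d (T : measurableType d) (D : set T) (f : T -> C) : bounded_cplx D f -> bounded_cplx set0 f.
Proof. by move=> [? ? _]; split=> //; exists 0. Qed.

Lemma bounded_cplx_conj d (T : measurableType d) (D : set T) (f : T -> C) :
  bounded_cplx D f -> bounded_cplx D (fun w => Num.conj (f w)).
Proof.
move=> [mr mi [k fk]]; split.
- by under eq_fun do rewrite conjE.
- under eq_fun do rewrite conjE; exact: measurable_funN.
- by exists k => w Dw; rewrite norm_conjC; exact: fk.
Qed.

Lemma bounded_mx_adj d (T : measurableType d) (D : set T) (M : T -> Mx) :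
  bounded_mx D M -> bounded_mx D (fun w => adjmx (M w)).
Proof. by move=> bM i j; under eq_fun do rewrite adjmxE; exact: bounded_cplx_conj. Qed.

Lemma entry_measurable : bounded_mx set0 (fun M : MM => M : Mx).
Proof.
move=> i j; split; last by exists 0.
- move=> _ B mB; rewrite setTI; apply: sub_sigma_algebra.
  by exists i, j, B; split => //; left.
- move=> _ B mB; rewrite setTI; apply: sub_sigma_algebra.
  by exists i, j, B; split => //; right.
Qed.

Definition Uset : set MM := [set M : MM | (M : Mx) \is unitarymx].

(** Unitarity amounts to finitely many polynomial equations in real and imaginary parts. *)
Lemma measurable_Uset : measurable Uset.
Proof.
have bE : bounded_mx set0 (fun M : MM => (M : Mx) * adjmx (M : Mx)).
  by apply: bounded_mx_mul; [exact: entry_measurable | apply: bounded_mx_adj; exact: entry_measurable].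
have -> : Uset = \bigcap_(p in [set: 'I_n.+1 * 'I_n.+1])
   ((fun M : MM => complex.Re (((M : Mx) * adjmx (M : Mx)) p.1 p.2)) @^-1`
        [set complex.Re ((1%:M : Mx) p.1 p.2)] `&`
    (fun M : MM => complex.Im (((M : Mx) * adjmx (M : Mx)) p.1 p.2)) @^-1`
        [set complex.Im ((1%:M : Mx) p.1 p.2)]).
  apply/seteqP; split => M /=.
    by move=> /unitary_adj h p _ /=; split; rewrite /= -[_ * _]/(_ *m _) h.
  move=> h; apply: unitary_of_adj; apply/matrixP => i j.
  have [/= h1 h2] := h (i, j) I.
  by apply/eqP; rewrite eq_complex -[_ *m _]/(_ * _) h1 h2 !eqxx.
apply: fin_bigcap_measurable; first exact: finite_finset.
move=> [i j] _ /=; have [mr mi _] := bE i j; apply: measurableI.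
  by rewrite -[X in measurable X]setTI; apply: mr.
by rewrite -[X in measurable X]setTI; apply: mi.
Qed.

Lemma unitary_frob2 (M : Mx) : M \is unitarymx -> frob2 M = n.+1%:R.
Proof.
move=> /unitary_adjl h; apply: rc_inj; rewrite frob2_tr h mxtrace1 rc_nat //.
Qed.

Lemma entry_bounded : bounded_mx Uset (fun M : MM => M : Mx).
Proof.
move=> i j; have [mr mi _] := entry_measurable i j; split => //.
exists n.+1%:R => M /= /unitary_frob2 MU.
rewrite -(@ler_pXn2r _ 2) ?nnegrE //; last by rewrite rc_nat ler0n.
rewrite normCKC -rc_sqr2 -rcX /rc lecR.
apply: le_trans (_ : frob2 (M : Mx) <= _); last first.
  by rewrite MU expr2 ler_peMr // ler1n.
rewrite /frob2 (bigD1 i) //= (bigD1 j) //= -addrA lerDl addr_ge0 //.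
  by apply: sumr_ge0 => k _; rewrite addr_ge0 ?sqr_ge0.
by apply: sumr_ge0 => k _; apply: sumr_ge0 => l _; rewrite addr_ge0 ?sqr_ge0.
Qed.

Lemma mulmx_measurable (V : Mx) : measurable_fun setT (fun M : MM => V *m (M : Mx) : MM).
Proof.
have bE : bounded_mx set0 (fun M : MM => V * (M : Mx)).
  by apply: bounded_mx_mul; [exact: bounded_mx_cst | exact: entry_measurable].
apply: (@measurability _ _ MM MM setT _ (@mx_gen R n.+1)); first by [].
move=> _ [_ [i [j [B [mB [->|->]]]]] <-]; rewrite setTI.
- by have [mr _ _] := bE i j; rewrite -[X in measurable X]setTI; apply: mr.
- by have [_ mi _] := bE i j; rewrite -[X in measurable X]setTI; apply: mi.
Qed.

Variable mu : probability MM R.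
Hypotheses (mu_unitary : mu (~` Uset) = 0%E)
  (mu_inv : forall V : Mx, V \is unitarymx -> forall E : set MM, measurable E ->
     mu E = mu ((fun M : MM => V *m (M : Mx) : MM) @^-1` E)).

Lemma mu_Uset : mu Uset = 1%E.
Proof.
have := probability_setC mu (measurableC measurable_Uset).
by rewrite setCK mu_unitary sube0.
Qed.

Lemma Uset_mul (V : Mx) : V \is unitarymx ->
  (fun M : MM => V *m (M : Mx) : MM) @^-1` Uset = Uset.
Proof.
move=> VU; apply/seteqP; split=> M /=; rewrite /Uset /=.
  move=> h; have -> : (M : Mx) = adjmx V *m (V *m (M : Mx)).
    by rewrite mulmxA unitary_adjl // mul1mx.
  have VU' : adjmx V \is unitarymx by rewrite adjmx_trC trmxC_unitary.
  exact (mul_unitarymx VU' h).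
by move=> h; exact (mul_unitarymx VU h).
Qed.

(** Change of variables under left multiplication, which preserves [Uset]. *)
Lemma expect_inv (V : Mx) (f : MM -> R) : V \is unitarymx -> bounded_real Uset f ->
  bounded_real Uset (fun M : MM => f (V *m (M : Mx) : MM)) ->
  expect mu Uset (fun M : MM => f (V *m (M : Mx) : MM)) = expect mu Uset f.
Proof.
move=> VU bf bf'.
have mphi := mulmx_measurable V.
rewrite /expect /Rintegral; congr fine.
transitivity (\int[pushforward mu (fun M : MM => V *m (M : Mx) : MM)]_(y in Uset) (f y)%:E)%E.
  have h1 : measurable_fun setT (EFin \o f) by apply/measurable_EFinP; case: bf.
  have h2 := bounded_real_integrable measurable_Uset mu_Uset bf'.
  rewrite -(Uset_mul VU) in h2.
  by rewrite (integral_pushforward mphi h1 h2 measurable_Uset) Uset_mul.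
by apply: eq_measure_integral => A mA _; rewrite /= [RHS](mu_inv VU mA).
Qed.

Lemma expectC_inv (V : Mx) (f : MM -> C) : V \is unitarymx -> bounded_cplx Uset f ->
  bounded_cplx Uset (fun M : MM => f (V *m (M : Mx) : MM)) ->
  expectC mu Uset (fun M : MM => f (V *m (M : Mx) : MM)) = expectC mu Uset f.
Proof.
move=> VU bf bf'; rewrite /expectC; congr Complex.
  by apply: (expect_inv (f := fun M => complex.Re (f M))) => //; exact: bounded_cplx_Re.
by apply: (expect_inv (f := fun M => complex.Im (f M))) => //; exact: bounded_cplx_Im.
Qed.

End MatrixSpace.

(** * The matrices c and W for fixed bits *)

Section BitMatrices.
Context {R : realType} (n : nat).
Local Notation C := (complex R).
Local Notation MM := (cmxm R n.+1).
Local Notation Mx := 'M[C]_n.+1.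
Variables (al : R) (av bv : 'I_n.+1 -> bool).
Hypothesis al01 : 0 < al < 1.

(** For Bernoulli(al) bits the diagonal of [cmat] is standardised and [kapp] is its third moment.
    The traces [gamm] and [omm] of c and W vanish when the bit fractions are exactly al and 1/2. *)
Definition sdev : R := Num.sqrt (al * (1 - al)).
Definition kapp : R := (1 - 2 * al) / sdev.
Definition cmat : Mx := rc sdev^-1 *: (bdiag av - (rc al)%:M).
Definition smat : Mx := rc 2 *: bdiag bv - 1%:M.
Definition wmat (M : Mx) : Mx := M *m smat *m adjmx M.
Definition bit_frac (v : 'I_n.+1 -> bool) : R := (n.+1%:R)^-1 * \sum_i (v i)%:R.
Definition gamm : R := (bit_frac av - al) / sdev.
Definition omm : R := 2 * bit_frac bv - 1.

Lemma sdev_gt0 : 0 < sdev.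
Proof. by case/andP: al01 => a0 a1; rewrite sqrtr_gt0 mulr_gt0 // subr_gt0. Qed.

Lemma sdev_sq : sdev ^+ 2 = al * (1 - al).
Proof. by case/andP: al01 => a0 a1; rewrite sqr_sqrtr // mulr_ge0 ?subr_ge0 // ltW. Qed.

Lemma bdiag_sq v : bdiag v *m bdiag v = bdiag v :> Mx.
Proof.
apply/matrixP => i j; rewrite /bdiag mul_diag_mx !mxE.
by case: eqP => _; rewrite ?mulr1n ?mulr0n ?mulr0 //; case: (v i); rewrite ?mulr1 ?mulr0.
Qed.

Lemma bdiag_adj v : adjmx (bdiag v) = bdiag v :> Mx.
Proof.
apply/matrixP => i j; rewrite adjmxE !mxE eq_sym.
by case: eqP => [->|_]; rewrite ?mulr0n ?conjC0 // ?mulr1n conjC_nat.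
Qed.

Lemma bdiag_tr v : ntrace (bdiag v : Mx) = rc (bit_frac v).
Proof.
rewrite /ntrace /bit_frac rcM rcV rc_nat rc_sum mxtrace_diag; congr (_ * _).
by apply: eq_bigr => i _; rewrite mxE rc_nat.
Qed.

Lemma idempotent_shift_sq (A : Mx) (y a : C) : A * A = A -> y != 0 -> a * (1 - a) = y * y ->
  (y^-1 *: (A - a *: 1)) * (y^-1 *: (A - a *: 1)) =
  ((1 - 2 * a) / y) *: (y^-1 *: (A - a *: 1)) + 1.
Proof.
move=> AA y0 yy.
have E : (A - a *: 1) * (A - a *: 1) = (1 - 2 * a) *: A + (a * a) *: 1.
  rewrite mulrBl !mulrBr AA -!scalerAl -!scalerAr mul1r !mulr1 scalerA.
  apply/matrixP => i j; rewrite !mxE; move: (A i j) => x.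
  by case: (i == j); rewrite ?mulr1n ?mulr0n; ring.
rewrite -scalerAl -scalerAr E; apply/matrixP => i j; rewrite !mxE; move: (A i j) => x.
case: (i == j); rewrite ?mulr1n ?mulr0n; last by field.
transitivity ((y * y)^-1 * ((1 - 2 * a) * (x - a) + a * (1 - a))); first by field.
by rewrite yy; field.
Qed.

Lemma cmat_sq : cmat * cmat = rc kapp *: cmat + 1.
Proof.
have s0 : rc sdev != 0 by apply/eqP => /rc_inj h; have := sdev_gt0; rewrite h ltxx.
have ss : rc al * (1 - rc al) = rc sdev * rc sdev.
  by rewrite -rcM -expr2 sdev_sq rcM rcB.
rewrite /cmat /kapp rcM rcV rcB rcM rc1 rc_nat -scalemx1.
by apply: idempotent_shift_sq => //; exact: bdiag_sq.
Qed.

Lemma cmat_herm : adjmx cmat = cmat.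
Proof.
rewrite /cmat adjmxZ conj_rc adjmxD adjmxN bdiag_adj.
by rewrite -scalemx1 adjmxZ conj_rc adjmx1.
Qed.

Lemma cmat_tr : ntrace cmat = rc gamm.
Proof.
rewrite /cmat ntraceZ ntraceB bdiag_tr -scalemx1 ntraceZ ntrace1 mulr1 /gamm mulrC.
by rewrite rcM rcB.
Qed.

Lemma smat_sq : smat *m smat = 1%:M.
Proof.
rewrite /smat mulmxBl mul1mx mulmxBr mulmx1 -scalemxAl -scalemxAr bdiag_sq scalerA.
have -> : rc 2 * rc 2 = rc 2 + rc 2 :> C by rewrite -rcM -rcD; congr rc; ring.
by rewrite scalerDl addrK opprB addrC subrK.
Qed.

Lemma smat_herm : adjmx smat = smat.
Proof. by rewrite /smat adjmxD adjmxN adjmxZ conj_rc bdiag_adj adjmx1. Qed.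

Lemma smat_tr : ntrace smat = rc omm.
Proof. by rewrite /smat ntraceB ntraceZ bdiag_tr ntrace1 /omm rcB rcM. Qed.

Lemma wmat_sq (M : Mx) : M \is unitarymx -> wmat M * wmat M = 1.
Proof.
move=> MU; rewrite /wmat -[LHS]/(_ *m _) !mulmxA -(mulmxA _ (adjmx M) M) unitary_adjl //.
by rewrite mulmx1 -(mulmxA M) smat_sq mulmx1 unitary_adj.
Qed.

Lemma wmat_herm (M : Mx) : adjmx (wmat M) = wmat M.
Proof. by rewrite /wmat !adjmxM adjmxK smat_herm mulmxA. Qed.

Lemma wmat_tr (M : Mx) : M \is unitarymx -> ntrace (wmat M) = rc omm.
Proof.
move=> MU; rewrite -smat_tr /ntrace /wmat mxtrace_mulC mulmxA unitary_adjl //.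
by rewrite mul1mx.
Qed.

Lemma wmat_mul (V M : Mx) : wmat (V *m M) = V * wmat M * adjmx V.
Proof. by rewrite /wmat adjmxM -[RHS]/(_ *m _ *m _) !mulmxA. Qed.

Lemma wmat_bounded : bounded_mx (@Uset R n) (fun M : MM => wmat (M : Mx)).
Proof.
apply: bounded_mx_mul; last by apply: bounded_mx_adj; exact: entry_bounded.
by apply: bounded_mx_mul; [exact: entry_bounded | exact: bounded_mx_cst].
Qed.

Variable mu : probability MM R.
Hypotheses (mu_unitary : mu (~` @Uset R n) = 0%E)
  (mu_inv : forall V : Mx, V \is unitarymx -> forall E : set MM, measurable E ->
     mu E = mu ((fun M : MM => V *m (M : Mx) : MM) @^-1` E)).

(** Replacing M by VM conjugates W by V, so left invariance of the law of M is conjugation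
    invariance of the law of W. *)
Lemma wmat_inv (V : Mx) (G : Mx -> C) : V \is unitarymx ->
  bounded_cplx (@Uset R n) (fun M : MM => G (wmat M)) ->
  bounded_cplx (@Uset R n) (fun M : MM => G (V * wmat M * adjmx V)) ->
  expectC mu (@Uset R n) (fun M : MM => G (V * wmat M * adjmx V)) =
  expectC mu (@Uset R n) (fun M : MM => G (wmat M)).
Proof.
move=> VU b1 b2.
have e : (fun M : MM => G (V * wmat M * adjmx V)) =
  (fun M : MM => (fun L : MM => G (wmat L)) (V *m (M : Mx) : MM)).
  by apply/funext => M; rewrite -wmat_mul.
rewrite e; apply: (expectC_inv mu_unitary mu_inv (f := fun L : MM => G (wmat L))) => //.
by rewrite -e.
Qed.

Variables (K : nat) (k0 eps : R).
Hypotheses (k0_ge1 : 1 <= k0) (kap_le : `|kapp| <= k0) (eps_gt0 : 0 < eps)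
  (eps_le1 : eps <= 1) (gam_le : `|gamm| <= eps) (om_le : `|omm| <= eps)
  (K_eps : 12 * K%:R ^+ 3 * k0 ^+ 2 * eps <= 1)
  (K_q : 8 * K%:R * K.+1%:R ^+ 2 * k0 ^+ 2 * n.+1%:R ^- 2 <= eps ^+ 2).

Lemma haar_word_chebyshev k eta : (0 < k)%N -> (k.*2 <= K)%N -> 0 < eta ->
  (mu ([set M : MM | (eta <= `|complex.Re (word_tr cmat (wmat M) k)|)%R] `&` @Uset R n)
     <= (eps ^+ 2 / eta ^+ 2)%:E)%E.
Proof.
exact: (word_tr_chebyshev (@measurable_Uset R n) (mu_Uset mu_unitary) wmat_bounded wmat_inv
  cmat_sq wmat_sq cmat_tr wmat_tr cmat_herm (fun M _ => wmat_herm M)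
  k0_ge1 kap_le eps_gt0 eps_le1 gam_le om_le K_eps K_q).
Qed.

Lemma haar_frob2_markov k x : (k.*2 <= K)%N -> 0 < x ->
  (mu ([set M : MM | (x <= frob2 ((cmat * wmat M) ^+ k))%R] `&` @Uset R n)
     <= (n.+1%:R * (k.+1%:R * K.+1%:R * k0 ^+ 2) / x)%:E)%E.
Proof.
exact: (frob2_word_markov (@measurable_Uset R n) (mu_Uset mu_unitary) wmat_bounded wmat_inv
  cmat_sq wmat_sq cmat_tr wmat_tr cmat_herm (fun M _ => wmat_herm M)
  k0_ge1 kap_le eps_gt0 eps_le1 gam_le om_le K_eps K_q).
Qed.

End BitMatrices.

(** * A pair of projections *)

Lemma sq_le (R : realDomainType) (x y : R) : 0 <= y -> x ^+ 2 <= y ^+ 2 -> x <= y.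
Proof.
move=> y0; case: (lerP 0 x) => x0; last by move=> _; apply: ltW; apply: lt_le_trans x0 y0.
by rewrite ler_pXn2r // nnegrE.
Qed.

(** Substituting A = s c + a for the inner A, the s part lengthens the word by one. In the a part W
    cancels, and A c = ((1 - a) / s) A shortens the word with coefficient a (1 - a) / s = s. The
    cancellation requires at least one letter pair, hence j.+1. *)
Lemma word_recurrence (F : fieldType) n (A c W : 'M[F]_n.+1) (s a : F) j :
  A = s *: c + a *: 1 -> W * W = 1 -> s *: (A * c) = (1 - a) *: A -> s != 0 ->
  a * (1 - a) = s * s ->
  A * (W * (A * (W * c) ^+ j.+1)) = s *: (A * (W * c) ^+ j.+2 + A * (W * c) ^+ j).
Proof.
move=> AE WW Ac s0 as2.
have E1 : A * (W * c) ^+ j.+1 = s *: (c * (W * c) ^+ j.+1) + a *: (W * c) ^+ j.+1.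
  by rewrite {1}AE mulrDl -!scalerAl mul1r.
have E2 : W * (c * (W * c) ^+ j.+1) = (W * c) ^+ j.+2 by rewrite mulrA -exprS.
have E3 : W * (W * c) ^+ j.+1 = c * (W * c) ^+ j.
  by rewrite exprS !mulrA WW mul1r.
have E4 : A * c = (s^-1 * (1 - a)) *: A by rewrite -scalerA -Ac scalerA mulVf // scale1r.
rewrite E1 mulrDr -!scalerAr E2 E3 mulrDr -!scalerAr scalerDr; congr (_ + _).
rewrite mulrA E4 -scalerAl scalerA; congr (_ *: _).
by rewrite mulrCA as2 mulKf.
Qed.

(** The tail is small and the fold is close to 1 if i = j and to 0 otherwise: the words are nearly
    orthogonal, with squared norm near a. *)
Lemma dot_words (F : numFieldType) n (A c W : 'M[F]_n.+1) (s a : F) i j :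
  A = s *: c + a *: 1 -> A * A = A ->
  ntrace ((c * W) ^+ i * A * (A * (W * c) ^+ j)) =
  s * tail_tr c W (i + j) + a * fold_tr c W i j.
Proof.
move=> AE AA.
have E1 : A * (W * c) ^+ j = s *: ((c * W) ^+ j * c) + a *: (W * c) ^+ j.
  by rewrite {1}AE mulrDl -!scalerAl mul1r word_swap.
have E2 : (c * W) ^+ i * A * (A * (W * c) ^+ j) = (c * W) ^+ i * (A * (W * c) ^+ j).
  by rewrite -mulrA (mulrA A A) AA.
rewrite E2 E1 mulrDr -!scalerAr ntraceD !ntraceZ /fold_tr /tail_tr; congr (_ * ntrace _ + _).
by rewrite mulrA -exprD.
Qed.

Section ProjectionPair.
Context {R : realType} (n : nat).
Local Notation C := (complex R).
Local Notation Mx := 'M[C]_n.+1.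
Variables (al : R) (av bv : 'I_n.+1 -> bool).
Hypothesis al01 : 0 < al < 1.
Variable (U : Mx).

Local Notation A := (bdiag av : Mx).
Local Notation s := (sdev al).
Definition pmat : Mx := bdiag av *m U *m bdiag bv.
Definition xmat : Mx := bdiag av *m U *m bdiag bv *m adjmx U *m bdiag av.

Lemma xmat_gram : xmat = pmat *m adjmx pmat.
Proof.
by rewrite /xmat /pmat !adjmxM !bdiag_adj !mulmxA -(mulmxA _ (bdiag bv) (bdiag bv)) bdiag_sq.
Qed.

Lemma xmat_top : exists x : 'cV[C]_n.+1,
  [/\ x != 0, xmat *m x = rc (lambda_max xmat) *: x &
      forall q (y : 'M[C]_(n.+1, q)), frob2 (adjmx pmat *m y) <= lambda_max xmat * frob2 y].
Proof. by rewrite xmat_gram; exact: lambda_maxP. Qed.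

Lemma xmat_ge0 : 0 <= lambda_max xmat.
Proof. by rewrite xmat_gram; exact: lambda_max_ge0. Qed.

Lemma xmat_range (x : 'cV[C]_n.+1) l : l != 0 -> xmat *m x = rc l *: x -> A *m x = x.
Proof.
move=> l0 Xx; have lC : rc l != 0 by apply: contra l0 => /eqP /rc_inj ->.
have : A *m (xmat *m x) = xmat *m x.
  by rewrite /xmat !mulmxA bdiag_sq.
by rewrite Xx -scalemxAr => /(scalerI lC).
Qed.

Lemma bdiag_contract q v (y : 'M[C]_(n.+1, q)) : frob2 (bdiag v *m y) <= frob2 y.
Proof.
rewrite /frob2; apply: ler_sum => i _; apply: ler_sum => j _.
rewrite /bdiag mul_diag_mx !mxE; case: (v i); first by rewrite mul1r.
by rewrite mul0r /= expr0n /= addr0 addr_ge0 ?sqr_ge0.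
Qed.

Hypothesis UU : U \is unitarymx.
Local Notation W := (wmat bv U).
Local Notation c := (cmat al av).

Lemma frob2_unitaryV q (y : 'M[C]_(n.+1, q)) : frob2 (adjmx U *m y) = frob2 y.
Proof. by apply: frob2_unitary; rewrite adjmxK unitary_adj. Qed.

Lemma lambda_max_le1 : lambda_max xmat <= 1.
Proof.
have [x [x0 Xx ub]] := xmat_top.
have fx := frob2_gt0 x0.
have : frob2 (adjmx pmat *m x) = lambda_max xmat * frob2 x.
  by apply: rc_inj; rewrite gram_form -xmat_gram Xx rcM frob2_tr -scalemxAr mxtraceZ.
rewrite /pmat !adjmxM !bdiag_adj -!mulmxA => h.
have := bdiag_contract bv (adjmx U *m (A *m x)).
rewrite h frob2_unitaryV => /le_trans /(_ (bdiag_contract _ _)).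
by rewrite -{2}[frob2 x]mul1r ler_pM2r.
Qed.

Lemma xmat_wmat q (y : 'M[C]_(n.+1, q)) : A *m y = y ->
  rc 2 *: (xmat *m y) = y + A *m (W *m y).
Proof.
move=> Ay; rewrite /xmat -mulmxA Ay -!mulmxA /wmat /smat.
rewrite mulmxBl mul1mx -scalemxAl mulmxBr -scalemxAr (mulmxA U (adjmx U)) (unitary_adj UU).
by rewrite mul1mx mulmxBr -scalemxAr Ay addrC subrK.
Qed.

Lemma W_invol q (y : 'M[C]_(n.+1, q)) : W *m (W *m y) = y.
Proof. by rewrite mulmxA -[W *m W]/(W * W) wmat_sq // mul1mx. Qed.

Lemma W_frob2 q (y : 'M[C]_(n.+1, q)) : frob2 (W *m y) = frob2 y.
Proof. by apply: frob2_unitary; rewrite wmat_herm -[W *m W]/(W * W) wmat_sq. Qed.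

Lemma c_mul q (y : 'M[C]_(n.+1, q)) : rc s *: (c *m y) = A *m y - rc al *: y.
Proof.
have s0 : rc s != 0 by apply/eqP => /rc_inj h; have := sdev_gt0 al01; rewrite h ltxx.
by rewrite /cmat -scalemxAl scalerA rcV mulfV // scale1r mulmxBl mul_scalar_mx.
Qed.

Lemma sdev_le : s <= 1 / 2.
Proof.
have s0 := sdev_gt0 al01; have s2 := sdev_sq al01.
apply: sq_le; first lra.
rewrite s2 -subr_ge0 (_ : _ - _ = (al - 1 / 2) ^+ 2); last by field.
exact: sqr_ge0.
Qed.

(* Ihara-Bass trick: on span(x, Wx) the operator cW has determinant 1 and trace l/s,
   where l is the eigenvalue of AWA at x. *)
Lemma upper_word del k : al <= 1 / 2 -> 0 < del ->
  1 / 2 + s + del <= lambda_max xmat -> (1 + del) ^+ k.*2 <= frob2 ((c * W) ^+ k).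
Proof.
move=> alh d0 hl; have s0 := sdev_gt0 al01; have sh := sdev_le; have s2 := sdev_sq al01.
have [a0 a1] := andP al01.
have [x [x0 Xx _]] := xmat_top.
set lam := lambda_max xmat in hl Xx.
have lam0 : lam != 0 by rewrite gt_eqF //; lra.
have Ax := xmat_range lam0 Xx.
pose l := 2 * lam - 1.
have AWx : A *m (W *m x) = rc l *: x.
  have h := xmat_wmat Ax; rewrite Xx scalerA in h.
  by rewrite /l rcB rcM scalerBl scale1r h addrAC subrr add0r.
pose L := l / s; have Ls : L * s = l by rewrite /L divfK // gt_eqF.
have L2 : 2 + 2 * del <= L.
  rewrite /L ler_pdivlMr // /l.
  have : del * s <= del * 1 by rewrite ler_wpM2l ?ltW //; lra.
  lra.
(* The larger root of mu^2 - L mu + 1, the characteristic polynomial of cW on span(x, Wx); it is at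
   least L / 2. *)
pose mu := (L + Num.sqrt (L ^+ 2 - 4)) / 2.
have disc : 0 <= L ^+ 2 - 4.
  have : 2 * 2 <= L * L by apply: ler_pM; lra.
  rewrite expr2; lra.
have mu_ge : 1 + del <= mu.
  have := sqrtr_ge0 (L ^+ 2 - 4); rewrite /mu; lra.
have muE : mu ^+ 2 = L * mu - 1.
  have := sqr_sqrtr disc; rewrite /mu; set r := Num.sqrt _ => r2.
  have -> : ((L + r) / 2) ^+ 2 = (L ^+ 2 + 2 * L * r + r ^+ 2) / 4 by field.
  by rewrite r2; field.
clearbody mu.
(* Up to a factor, the solution of cW y = mu y in span(x, Wx). *)
pose y := rc (mu * s) *: x - rc al *: (W *m x).
have sC : rc s != 0 by apply/eqP => /rc_inj h; rewrite h ltxx in s0.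
have Yy : (c * W) *m y = rc mu *: y.
  apply: (scalerI sC).
  rewrite -[c * W]/(c *m W) -mulmxA c_mul /y mulmxBr -!scalemxAr W_invol.
  rewrite mulmxBr -!scalemxAr AWx Ax.
  have e1 : mu * s * l - al + al * al = s * mu * (mu * s).
    have -> : s * mu * (mu * s) = mu ^+ 2 * s ^+ 2 by ring.
    rewrite muE s2 -Ls.
    have -> : mu * s * (L * s) = L * mu * s ^+ 2 by ring.
    rewrite s2; ring.
  move/(congr1 (@rc R)): e1; rewrite rcD rcB !rcM => e1.
  move: (W *m x) => v; apply/matrixP => i j; rewrite !mxE; move: (x i j) (v i j) => p q.
  transitivity ((rc mu * rc s * rc l - rc al + rc al * rc al) * p - rc mu * rc s * rc al * q).
    by ring.
  by rewrite e1; ring.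
(* If y vanished, the isometry W would give mu s = al in absolute value. But al <= 1/2 implies al <=
   s < mu s; this is where the regime of small alpha enters. *)
have y0 : y != 0.
  apply/eqP => /eqP; rewrite subr_eq0 => /eqP /(congr1 (@frob2 R _ _)).
  rewrite !frob2Zr W_frob2 => /(mulIf _) h.
  have {}h := h ltac:(by rewrite gt_eqF // frob2_gt0).
  have als : al <= s.
    by apply: sq_le; [lra | rewrite s2 expr2 ler_wpM2l //; lra].
  have : mu * s <= al by apply: sq_le; [lra | rewrite h].
  have : s * 1 < s * mu by rewrite ltr_pM2l //; lra.
  lra.
have := frob2_eigen_ge y0 (eigen_exp k Yy).
rewrite -rcX /= expr0n /= addr0 -exprM muln2.
by apply: le_trans; rewrite lerXn2r ?nnegrE //; lra.
Qed.

(** Matrices replace the vectors of a Krylov space: with the normalised trace as inner product, no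
    starting vector has to be chosen. *)
Definition krylov_mx (j : nat) : Mx := A * (W * c) ^+ j.

Lemma A_krylov j : A *m krylov_mx j = krylov_mx j.
Proof. by rewrite -[A *m _]/(A * _) /krylov_mx mulrA -[A * A]/(A *m A) bdiag_sq. Qed.

Lemma AcE : rc s *: c = A - rc al *: 1.
Proof. by have := c_mul (1%:M : Mx); rewrite !mulmx1. Qed.

Lemma W_krylov j : A *m (W *m krylov_mx j.+1) = rc s *: (krylov_mx j.+2 + krylov_mx j).
Proof.
have s0 := sdev_gt0 al01; have s2 := sdev_sq al01.
have WW : W * W = 1 by exact: wmat_sq.
have AA : A * A = A by exact: bdiag_sq.
have AE : A = rc s *: c + rc al *: 1 by rewrite AcE subrK.
have Ac : rc s *: (A * c) = rc (1 - al) *: A.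
  by rewrite scalerAr AcE mulrBr AA -scalerAr mulr1 rcB scalerBl scale1r.
have sC : rc s != 0 by apply/eqP => /rc_inj h; rewrite h ltxx in s0.
have as2 : rc al * (1 - rc al) = rc s * rc s by rewrite -rc1 -rcB -!rcM -expr2 s2.
rewrite rcB rc1 in Ac.
exact (word_recurrence j AE WW Ac sC as2).
Qed.

Lemma krylov_dot i j :
  ntrace (adjmx (krylov_mx i) * krylov_mx j) = rc s * tail_tr c W (i + j) + rc al * fold_tr c W i j.
Proof.
have AA : A * A = A by exact: bdiag_sq.
have AE : A = rc s *: c + rc al *: 1 by rewrite AcE subrK.
have -> : adjmx (krylov_mx i) = (c * W) ^+ i * A.
  rewrite /krylov_mx -[A * _]/(A *m _) adjmxM bdiag_adj.
  by rewrite -[adjmx _]adjmxK -(adjmx_word (cmat_herm al av) (wmat_herm bv U)) !adjmxK.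
exact (dot_words _ i j AE AA).
Qed.

Variables (k0 eta : R) (L : nat).
Hypotheses (k0_ge1 : 1 <= k0) (kap_le : `|kapp al| <= k0) (eta_ge0 : 0 <= eta)
  (gam_le : `|gamm al av| <= eta) (om_le : `|omm bv| <= eta)
  (tau_le : forall k, (0 < k)%N -> (k <= L.*2.+2)%N -> `|complex.Re (word_tr c W k)| <= eta).

Let nrc (y : R) : `|rc y| = rc `|y|.
Proof. by rewrite normc_def /= expr0n addr0 sqrtr_sqr. Qed.

Let M : R := (L.*2 + 3)%:R.

Lemma tau_small k : (0 < k)%N -> (k <= L.*2.+2)%N -> `|word_tr c W k| <= rc eta.
Proof.
move=> k1 k2; rewrite (word_tr_real (cmat_herm al av) (wmat_herm bv U)) nrc /rc lecR.
exact: tau_le.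
Qed.

Lemma normrcM (z z' : C) (x y : R) : `|z| <= rc x -> `|z'| <= rc y -> `|z * z'| <= rc (x * y).
Proof. by move=> *; rewrite normrM rcM ler_pM. Qed.
Lemma normrcD (z z' : C) (x y : R) : `|z| <= rc x -> `|z'| <= rc y -> `|z + z'| <= rc (x + y).
Proof. by move=> *; rewrite rcD (le_trans (ler_normD _ _)) // lerD. Qed.
Lemma normrcW (z : C) (x y : R) : x <= y -> `|z| <= rc x -> `|z| <= rc y.
Proof. by move=> xy /le_trans; apply; rewrite /rc lecR. Qed.

Lemma tail_small k : (k <= L.*2.+2)%N -> `|tail_tr c W k| <= rc (k.+1%:R * k0 * eta).
Proof.
have k01 := k0_ge1; have e_0 := eta_ge0; have g_e := gam_le; have o_e := om_le.
have k00 : 0 <= k0 by lra.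
have kc : `|rc (kapp al)| <= rc k0 by rewrite nrc /rc lecR.
have csq := cmat_sq av al01; have Wsq := wmat_sq bv UU.
have ke : eta <= k0 * eta by rewrite ler_peMl.
elim/ltn_ind: k => -[|[|k]] IH kL.
- rewrite /tail_tr expr0 mul1r cmat_tr nrc /rc lecR mul1r; lra.
- rewrite (tail_tr1 _ csq) wmat_tr //.
  apply: normrcW (normrcD (normrcM kc (tau_small _ _)) (_ : _ <= rc eta)) => //.
    lra.
  by rewrite nrc /rc lecR.
- rewrite (tail_trS csq Wsq).
  apply: normrcW (normrcD (normrcM kc (tau_small _ _)) (IH k _ _)) => //; last by nlia.
  have -> : k.+3 = (k.+1 + 2)%N by nlia.
  rewrite natrD; have : 0 <= k0 * eta by lra.
  move: (k.+1%:R : R) => x; lra.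
Qed.

(** Pointwise counterpart of the expectation bounds, on the event that all tau_k in range are small:
    only tau_0 = 1 at the end of the diagonal recursion survives. *)
Lemma fold_small k l : (k + l <= L.*2.+2)%N ->
  `|fold_tr c W k l - (k == l)%:R| <= rc (k.+1%:R * M * k0 ^+ 2 * eta).
Proof.
have k01 := k0_ge1; have e_0 := eta_ge0; have g_e := gam_le; have o_e := om_le.
have k00 : 0 <= k0 by lra.
have kc : `|rc (kapp al)| <= rc k0 by rewrite nrc /rc lecR.
have csq := cmat_sq av al01; have Wsq := wmat_sq bv UU.
have M1 : 1 <= M by rewrite ler1n; nlia.
have k02 : 1 <= k0 ^+ 2 by rewrite expr_ge1.
have Mk : eta <= M * k0 ^+ 2 * eta by rewrite ler_peMl // mulr_ege1.
have base (j : nat) : eta <= j.+1%:R * M * k0 ^+ 2 * eta.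
  apply: le_trans Mk _; rewrite -!mulrA ler_peMl ?ler1n // !mulr_ge0 ?exprn_ge0 //; lra.
elim: k l => [|k IH] [|l] kl.
- rewrite fold_tr0l word_tr0 subrr normr0 /rc lecR; apply: le_trans (base 0%N); lra.
- by rewrite fold_tr0l subr0; apply: normrcW (base 0%N) (tau_small _ _).
- by rewrite fold_tr0r subr0; apply: normrcW (base k.+1) (tau_small _ _); nlia.
- rewrite (fold_trS csq Wsq) eqSS -addrA.
  apply: normrcW (normrcD (normrcM kc (tail_small _)) (IH _ _)); try nlia.
  rewrite -[in leRHS]natr1 !mulrDl mul1r addrC lerD2l.
  have -> : k0 * ((k + l).+1%:R * k0 * eta) = (k + l).+1%:R * (k0 ^+ 2 * eta) by ring.
  rewrite -mulrA ler_wpM2r ?mulr_ge0 ?exprn_ge0 //.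
  by rewrite /M ler_nat; nlia.
Qed.

Let th : R := (L + 4)%:R * M * k0 ^+ 2 * eta.

(** Indices go up to L + 1 since the shift moves the last test word one step further; hence the
    control of tau_k up to 2L + 2. *)
Lemma dot_small i j : (i <= L.+1)%N -> (j <= L.+1)%N ->
  `|ntrace (adjmx (krylov_mx i) * krylov_mx j) - rc (al * (i == j)%:R)| <= rc th.
Proof.
have k01 := k0_ge1; have e_0 := eta_ge0; have g_e := gam_le; have o_e := om_le.
move=> iL jL; rewrite krylov_dot rcM rc_nat -addrA -mulrBr.
have [a0 a1] := andP al01; have s0 := sdev_gt0 al01; have sh := sdev_le.
have ij : (i + j <= L.*2.+2)%N by nlia.
have sc : `|rc s| <= rc 1 by rewrite nrc /rc lecR gtr0_norm //; lra.
have ac : `|rc al| <= rc 1 by rewrite nrc /rc lecR gtr0_norm //; lra.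
apply: normrcW (normrcD (normrcM sc (tail_small ij)) (normrcM ac (fold_small ij))).
rewrite !mul1r /th.
have k00 : 0 <= k0 by lra.
have h1 : (i + j).+1%:R * k0 * eta <= 1 * (M * k0 ^+ 2 * eta).
  rewrite mul1r ler_wpM2r // ler_pM //; first by rewrite ler_nat; nlia.
  by rewrite expr2 ler_peMl.
have h2 : i.+1%:R * M * k0 ^+ 2 * eta <= L.+2%:R * (M * k0 ^+ 2 * eta).
  by rewrite !mulrA !ler_wpM2r ?exprn_ge0 ?ler0n // ler_nat.
have h3 : 0 <= M * k0 ^+ 2 * eta by rewrite !mulr_ge0 ?exprn_ge0 ?ler0n.
have -> : (L + 4)%N = (L.+2 + 2)%N by nlia.
rewrite natrD; move: h1 h2; rewrite -!mulrA; rewrite -!mulrA in h3.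
move: (L.+2%:R : R) (M * _) h3 => x y h3; lra.
Qed.

(** The sum starts at index 1, where the three-term relation becomes available. Equal weights are
    good enough: the boundary loss is of relative order 1 / L. *)
Definition test_mx : Mx := \sum_(j < L) krylov_mx j.+1.

Lemma A_test_mx : A *m test_mx = test_mx.
Proof. by rewrite /test_mx mulmx_sumr; apply: eq_bigr => j _; exact: A_krylov. Qed.

Lemma test_mx_sq : `|ntrace (adjmx test_mx * test_mx) - rc (al * L%:R)| <= rc ((L * L)%:R * th).
Proof.
have -> : ntrace (adjmx test_mx * test_mx) - rc (al * L%:R) =
  \sum_(i < L) \sum_(j < L) (ntrace (adjmx (krylov_mx i.+1) * krylov_mx j.+1) - rc (al * (i.+1 == j.+1)%:R)).
  have -> : adjmx test_mx = \sum_(i < L) adjmx (krylov_mx i.+1).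
    rewrite /test_mx; apply: (big_morph (fun M : Mx => adjmx M)); first exact: adjmxD.
    by apply/matrixP => i j; rewrite adjmxE !mxE conjC0.
  rewrite mulr_suml ntrace_sum -[X in _ - X](_ : \sum_(i < L) rc al = _); last first.
    by rewrite sumr_const card_ord rcM rc_nat mulr_natr.
  rewrite -sumrB; apply: eq_bigr => i _.
  rewrite /test_mx mulr_sumr ntrace_sum sumrB; congr (_ - _).
  rewrite (bigD1 i) //= eqxx mulr1 big1 ?addr0 // => j ji.
  by rewrite eqSS eq_sym (inj_eq val_inj) (negbTE ji) mulr0.
apply: le_trans (ler_norm_sum _ _ _) _.
apply: le_trans (_ : \sum_(i < L) \sum_(j < L) rc th <= _).
  apply: ler_sum => i _; apply: le_trans (ler_norm_sum _ _ _) _; apply: ler_sum => j _.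
  by apply: dot_small; have := ltn_ord i; have := ltn_ord j; nlia.
by rewrite !sumr_const card_ord -mulrnA rcM rc_nat mulr_natl.
Qed.

Lemma test_mx_shift : (0 < L)%N ->
  `|ntrace (adjmx test_mx * (A * (W * test_mx))) - rc (s * (al * (2 * (L%:R - 1))))|
    <= rc (s * (2 * (L * L)%:R * th)).
Proof.
move=> L0.
have s0 := sdev_gt0 al01.
pose G i j := ntrace (adjmx (krylov_mx i) * krylov_mx j).
have -> : ntrace (adjmx test_mx * (A * (W * test_mx))) - rc (s * (al * (2 * (L%:R - 1)))) = rc s *
  \sum_(i < L) \sum_(j < L) ((G i.+1 j.+2 - rc (al * (i.+1 == j.+2)%:R))
       + (G i.+1 j - rc (al * (i.+1 == j :> nat)%:R))).
  have -> : adjmx test_mx = \sum_(i < L) adjmx (krylov_mx i.+1).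
    rewrite /test_mx; apply: (big_morph (fun M : Mx => adjmx M)); first exact: adjmxD.
    by apply/matrixP => i j; rewrite adjmxE !mxE conjC0.
  have -> : A * (W * test_mx) = rc s *: \sum_(j < L) (krylov_mx j.+2 + krylov_mx j).
    rewrite /test_mx mulr_sumr mulr_sumr scaler_sumr; apply: eq_bigr => j _; exact: W_krylov.
  rewrite -scalerAr ntraceZ rcM -mulrBr; congr (_ * _).
  rewrite mulr_suml ntrace_sum.
  have -> : \sum_(i < L) \sum_(j < L) ((G i.+1 j.+2 - rc (al * (i.+1 == j.+2)%:R))
       + (G i.+1 j - rc (al * (i.+1 == j :> nat)%:R))) =
    \sum_(i < L) \sum_(j < L) (G i.+1 j.+2 + G i.+1 j) -
    rc (al * (\sum_(i < L) \sum_(j < L) ((i.+1 == j.+2) + (i.+1 == j :> nat)))%:R).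
    rewrite natr_sum mulr_sumr rc_sum -sumrB; apply: eq_bigr => i _.
    rewrite natr_sum mulr_sumr rc_sum -sumrB; apply: eq_bigr => j _.
    by rewrite natrD mulrDr rcD opprD addrACA.
  congr (_ - rc (_ * _)).
    apply: eq_bigr => i _; rewrite mulr_sumr ntrace_sum; apply: eq_bigr => j _.
    by rewrite mulrDr ntraceD.
  (* The number of ordered pairs of neighbours in a path with L vertices. *)
  have -> : (\sum_(i < L) \sum_(j < L) ((i.+1 == j.+2) + (i.+1 == j :> nat)) = 2 * (L - 1))%N.
    rewrite (eq_bigr (fun i : 'I_L => (0 < i) + (i.+1 < L)))%N; last first.
      move=> i _; rewrite big_split /=; congr (_ + _)%N.
        case: i => -[|i] iL /=; first by rewrite big1.
        rewrite (bigD1 (Ordinal (ltnW iL))) //= eqxx big1 ?addn0 // => j ji.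
        by rewrite !eqSS eq_sym; move: ji; rewrite -(inj_eq val_inj) /= => /negbTE ->.
      case: (ltnP i.+1 L) => h.
        rewrite (bigD1 (Ordinal h)) //= eqxx big1 // => j ji.
        by rewrite eq_sym; move: ji; rewrite -(inj_eq val_inj) /= => /negbTE ->.
      by rewrite big1 // => j _; have := ltn_ord j; case: eqP => //; nlia.
    rewrite big_split /= mul2n -addnn; case: L L0 => // L' _; rewrite subn1 /=; congr (_ + _)%N.
      by rewrite big_ord_recl /= sum_nat_const card_ord muln1.
    rewrite big_ord_recr /= ltnn addn0 (eq_bigr (fun=> 1%N)) => [|i _].
      by rewrite sum_nat_const card_ord muln1.
    by rewrite ltnS ltn_ord.
  by rewrite natrM natrB.
apply: normrcM; first by rewrite nrc gtr0_norm.
apply: le_trans (ler_norm_sum _ _ _) _.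
apply: le_trans (_ : \sum_(i < L) \sum_(j < L) rc (th + th) <= _).
  apply: ler_sum => i _; apply: le_trans (ler_norm_sum _ _ _) _; apply: ler_sum => j _.
  by apply: normrcD; apply: dot_small; have := ltn_ord i; have := ltn_ord j; nlia.
have -> : 2 * (L * L)%:R * th = (L * L)%:R * (th + th) by ring.
by rewrite !sumr_const card_ord -mulrnA rcM rc_nat mulr_natl.
Qed.

(** Let TH = L^2 th be the accumulated error. A top eigenvalue at most 1/2 + s - del would give del
    (al L - TH) <= al + 2 TH; but del L >= 2 and del <= 1 then yield al <= 3 TH, against the
    smallness hypothesis. *)
Lemma lower_lambda del : 0 < del <= 1 -> 2 <= del * L%:R ->
  3 * (L * L)%:R * th < al -> 1 / 2 + s - del < lambda_max xmat.
Proof.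
have k01 := k0_ge1; have e_0 := eta_ge0; have g_e := gam_le; have o_e := om_le.
move=> /andP[d0 d1] dL small.
have [a0 a1] := andP al01; have s0 := sdev_gt0 al01; have sh := sdev_le.
have L0 : (0 < L)%N by rewrite lt0n; apply/eqP => h; move: dL; rewrite h mulr0; lra.
have [x [_ _ ub]] := xmat_top.
rewrite ltNge; apply/negP => hl; set lam := lambda_max xmat in hl ub.
have h1 := normc_Re_le test_mx_sq; have h2 := normc_Re_le (test_mx_shift L0).
set qq := ntrace (adjmx test_mx * test_mx) in h1; set pp := ntrace _ in h2.
have N0 : 0 < n.+1%:R :> R by rewrite ltr0n.
have fq : frob2 test_mx = n.+1%:R * complex.Re qq.
  have : rc (frob2 test_mx) = n.+1%:R * qq by rewrite frob2_tr -[adjmx test_mx *m test_mx]/(adjmx test_mx * test_mx) trE.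
  by rewrite -rc_nat => /(congr1 (@complex.Re R)); rewrite cReM /= mul0r subr0.
have fp : 2 * frob2 (adjmx pmat *m test_mx) = n.+1%:R * (complex.Re qq + complex.Re pp).
  have : rc (2 * frob2 (adjmx pmat *m test_mx)) = n.+1%:R * (qq + pp).
    rewrite rcM gram_form -xmat_gram -mxtraceZ scalemxAr (xmat_wmat A_test_mx) mulmxDr mxtraceD.
    by rewrite mulrDr -!trE.
  by rewrite -rc_nat => /(congr1 (@complex.Re R)); rewrite cReM /= mul0r subr0 cReD.
have := ub _ test_mx; rewrite fq.
have q0 : 0 <= complex.Re qq by rewrite -(pmulr_rge0 _ N0) -fq frob2_ge0.
move=> h3.
have {}h3 : complex.Re qq + complex.Re pp <= 2 * (lam * complex.Re qq).
  rewrite -(ler_pM2l N0) -fp; move: h3; lra.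
have h4 : lam * complex.Re qq <= (1 / 2 + s - del) * complex.Re qq by rewrite ler_wpM2r.
move: h1 h2; rewrite /= !cReD /= => h1 h2.
set Q := complex.Re qq in h1 h2 h3 h4 q0.
set PP := complex.Re pp in h1 h2 h3 h4.
have t0 : 0 <= (L * L)%:R * th.
  by rewrite /th !mulr_ge0 ?exprn_ge0 ?ler0n //; lra.
move: small; rewrite -mulrA => small.
rewrite -mulrA in h2.
set TH := (L * L)%:R * th in h1 h2 t0 small.
set Lr : R := L%:R in h1 h2 dL.
have g1 : al * Lr - TH <= Q <= al * Lr + TH by move: h1; rewrite ler_norml; lra.
have g2 : s * (al * (2 * (Lr - 1))) - s * (2 * TH) <= PP by move: h2; rewrite ler_norml; lra.
have g3 : del * Q <= s * (Q - al * (Lr - 1) + TH) by lra.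
have g4 : Q - al * (Lr - 1) + TH <= al + 2 * TH by lra.
have g5 : s * (Q - al * (Lr - 1) + TH) <= 1 * (al + 2 * TH).
  apply: le_trans (ler_wpM2l (ltW s0) g4) _; rewrite ler_wpM2r //; lra.
have g6 : del * (al * Lr - TH) <= del * Q by rewrite ler_wpM2l ?(ltW d0) //; lra.
have g7 : del * TH <= 1 * TH by rewrite ler_wpM2r.
have g8 : al * 2 <= al * (del * Lr) by rewrite ler_wpM2l ?(ltW a0).
lra.
Qed.

End ProjectionPair.

(** * Intersecting ranges, measurability *)

Lemma bernoulli_ineq (R : realDomainType) (d : R) k : 0 <= d -> 1 + k%:R * d <= (1 + d) ^+ k.
Proof.
move=> d0; elim: k => [|k IH]; first by rewrite mul0r addr0 expr0.
rewrite exprS; apply: le_trans (_ : (1 + d) * (1 + k%:R * d) <= _); last first.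
  by rewrite ler_wpM2l // addr_ge0.
rewrite -natr1 -subr_ge0 (_ : _ - _ = k%:R * (d * d)); last by ring.
by rewrite !mulr_ge0.
Qed.

Lemma mul_idempotent_sandwich (F : pzRingType) m n (u : 'M[F]_(m, n)) (V U D : 'M[F]_n) :
  V *m U = 1%:M -> D *m D = D -> u *m (D *m V) *m (U *m D *m V) = u *m (D *m V).
Proof. by move=> VU DD; rewrite -!mulmxA (mulmxA V U) VU mul1mx (mulmxA D D) DD. Qed.

Section IntersectingRanges.
Context {R : realType} (n : nat).
Local Notation C := (complex R).
Local Notation Mx := 'M[C]_n.+1.

(** The rows of E are the unit vectors selected by v: they are independent and lie in the row space
    of the projection. *)
Lemma rank_bdiag (v : 'I_n.+1 -> bool) : (\sum_i v i <= \rank (bdiag v : Mx))%N.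
Proof.
pose S : {set _} := finset v.
have -> : (\sum_i v i)%N = #|S|.
  by rewrite -sum1_card [RHS]big_mkcond; apply: eq_bigr => i _; rewrite inE; case: (v i).
pose E : 'M[C]_(#|S|, n.+1) := \matrix_(k, j) (enum_val k == j)%:R.
have fE : row_free E.
  apply/row_freeP; exists E^T; apply/matrixP => k l; rewrite !mxE.
  rewrite (bigD1 (enum_val k)) //= big1 ?addr0 => [|j jk].
    by rewrite !mxE eqxx mul1r (inj_eq enum_val_inj) eq_sym.
  by rewrite !mxE eq_sym (negbTE jk) mul0r.
have EE : E = E *m bdiag v.
  apply/matrixP => k j; rewrite /bdiag mul_mx_diag !mxE.
  case: eqP => [<-|_]; last by rewrite mul0r.
  by have := enum_valP k; rewrite inE => ->; rewrite mulr1.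
have : (E <= bdiag v)%MS by rewrite EE submxMl.
by move=> /mxrankS; rewrite (eqP fE).
Qed.

Lemma lambda_max_eq1 (av bv : 'I_n.+1 -> bool) (U : Mx) : U \is unitarymx ->
  (n.+1 < \sum_i av i + \sum_i bv i)%N -> lambda_max (xmat av bv U) = 1.
Proof.
move=> UU big; apply/eqP; rewrite eq_le lambda_max_le1 //=.
(* Subspaces are row spaces here, and right multiplication by U D U^* fixes the row space of D U^*,
   whose rank is that of D. *)
pose G : Mx := bdiag bv *m adjmx U.
have rG : \rank G = \rank (bdiag bv : Mx).
  rewrite /G mxrankMfree // row_free_unit.
  by have [] := mulmx1_unit (unitary_adjl UU).
have := mxrank_sum_cap (bdiag av : Mx) G; rewrite rG => rk.
have cap0 : (bdiag av :&: G != 0)%MS.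
  rewrite -mxrank_eq0 -lt0n.
  have h1 := rank_bdiag av; have h2 := rank_bdiag bv.
  have h3 := rank_leq_col (bdiag av + G)%MS.
  move: rk h1 h2 h3 big; set r := \rank (_ :&: _)%MS; set r' := \rank (_ + _)%MS; lia.
pose v := nz_row (bdiag av :&: G)%MS.
have v0 : v != 0 by rewrite nz_row_eq0.
have : (v <= bdiag av :&: G)%MS by exact: nz_row_sub.
rewrite sub_capmx => /andP[/submxP[u1 e1] /submxP[u2 e2]].
have vA : v *m bdiag av = v by rewrite e1 -mulmxA bdiag_sq.
have vG : v *m (U *m bdiag bv *m adjmx U) = v.
  by rewrite e2; exact (mul_idempotent_sandwich u2 (unitary_adjl UU) (bdiag_sq bv)).
have vX : v *m xmat av bv U = v.
  rewrite /xmat mulmxA; have := vG; rewrite !mulmxA vA => ->; exact: vA.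
have [x [_ _ ub]] := xmat_top av bv U.
pose y := adjmx v.
have y0 : y != 0.
  apply: contra v0 => /eqP h; rewrite -(adjmxK v) -/y h.
  by apply/eqP/matrixP => i j; rewrite adjmxE !mxE conjC0.
have Xy : xmat av bv U *m y = y.
  have XX : adjmx (xmat av bv U) = xmat av bv U by rewrite xmat_gram adjmxM adjmxK.
  by rewrite /y -XX -adjmxM vX.
have := ub _ y.
have -> : frob2 (adjmx (pmat av bv U) *m y) = frob2 y.
  by apply: rc_inj; rewrite gram_form -xmat_gram Xy frob2_tr.
by rewrite -{1}[frob2 y]mul1r ler_pM2r // frob2_gt0.
Qed.

End IntersectingRanges.

Section LambdaMeasurable.
Context {R : realType} (n : nat).
Local Notation C := (complex R).
Local Notation MM := (cmxm R n.+1).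
Local Notation Mx := 'M[C]_n.+1.
Variables (av bv : 'I_n.+1 -> bool).

Lemma frob2_measurable d (T : measurableType d) (M : T -> Mx) :
  bounded_mx set0 M -> measurable_fun setT (fun w => frob2 (M w)).
Proof.
move=> bM; rewrite /frob2.
apply: measurable_sum => i; apply: measurable_sum => j.
by have [mr mi _] := bM i j; apply: measurable_funD; apply: measurable_funX.
Qed.

Lemma lambda_max_measurable :
  measurable_fun setT (fun M : MM => lambda_max (xmat av bv (M : Mx))).
Proof.
have bX k : bounded_mx set0 (fun M : MM => xmat av bv (M : Mx) ^+ k).
  apply: bounded_mx_exp; apply: bounded_mx_mul; last exact: bounded_mx_cst.
  apply: bounded_mx_mul; last by apply: bounded_mx_adj; exact: entry_measurable.
  apply: bounded_mx_mul; last exact: bounded_mx_cst.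
  by apply: bounded_mx_mul; [exact: bounded_mx_cst | exact: entry_measurable].
move=> mD; apply: (measurability _ (RGenOInfty.measurableE R)) => //.
move=> _ [_ [t ->] <-]; rewrite setTI preimage_itvoy.
have -> : [set M : MM | t < lambda_max (xmat av bv (M : Mx))] =
  ~` [set M : MM | lambda_max (xmat av bv (M : Mx)) <= t].
  by apply/seteqP; split=> M /=; rewrite ltNge => /negP.
apply: measurableC.
(* Negative t is separated because only even powers of t appear below and would not see its sign. *)
have [t0|t0] := ltP t 0.
  have -> : [set M : MM | lambda_max (xmat av bv (M : Mx)) <= t] = set0; last exact: measurable0.
  apply/seteqP; split=> M //= h.
  by have := le_lt_trans (le_trans (xmat_ge0 av bv M) h) t0; rewrite ltxx.
have -> : [set M : MM | lambda_max (xmat av bv (M : Mx)) <= t] =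
  \bigcap_k [set M : MM | frob2 (xmat av bv (M : Mx) ^+ k) <= n.+1%:R * t ^+ k.*2].
  apply/seteqP; split=> M /=.
    move=> h k _ /=; apply: le_trans (_ : n.+1%:R * lambda_max (xmat av bv (M : Mx)) ^+ k.*2 <= _).
      by rewrite xmat_gram; exact: frob2_pow_le.
    by rewrite ler_wpM2l // lerXn2r ?nnegrE //; exact: xmat_ge0.
  move=> h; set lam := lambda_max _.
  have l0 : 0 <= lam := xmat_ge0 av bv M.
  have hk k : lam ^+ k.*2 <= n.+1%:R * t ^+ k.*2.
    by apply: le_trans (h k I); rewrite /lam xmat_gram; exact: lambda_max_pow_le.
  rewrite leNgt; apply/negP => tl.
  have lp : 0 < lam by apply: le_lt_trans tl.
  have [t00|t1] := eqVneq t 0.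
    by have := hk 1%N; rewrite t00 expr0n mulr0 leNgt exprn_gt0.
  have tp : 0 < t by rewrite lt_def t1.
  (* If lam > t, then (lam / t)^(2k) outgrows the dimension factor n.+1; Bernoulli's inequality
     provides an explicit k. *)
  pose d := lam / t - 1; have d0 : 0 < d by rewrite /d subr_gt0 ltr_pdivlMr // mul1r.
  have dE : 1 + d = lam / t by rewrite /d addrC subrK.
  pose k := (Num.truncn (n.+1%:R / d)).+1.
  have : (1 + d) ^+ k.*2 <= n.+1%:R by rewrite dE expr_div_n ler_pdivrMr ?exprn_gt0.
  apply/negP; rewrite -ltNge; apply: lt_le_trans (bernoulli_ineq _ (ltW d0)).
  have : n.+1%:R / d < k%:R by rewrite /k truncnS_gt.
  rewrite ltr_pdivrMr // => h1.
  have h2 : k%:R * d <= k.*2%:R * d by rewrite ler_wpM2r ?ler_nat //; [exact: ltW | lia].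
  lra.
apply: bigcapT_measurable => k.
rewrite -[X in measurable X]setTI.
have -> : [set M : MM | frob2 (xmat av bv (M : Mx) ^+ k) <= n.+1%:R * t ^+ k.*2] =
  (fun M : MM => frob2 (xmat av bv (M : Mx) ^+ k)) @^-1` `]-oo, n.+1%:R * t ^+ k.*2]%classic.
  by apply/seteqP; split=> M /=; rewrite in_itv /=.
exact: (frob2_measurable (bX k)).
Qed.

Lemma deviation_measurable (e x : R) :
  measurable [set M : MM | e <= `|lambda_max (xmat av bv (M : Mx)) - x|].
Proof.
have mf : measurable_fun setT (fun M : MM => `|lambda_max (xmat av bv (M : Mx)) - x|).
  apply: measurableT_comp => //; apply: measurable_funB => //; exact: lambda_max_measurable.
rewrite -[X in measurable X]setTI.
have -> : [set M : MM | e <= `|lambda_max (xmat av bv (M : Mx)) - x|] =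
  (fun M : MM => `|lambda_max (xmat av bv (M : Mx)) - x|) @^-1` `[e, +oo[%classic.
  by apply/seteqP; split=> M /=; rewrite in_itv /= andbT.
exact: mf.
Qed.

End LambdaMeasurable.

(** * Random bits *)

Lemma prob_le d (T : measurableType d) (R : realType) (P : probability T R) (A B : set T) :
  measurable A -> measurable B -> A `<=` B -> (P A <= P B)%E.
Proof. by move=> mA mB AB; apply: le_measure => //; rewrite inE. Qed.

Lemma prob_bigU d (T : measurableType d) (R : realType) (P : probability T R)
    (I : Type) (r : seq I) (F : I -> set T) : (forall i, measurable (F i)) ->
  (P (\big[setU/set0]_(i <- r) F i) <= \sum_(i <- r) P (F i))%E.
Proof.
move=> mF; have mU s : measurable (\big[setU/set0]_(i <- s) F i).
  by apply: bigsetU_measurable.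
elim: r => [|i r IH]; first by rewrite !big_nil measure0.
rewrite !big_cons; apply: le_trans (measureU2 _ _ _) _ => //.
by rewrite leeD2l.
Qed.

(** * Deviation probability for fixed bits *)

Section FixedBits.
Context {R : realType} (n : nat).
Local Notation C := (complex R).
Local Notation MM := (cmxm R n.+1).
Local Notation Mx := 'M[C]_n.+1.
Variables (al : R) (av bv : 'I_n.+1 -> bool).
Hypotheses (al01 : 0 < al < 1) (al_half : al <= 1 / 2).
Variable mu : probability MM R.
Hypotheses (mu_unitary : mu (~` @Uset R n) = 0%E)
  (mu_inv : forall V : Mx, V \is unitarymx -> forall E : set MM, measurable E ->
     mu E = mu ((fun M : MM => V *m (M : Mx) : MM) @^-1` E)).
Variables (k L : nat) (k0 eps eta del : R).
Hypotheses (k0_ge1 : 1 <= k0) (kap_le : `|kapp al| <= k0) (eps_gt0 : 0 < eps)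
  (eps_le1 : eps <= 1) (eps_eta : eps <= eta)
  (gam_le : `|gamm al av| <= eps) (om_le : `|omm bv| <= eps)
  (K_eps : 12 * k.*2%:R ^+ 3 * k0 ^+ 2 * eps <= 1)
  (K_q : 8 * k.*2%:R * k.*2.+1%:R ^+ 2 * k0 ^+ 2 * n.+1%:R ^- 2 <= eps ^+ 2)
  (L_k : (L.*2.+2 <= k)%N) (del01 : 0 < del <= 1) (del_L : 2 <= del * L%:R)
  (L_eta : 3 * (L * L)%:R * ((L + 4)%:R * (L.*2 + 3)%:R * k0 ^+ 2 * eta) < al).

(** Outside a null set a deviation forces either a large Frobenius norm of Y^k (upper edge) or some
    |tau_j| >= eta with j <= 2L + 2 (lower edge). The degree budget K is 2k, enough for the fold of
    Y^k and, as 2L + 2 <= k, for the second moments of these tau_j. *)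
Lemma fixed_bits_bound :
  (mu [set M : MM | (del <= `|lambda_max (xmat av bv (M : Mx)) - (1 / 2 + sdev al)|)%R] <=
   (n.+1%:R * (k.+1%:R * k.*2.+1%:R * k0 ^+ 2) / (1 + del) ^+ k.*2
     + L.*2.+2%:R * (eps ^+ 2 / eta ^+ 2))%:E)%E.
Proof.
have e_0 := eps_gt0; have e_e := eps_eta; have eta0 : 0 < eta by lra.
have [d0 d1] := andP del01.
set E0 := [set M : MM | _].
pose X0 := [set M : MM | ((1 + del) ^+ k.*2 <= frob2 ((cmat al av * wmat bv (M : Mx)) ^+ k))%R]
   `&` @Uset R n.
pose F (j : 'I_L.*2.+2) := [set M : MM |
  (eta <= `|complex.Re (word_tr (cmat al av) (wmat bv (M : Mx)) j.+1)|)%R] `&` @Uset R n.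
have bw : bounded_mx (@Uset R n) (fun M : MM => wmat bv (M : Mx)) by exact: wmat_bounded.
have geM (f : MM -> R) x : measurable_fun setT f -> measurable [set M | x <= f M].
  move=> mf; rewrite -[X in measurable X]setTI.
  have -> : [set M | x <= f M] = f @^-1` `[x, +oo[%classic.
    by apply/seteqP; split=> M /=; rewrite in_itv /= andbT.
  exact: mf.
have mX0 : measurable X0.
  apply: measurableI; last exact: measurable_Uset.
  apply: geM; apply: frob2_measurable => i j; apply: (bounded_cplx_set0 (D := @Uset R n)).
  by apply: (bounded_mx_exp (M := fun M : MM => cmat al av * wmat bv (M : Mx))); apply: bounded_mx_mul => //; exact: bounded_mx_cst.
have mF j : measurable (F j).
  apply: measurableI; last exact: measurable_Uset.
  apply: geM; apply: measurableT_comp => //.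
  by have [] := bounded_word_tr (cmat al av) bw j.+1.
have mE0 : measurable E0 by exact: deviation_measurable.
have mUc : measurable (~` @Uset R n) by apply: measurableC; exact: measurable_Uset.
have mFU : measurable (\big[setU/set0]_j F j) by apply: bigsetU_measurable.
have sub : E0 `<=` ~` @Uset R n `|` (X0 `|` \big[setU/set0]_j F j).
  move=> M /= h; case: (pselect (@Uset R n M)) => MU; last by left.
  right; apply: contrapT => /not_orP[nX nF].
  have tau : forall k', (0 < k')%N -> (k' <= L.*2.+2)%N ->
      `|complex.Re (word_tr (cmat al av) (wmat bv (M : Mx)) k')| <= eta.
    move=> [//|k'] _ k'L; rewrite leNgt; apply/negP => hh; apply: nF.
    rewrite (bigD1 (Ordinal k'L)) //=; left; split => //=; exact: ltW.
  have lo := @lower_lambda R n al av bv al01 (M : Mx) MU k0 eta L k0_ge1 kap_le (ltW eta0)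
    (le_trans gam_le eps_eta) (le_trans om_le eps_eta) tau del del01 del_L L_eta.
  have hi : lambda_max (xmat av bv (M : Mx)) < 1 / 2 + sdev al + del.
    rewrite ltNge; apply/negP => hh; apply: nX; split => //=.
    exact: (upper_word al01 MU k al_half d0 hh).
  have : del <= `|lambda_max (xmat av bv (M : Mx)) - (1 / 2 + sdev al)| := h.
  by rewrite leNgt ltr_norml => /negP; apply; lra.
apply: le_trans (prob_le mu mE0 _ sub) _.
  by apply: measurableU => //; apply: measurableU.
apply: le_trans (measureU2 _ mUc _) _; first exact: measurableU.
rewrite [X in (X + _)%E](_ : _ = 0%E) // add0e.
apply: le_trans (measureU2 _ mX0 mFU) _.
rewrite EFinD; apply: leeD.
  apply: (haar_frob2_markov al01 mu_unitary mu_inv k0_ge1 kap_le eps_gt0 eps_le1 gam_le om_le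
    K_eps K_q (leqnn _)); rewrite exprn_gt0 //; lra.
apply: le_trans (prob_bigU mu (index_enum _) mF) _.
apply: le_trans (_ : (\sum_(j < L.*2.+2) (eps ^+ 2 / eta ^+ 2)%:E <= _)%E).
  apply: lee_sum => j _.
  apply: (haar_word_chebyshev al01 mu_unitary mu_inv k0_ge1 kap_le eps_gt0 eps_le1 gam_le om_le
    K_eps K_q) => //.
  have := ltn_ord j; have := L_k; rewrite leq_double; clear; lia.
by rewrite sumEFin sumr_const card_ord mulr_natl.
Qed.

End FixedBits.

Section BitFractions.
Context {R : realType} d (T : measurableType d) (P : probability T R) (n : nat).
Variables (p : R) (e : T -> 'I_n.+1 -> bool).
Hypotheses (p01 : 0 <= p <= 1) (e_meas : forall i, measurable [set w | e w i])
  (e_prob : forall i, P [set w | e w i] = p%:E)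
  (e_pair : forall i j, i != j -> P [set w | e w i /\ e w j] = (p * p)%:E).

Let PT : P setT = 1%E := probability_setT P.

Let bit (i : 'I_n.+1) (w : T) : R := (e w i)%:R.

Let bit_indic i : bit i = \1_[set w | e w i].
Proof.
apply/funext => w; rewrite indicE /bit; congr (_%:R).
by case: (boolP (e w i)) => h; [rewrite mem_set | rewrite memNset //=; apply/negP].
Qed.

Lemma expect_indic (A : set T) : measurable A -> expect P setT (\1_A : T -> R) = fine (P A).
Proof. by move=> mA; rewrite /expect /Rintegral integral_indic // setIT. Qed.

Lemma bounded_real_indic (A : set T) : measurable A -> bounded_real (setT : set T) (\1_A : T -> R).
Proof.
move=> mA; split; first exact: measurable_indic.
by exists 1 => w _; rewrite indicE; case: (_ \in _); rewrite ?normr0 ?normr1.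
Qed.

Let bm_bit i : bounded_real setT (bit i).
Proof. by rewrite bit_indic; exact: bounded_real_indic. Qed.

(** Chebyshev's inequality: the pair probabilities cancel the off-diagonal covariances, and p (1 -
    p) is estimated by 1. *)
Lemma bits_variance (t : R) : 0 < t ->
  (P [set w | (t <= `|bit_frac (e w) - p|)%R] <= ((n.+1%:R * t ^+ 2)^-1)%:E)%E.
Proof.
move=> t0.
have [p0 p1] := andP p01.
have N0 : 0 < n.+1%:R :> R by rewrite ltr0n.
pose f i w := bit i w - p.
have bf i : bounded_real setT (f i) by apply: bounded_realB => //; exact: bounded_real_cst.
have exb i : expect P setT (bit i) = p by rewrite bit_indic expect_indic // e_prob.
have exf i j : expect P setT (fun w => f i w * f j w) = if i == j then p * (1 - p) else 0.
  have bb : bounded_real setT (fun w => bit i w * bit j w) by exact: bounded_realM.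
  have -> : (fun w => f i w * f j w) =
     (fun w => (bit i w * bit j w + (- p) * bit i w) + ((- p) * bit j w + p * p)).
    by apply/funext => w; rewrite /f; ring.
  rewrite !expectD ?expect_cst ?expectZ ?exb //; try (by [exact: bounded_realZ | exact: bounded_real_cst | apply: bounded_realD => //; [exact: bounded_realZ | exact: bounded_real_cst] | apply: bounded_realD => //; exact: bounded_realZ]).
  have -> : expect P setT (fun w => bit i w * bit j w) = if i == j then p else p * p.
    case: eqVneq => [->|ij].
      rewrite -[RHS](exb j); congr expect; apply/funext => w; rewrite /bit.
      by case: (e w j); rewrite ?mulr1 ?mulr0.
    have -> : (fun w => bit i w * bit j w) = \1_[set w | e w i /\ e w j].
      apply/funext => w; rewrite indicE /bit -natrM mulnb; congr (_%:R).
      case: (boolP (_ && _)) => h; first by rewrite mem_set //=; exact/andP.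
      by rewrite memNset //= => /andP; exact/negP.
    rewrite expect_indic ?e_pair //.
    rewrite [X in measurable X](_ : _ = [set w | e w i] `&` [set w | e w j]) //.
    exact: measurableI.
  by case: eqVneq => _; ring.
have bs : bounded_real setT (fun w => (\sum_i f i w) ^+ 2).
  by under eq_fun do rewrite expr2; apply: bounded_realM; apply: bounded_real_sum.
have exS : expect P setT (fun w => (\sum_i f i w) ^+ 2) = n.+1%:R * (p * (1 - p)).
  have -> : (fun w => (\sum_i f i w) ^+ 2) = (fun w => \sum_i \sum_j f i w * f j w).
    apply/funext => w; rewrite expr2 mulr_suml; apply: eq_bigr => i _.
    by rewrite mulr_sumr.
  have bij i : bounded_real setT (fun w => \sum_j f i w * f j w) by apply: bounded_real_sum => j; exact: bounded_realM.
  rewrite (expect_sum measurableT PT _ bij) (eq_bigr (fun=> p * (1 - p))).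
    by rewrite sumr_const card_ord mulr_natl.
  move=> i _; rewrite (expect_sum measurableT PT _ (fun j => bounded_realM (bf i) (bf j))).
  rewrite (bigD1 i) //= exf eqxx big1 ?addr0 // => j ji.
  by rewrite exf eq_sym (negbTE ji).
have x0 : 0 < (n.+1%:R * t) ^+ 2 by rewrite exprn_gt0 // mulr_gt0.
have := bounded_real_markov measurableT PT bs (fun w _ => sqr_ge0 _) x0.
rewrite setIT exS.
have -> : [set w | (n.+1%:R * t) ^+ 2 <= (\sum_i f i w) ^+ 2] =
          [set w | t <= `|bit_frac (e w) - p|].
  have E w : \sum_i f i w = n.+1%:R * (bit_frac (e w) - p).
    rewrite /bit_frac mulrBr mulVKf ?gt_eqF // sumrB sumr_const card_ord mulr_natl //.
  have sqE w : ((n.+1%:R * t) ^+ 2 <= (\sum_i f i w) ^+ 2) = (t <= `|bit_frac (e w) - p|).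
    rewrite E !exprMn ler_pM2l ?exprn_gt0 // -[X in _ <= X](real_normK (num_real _)).
    by rewrite ler_pXn2r // nnegrE // ltW.
  by apply/seteqP; split=> w /=; rewrite sqE.
move=> /le_trans; apply; rewrite lee_fin.
have -> : n.+1%:R * (p * (1 - p)) / (n.+1%:R * t) ^+ 2 = (p * (1 - p)) * (n.+1%:R * t ^+ 2)^-1.
  have tn : t != 0 by rewrite gt_eqF.
  have yn : (n.+1%:R : R) != 0 by rewrite pnatr_eq0.
  by move: (n.+1%:R : R) yn => y yn; field; rewrite yn tn.
rewrite ler_piMl //; first by rewrite invr_ge0 mulr_ge0 ?exprn_ge0 // ltW.
have : p * (1 - p) <= 1 * 1 by apply: ler_pM => //; lra.
lra.
Qed.

End BitFractions.

(** * Asymptotics *)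

Lemma nat_root p N : (0 < p)%N -> exists j, (j ^ p <= N < j.+1 ^ p)%N.
Proof.
move=> p0; have ex0 : exists j, (j ^ p <= N)%N by exists 0%N; rewrite exp0n.
have ub j : (j ^ p <= N)%N -> (j <= N)%N.
  move=> h; apply: leq_trans h; case: j => // j.
  by rewrite -[X in (X <= _)%N]expn1 leq_pexp2l.
case: (ex_maxnP ex0 ub) => j jN jmax; exists j; rewrite jN /= ltnNge.
by apply/negP => /jmax; rewrite ltnn.
Qed.

(** All scales are powers of an integer x of order N^(1/40): k = 24 x and eps of order x^(-3). The
    constant C0 belongs to the merging condition, C1 to the bit fluctuations, C2 to the Frobenius
    norm and C3 to Chebyshev's bound for the tau_j. *)
Lemma parameter_choice (R : realType) (k0 s del eta zeta : R) (L : nat) :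
  1 <= k0 -> 0 < s -> 0 < del -> 0 < eta -> 0 < zeta ->
  exists N0 : nat, forall n, (N0 <= n)%N -> exists (k : nat) (eps : R),
  [/\ 0 < eps <= 1, eps <= eta, 12 * k.*2%:R ^+ 3 * k0 ^+ 2 * eps <= 1,
      8 * k.*2%:R * k.*2.+1%:R ^+ 2 * k0 ^+ 2 * n.+1%:R ^- 2 <= eps ^+ 2 &
      (L.*2.+2 <= k)%N /\
      n.+1%:R * (k.+1%:R * k.*2.+1%:R * k0 ^+ 2) / (1 + del) ^+ k.*2
       + L.*2.+2%:R * (eps ^+ 2 / eta ^+ 2) + 2 * (n.+1%:R * (s * eps) ^+ 2)^-1 <= zeta].
Proof.
move=> k01 s0 d0 e0 z0.
have k00 : 0 < k0 by lra.
(* With 2k = 48 x and eps = 1 / (A x^3) the splitting condition becomes an equality. *)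
pose A : R := 12 * 48 ^+ 3 * k0 ^+ 2.
have A1 : 1 <= A.
  rewrite /A; have : 1 <= k0 ^+ 2 by rewrite expr_ge1 // ltW.
  move=> h; apply: mulr_ege1 => //; rewrite -natrX -natrM ler1n //.
pose C0 : R := 8 * 48 * 49 ^+ 2 * k0 ^+ 2 * A ^+ 2.
pose C1 : R := 2 * A ^+ 2 / s ^+ 2.
pose C2 : R := 2 ^+ 40 * 25 * 49 * k0 ^+ 2 / del ^+ 48.
pose C3 : R := L.*2.+2%:R / eta ^+ 2.
have C10 : 0 <= C1 by rewrite /C1 divr_ge0 ?mulr_ge0 ?exprn_ge0 // ltW // (lt_le_trans ltr01).
have C20 : 0 <= C2 by rewrite /C2 divr_ge0 ?mulr_ge0 ?exprn_ge0 // ltW.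
have C30 : 0 <= C3 by rewrite /C3 divr_ge0 ?exprn_ge0 // ltW.
(* Makes x dominate all the constants; the summand L ensures 2L + 2 <= k. *)
pose J := (Num.truncn (C0 + eta^-1 + (C1 + C2 + C3) / zeta) + L).+1.
exists (J ^ 40)%N => n nJ.
have [j /andP[jn nj]] := @nat_root 40 n.+1 isT.
have Jj : (J <= j)%N.
  rewrite leqNgt; apply/negP => h.
  have : (j.+1 ^ 40 <= J ^ 40)%N by rewrite leq_exp2r.
  by move=> /(leq_trans nj); rewrite ltnNge (leq_trans nJ).
pose x : R := j%:R; pose y : R := n.+1%:R.
have x1 : 1 <= x by rewrite ler1n; apply: leq_trans Jj.
have x0 : 0 < x by lra.
have C00 : 0 <= C0 by rewrite /C0 !mulr_ge0 ?exprn_ge0 //; lra.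
have S0 : 0 <= (C1 + C2 + C3) / zeta by rewrite divr_ge0 // ?addr_ge0 // ltW.
have xJ : C0 + eta^-1 + (C1 + C2 + C3) / zeta <= x.
  apply: ltW; apply: lt_le_trans (_ : (Num.truncn (C0 + eta^-1 + (C1 + C2 + C3) / zeta)).+1%:R <= _).
    exact: truncnS_gt.
  by rewrite ler_nat; apply: leq_trans Jj; rewrite ltnS leq_addr.
have ei0 : 0 < eta^-1 by rewrite invr_gt0.
have xC0 : C0 <= x by lra.
have xe : eta^-1 <= x by lra.
have xS : (C1 + C2 + C3) / zeta <= x by lra.
have y1 : x ^+ 40 <= y by rewrite -natrX ler_nat.
have y2 : y <= (2 * x) ^+ 40.
  rewrite -natrM -natrX ler_nat; apply: leq_trans (ltnW nj) _; rewrite leq_exp2r //.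
  have : (0 < j)%N by apply: leq_trans Jj.
  by clear; lia.
have xp (p : nat) : (0 < p)%N -> x <= x ^+ p.
  by move=> p0; rewrite -[X in X <= _]expr1 ler_weXn2l.
have y0 : 0 < y by rewrite ltr0n.
have A0 : 0 < A by lra.
have B0 : 0 < A * x ^+ 3 by rewrite mulr_gt0 // exprn_gt0.
pose eps : R := (A * x ^+ 3)^-1.
have epsx : eps <= x^-1.
  rewrite /eps lef_pV2 ?posrE //; apply: le_trans (xp 3 isT) _.
  by rewrite ler_peMl // exprn_ge0 // ltW.
have eps0 : 0 < eps by rewrite invr_gt0.
have xi1 : x^-1 <= 1 by rewrite invf_le1.
exists (24 * j)%N, eps.
have kk : (24 * j).*2%:R = 48 * x by rewrite -muln2 mulnAC natrM.
have kk1 : (24 * j).*2.+1%:R <= 49 * x by rewrite -natr1 kk; lra.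
have k1 : (24 * j).+1%:R <= 25 * x by rewrite -natr1 natrM -/x; lra.
split.
- by rewrite eps0 (le_trans epsx).
- apply: le_trans epsx _; rewrite -[leRHS]invrK lef_pV2 ?posrE //.
- rewrite kk /eps /A.
  have -> : 12 * (48 * x) ^+ 3 * k0 ^+ 2 = A * x ^+ 3 by rewrite /A; ring.
  by rewrite mulfV // gt_eqF.
- have h1 : 8 * (24 * j).*2%:R * (24 * j).*2.+1%:R ^+ 2 * k0 ^+ 2 <=
     8 * (48 * x) * (49 * x) ^+ 2 * k0 ^+ 2.
    rewrite kk ler_wpM2r ?exprn_ge0 ?(ltW k00) // ler_wpM2l //; first by rewrite !mulr_ge0 // ltW.
    by rewrite lerXn2r ?nnegrE // mulr_ge0 // ltW.
  apply: le_trans (ler_wpM2r _ h1) _; first by rewrite invr_ge0 exprn_ge0 // ltW.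
  rewrite -/y ler_pdivrMr ?exprn_gt0 // /eps.
  have -> : (A * x ^+ 3)^-1 ^+ 2 * y ^+ 2 = y ^+ 2 / (A * x ^+ 3) ^+ 2.
    by rewrite exprVn mulrC.
  rewrite ler_pdivlMr ?exprn_gt0 //.
  have -> : 8 * (48 * x) * (49 * x) ^+ 2 * k0 ^+ 2 * (A * x ^+ 3) ^+ 2 = C0 * x ^+ 9.
    by rewrite /C0; ring.
  apply: le_trans (_ : x * x ^+ 9 <= _); first by rewrite ler_wpM2r // exprn_ge0 // ltW.
  rewrite -exprS; apply: le_trans (_ : x ^+ 80 <= _); first by rewrite ler_weXn2l.
  by rewrite (_ : 80 = 40 * 2)%N // exprM lerXn2r // ?nnegrE ?exprn_ge0 // ltW.
- split.
    have : (J <= j)%N by []. have : (L < J)%N by rewrite /J ltnS leq_addl.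
    by clear; lia.
  have T1 : n.+1%:R * ((24 * j).+1%:R * (24 * j).*2.+1%:R * k0 ^+ 2) / (1 + del) ^+ (24 * j).*2
      <= C2 / x.
    (* Bernoulli's inequality is applied to (1 + del)^j before taking the 48th power. The exponent
       48 exceeds 42, which comes from N <= (2x)^40 and the factor x^2 of the Markov bound. *)
    have P1 : (x * del) ^+ 48 <= (1 + del) ^+ (24 * j).*2.
      have -> : ((24 * j).*2 = j * 48)%N by rewrite -muln2 mulnAC mulnC.
      rewrite exprM lerXn2r ?nnegrE ?exprn_ge0 //; [by rewrite mulr_ge0 // ltW | lra |].
      have := bernoulli_ineq j (ltW d0); rewrite -/x; lra.
    have xd0 : 0 < (x * del) ^+ 48 by rewrite exprn_gt0 // mulr_gt0.
    apply: le_trans (_ : (2 * x) ^+ 40 * (25 * x * (49 * x) * k0 ^+ 2) / (x * del) ^+ 48 <= _).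
      apply: ler_pM.
      + by rewrite !mulr_ge0 ?exprn_ge0 // ltW.
      + by rewrite invr_ge0 exprn_ge0 //; lra.
      + apply: ler_pM => //; first by rewrite !mulr_ge0 ?exprn_ge0 // ltW.
        by rewrite ler_wpM2r ?exprn_ge0 ?(ltW k00) // ler_pM.
      + by rewrite lef_pV2 ?posrE // exprn_gt0 //; lra.
    have -> : (2 * x) ^+ 40 * (25 * x * (49 * x) * k0 ^+ 2) / (x * del) ^+ 48 = C2 / x ^+ 6.
      have -> : (2 * x) ^+ 40 = 2 ^+ 40 * x ^+ 40 by rewrite exprMn.
      have -> : (x * del) ^+ 48 = x ^+ 42 * x ^+ 6 * del ^+ 48 by rewrite exprMn -exprD.
      rewrite /C2; have -> : x ^+ 42 = x ^+ 40 * x * x by rewrite -!exprSr.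
      have xn : x != 0 by rewrite gt_eqF.
      have a0 : x ^+ 40 != 0 by rewrite expf_neq0.
      have b0 : x ^+ 6 != 0 by rewrite expf_neq0.
      have c0 : del ^+ 48 != 0 by rewrite expf_neq0 // gt_eqF.
      move: (x ^+ 40) (x ^+ 6) (del ^+ 48) (2 ^+ 40 : R) a0 b0 c0 => a b c e a0 b0 c0.
      by field; rewrite a0 b0 c0 xn.
    by rewrite ler_wpM2l // lef_pV2 ?posrE ?exprn_gt0 //; exact: xp.
  have T2 : L.*2.+2%:R * (eps ^+ 2 / eta ^+ 2) <= C3 / x.
    rewrite /C3 mulrCA [leRHS]mulrC ler_wpM2r ?divr_ge0 ?exprn_ge0 ?(ltW e0) //.
    rewrite expr2; apply: le_trans (_ : 1 * x^-1 <= _); last by rewrite mul1r.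
    by apply: ler_pM => //; [exact: ltW | exact: ltW | exact: le_trans epsx xi1].
  have T3 : 2 * (n.+1%:R * (s * eps) ^+ 2)^-1 <= C1 / x.
    have xn : x != 0 by rewrite gt_eqF.
    have yn : y != 0 by rewrite gt_eqF.
    have sn : s != 0 by rewrite gt_eqF.
    have An : A != 0 by rewrite gt_eqF.
    have -> : 2 * (n.+1%:R * (s * eps) ^+ 2)^-1 = C1 * (x ^+ 6 / y).
      have gen (a z : R) : a != 0 -> z != 0 ->
        2 * (z * (s * (a * x ^+ 3)^-1) ^+ 2)^-1 = 2 * a ^+ 2 / s ^+ 2 * (x ^+ 6 / z).
        by move=> an zn; field; rewrite an zn sn xn.
      exact: gen.
    rewrite ler_wpM2l // ler_pdivrMr // mulrC ler_pdivlMr // -exprSr.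
    by apply: le_trans y1; rewrite ler_weXn2l.
  have T4 : (C1 + C2 + C3) / x <= zeta.
    by rewrite ler_pdivrMr // mulrC -ler_pdivrMr.
  apply: le_trans T4; have -> : (C1 + C2 + C3) / x = C2 / x + C3 / x + C1 / x.
    by rewrite -!mulrDl; congr (_ / _); rewrite -[LHS]addrA [LHS]addrC.
  by apply: lerD => //; apply: lerD.
Qed.

(** * Averaging over the random bits *)

Section Mixing.
Context {R : realType} d (T : measurableType d) (P : probability T R) (n : nat).
Local Notation C := (complex R).
Local Notation MM := (cmxm R n.+1).
Local Notation Mx := 'M[C]_n.+1.
Variables (U : T -> Mx) (a b : T -> 'I_n.+1 -> bool) (al be : R).
Hypotheses (al01 : 0 <= al <= 1) (be01 : 0 <= be <= 1)
  (haar : haar_unitary P U) (a_bern : forall i, bernoulli_bit P al (fun w => a w i))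
  (b_bern : forall i, bernoulli_bit P be (fun w => b w i)) (indep : indep_U_bits P U a b).

Lemma U_measurable : measurable_fun setT (U : T -> MM).
Proof. by case: haar => h _ _ _ E mE; rewrite setTI; exact: h. Qed.

(** Moving to the law of U on matrix space makes the estimates for fixed bits independent of the
    underlying probability space. *)
Lemma haar_law : exists mu : probability MM R,
  [/\ forall E : set MM, measurable E -> mu E = P (U @^-1` E), mu (~` @Uset R n) = 0%E &
   forall V : Mx, V \is unitarymx -> forall E : set MM, measurable E ->
     mu E = mu ((fun M : MM => V *m (M : Mx) : MM) @^-1` E)].
Proof.
have [_ h2 h3] := haar.
pose X : {mfun T >-> MM} := HB.pack (U : T -> MM) (isMeasurableFun.Build _ _ _ _ _ U_measurable).
exists (distribution P X); split => //.
rewrite -h2; congr (P _); apply/seteqP; split=> w /=; first by move=> h; apply/negP.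
by move=> /negP.
Qed.

Let meas_a i v : measurable [set w | a w i = v].
Proof.
have [m _] := a_bern i; case: v; first exact: m.
rewrite (_ : [set w | _] = ~` [set w | a w i]); first exact: measurableC.
by apply/seteqP; split=> w /=; case: (a w i).
Qed.

Let meas_b i v : measurable [set w | b w i = v].
Proof.
have [m _] := b_bern i; case: v; first exact: m.
rewrite (_ : [set w | _] = ~` [set w | b w i]); first exact: measurableC.
by apply/seteqP; split=> w /=; case: (b w i).
Qed.

(** Pairwise independence is read off from joint independence by leaving all other coordinates
    unconstrained. *)
Let pair_sets (p : R) (e : T -> 'I_n.+1 -> bool) (i j : 'I_n.+1) : i != j ->
  (forall k, P [set w | e w k] = p%:E) ->
  (\prod_(k < n.+1) P [set w | (if (k == i) || (k == j) then [set true] else setT) (e w k)])%E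
   = (p * p)%:E.
Proof.
move=> ij ep; rewrite (bigD1 i) //= (bigD1 j) /=; last by rewrite eq_sym.
rewrite eqxx /= eqxx orbT big1 => [|k /andP[ki kj]].
  rewrite mule1 (ep i) (ep j) //.
by rewrite (negbTE ki) (negbTE kj) /= -[X in P X]/setT probability_setT.
Qed.

Let prod_setT (e : T -> 'I_n.+1 -> bool) :
  (\prod_(k < n.+1) P [set w | (setT : set bool) (e w k)])%E = 1%E.
Proof. by rewrite big1 // => k _; rewrite -[X in P X]/setT probability_setT. Qed.

Let mxT : mx_measurable (setT : set Mx).
Proof. exact: (@measurableT _ MM). Qed.

Let pair_a i j : i != j -> P [set w | a w i /\ a w j] = (al * al)%:E.
Proof.
move=> ij.
have := indep (fun k => if (k == i) || (k == j) then [set true] else setT) (fun=> setT) mxT.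
rewrite (pair_sets ij (fun k => (a_bern k).2)) prod_setT preimage_setT probability_setT mul1e mule1.
move=> <-; congr (P _); apply/seteqP; split=> w /=.
  move=> [ai aj]; do 2?split=> //; move=> k.
  by case: ifP => // /orP[] /eqP -> /=.
move=> [_ [h _]]; split.
  by have := h i; rewrite eqxx.
by have := h j; rewrite eqxx orbT.
Qed.

Let pair_b i j : i != j -> P [set w | b w i /\ b w j] = (be * be)%:E.
Proof.
move=> ij.
have := indep (fun=> setT) (fun k => if (k == i) || (k == j) then [set true] else setT) mxT.
rewrite (pair_sets ij (fun k => (b_bern k).2)) prod_setT preimage_setT probability_setT !mul1e.
move=> <-; congr (P _); apply/seteqP; split=> w /=.
  move=> [ai aj]; do 2?split=> //; move=> k.
  by case: ifP => // /orP[] /eqP -> /=.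
move=> [_ [_ h]]; split.
  by have := h i; rewrite eqxx.
by have := h j; rewrite eqxx orbT.
Qed.

Let B := ({ffun 'I_n.+1 -> bool} * {ffun 'I_n.+1 -> bool})%type.
Let S (z : B) : set T := [set w | (forall i, a w i = z.1 i) /\ (forall i, b w i = z.2 i)].

Let S_meas z : measurable (S z).
Proof.
rewrite (_ : S z = (\bigcap_(i in [set: 'I_n.+1]) [set w | a w i = z.1 i]) `&`
   (\bigcap_(i in [set: 'I_n.+1]) [set w | b w i = z.2 i])).
  by apply: measurableI; apply: fin_bigcap_measurable => //; exact: finite_finset.
apply/seteqP; split=> w /=.
  by move=> [h1 h2]; split=> i _ /=.
by move=> [h1 h2]; split=> i; [apply: h1 | apply: h2].
Qed.

Let S_sum : (\sum_(z : B) P (S z) = 1)%E.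
Proof.
have fin z : P (S z) \is a fin_num by rewrite fin_num_measure.
rewrite (eq_bigr (fun z => (expect P setT (\1_(S z) : T -> R))%:E)); last first.
  by move=> z _; rewrite expect_indic ?fineK.
have bS z : bounded_real setT (\1_(S z) : T -> R) := bounded_real_indic (S_meas z).
have PT : P setT = 1%E := probability_setT P.
rewrite sumEFin -(expect_sum measurableT PT _ bS); congr EFin.
rewrite -[RHS](expect_cst measurableT PT 1); congr expect; apply/funext => w.
pose z0 : B := (finfun (a w), finfun (b w)).
rewrite (bigD1 z0) //= big1 => [|z zz0]; rewrite indicE.
  by rewrite addr0 mem_set // /S /=; split=> i; rewrite ffunE.
rewrite memNset // => -[h1 h2]; case/eqP: zz0; rewrite [z]surjective_pairing /z0.
by congr (_, _); apply/ffunP => i; rewrite ffunE.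
Qed.

Let P_indep (E : set MM) z : measurable E -> P (U @^-1` E `&` S z) = (P (U @^-1` E) * P (S z))%E.
Proof.
move=> mE.
have h1 := indep (fun i => [set z.1 i]) (fun i => [set z.2 i]) mE.
have h2 := indep (fun i => [set z.1 i]) (fun i => [set z.2 i]) mxT.
rewrite preimage_setT probability_setT mul1e in h2.
rewrite (_ : P (S z) = (\prod_(i < n.+1) P [set w | [set z.1 i] (a w i)] *
                   \prod_(i < n.+1) P [set w | [set z.2 i] (b w i)])%E).
  by rewrite muleA -h1.
by rewrite -h2; congr (P _); apply/seteqP; split=> w /=; [move=> h; split | case].
Qed.

(** The cells [S z] form a finite partition, so conditioning on the bits is a finite sum in which
    independence factors each term. Good cells contribute at most th, and the bad ones are covered
    by Chebyshev for the two fractions. The same finite decomposition shows that the mixed event is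
    measurable. *)
Lemma mixing_bound (E : ('I_n.+1 -> bool) -> ('I_n.+1 -> bool) -> set MM) (th t : R) :
  (forall x y, measurable (E x y)) -> 0 <= th -> 0 < t ->
  (forall x y, `|bit_frac x - al| < t -> `|bit_frac y - be| < t ->
     (P (U @^-1` E x y) <= th%:E)%E) ->
  (P [set w | E (a w) (b w) (U w)] <= (th + 2 * (n.+1%:R * t ^+ 2)^-1)%:E)%E /\
  measurable [set w | E (a w) (b w) (U w)].
Proof.
move=> mE th0 t0 small.
pose good (z : B) := (`|bit_frac z.1 - al| < t) && (`|bit_frac z.2 - be| < t).
pose F (z : B) : set T := U @^-1` E z.1 z.2 `&` S z.
have mUE x y : measurable (U @^-1` E x y).
  by have := U_measurable measurableT (mE x y); rewrite setTI.
have mF z : measurable (F z) by apply: measurableI.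
have aE w z : S z w -> a w = z.1 :> ('I_n.+1 -> bool) by move=> [h _]; apply/funext.
have bE w z : S z w -> b w = z.2 :> ('I_n.+1 -> bool) by move=> [_ h]; apply/funext.
have inS w : S (finfun (a w), finfun (b w)) w by split=> i; rewrite ffunE.
have FE : [set w | E (a w) (b w) (U w)] = \big[setU/set0]_(z : B) F z.
  apply/seteqP; split=> w /=.
    move=> h; rewrite (bigD1 (finfun (a w), finfun (b w))) //=; left; split; last exact: inS.
    by rewrite /preimage /= -(aE _ _ (inS w)) -(bE _ _ (inS w)).
  move: w; apply: (big_ind (fun X : set T => X `<=` [set w | E (a w) (b w) (U w)])) => //=.
    by move=> X Y hX hY w [/hX|/hY].
  by move=> z _ w [h1 h2] /=; rewrite (aE _ _ h2) (bE _ _ h2).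
have mFE : measurable [set w | E (a w) (b w) (U w)].
  by rewrite FE; apply: bigsetU_measurable.
split=> //.
have fracm (e : T -> 'I_n.+1 -> bool) (p : R) : (forall i, measurable [set w | e w i]) ->
    measurable [set w | t <= `|bit_frac (e w) - p|].
  move=> me; rewrite -[X in measurable X]setTI.
  have -> : [set w | t <= `|bit_frac (e w) - p|] =
     (fun w => `|bit_frac (e w) - p|) @^-1` `[t, +oo[%classic.
    by apply/seteqP; split=> w /=; rewrite in_itv /= andbT.
  have mf : measurable_fun setT (fun w => `|bit_frac (e w) - p|).
    apply: measurableT_comp => //; apply: measurable_funB => //.
    apply: measurable_funM => //; apply: measurable_sum => i.
    have -> : (fun w => (e w i)%:R) = \1_[set w | e w i] :> (T -> R).
      apply/funext => w; rewrite indicE; congr (_%:R).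
      by case: (boolP (e w i)) => h; [rewrite mem_set | rewrite memNset //=; apply/negP].
    exact: measurable_indic.
  exact: mf.
pose Ba := [set w | t <= `|bit_frac (a w) - al|].
pose Bb := [set w | t <= `|bit_frac (b w) - be|].
have mBa : measurable Ba by apply: fracm => i; have [] := a_bern i.
have mBb : measurable Bb by apply: fracm => i; have [] := b_bern i.
have va : (P Ba <= ((n.+1%:R * t ^+ 2)^-1)%:E)%E.
  by apply: bits_variance => // i; have [] := a_bern i.
have vb : (P Bb <= ((n.+1%:R * t ^+ 2)^-1)%:E)%E.
  by apply: bits_variance => // i; have [] := b_bern i.
pose G z := if good z then F z else set0.
have mG z : measurable (G z) by rewrite /G; case: ifP.
have mGU : measurable (\big[setU/set0]_(z : B) G z) by apply: bigsetU_measurable.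
have sub : [set w | E (a w) (b w) (U w)] `<=` \big[setU/set0]_(z : B) G z `|` (Ba `|` Bb).
  move=> w /= h; pose z : B := (finfun (a w), finfun (b w)).
  have [gz|] := boolP (good z).
    left; rewrite (bigD1 z) //= /G gz; left; split; last exact: inS.
    by rewrite /preimage /= -(aE _ _ (inS w)) -(bE _ _ (inS w)).
  rewrite /good -(aE _ _ (inS w)) -(bE _ _ (inS w)) negb_and -!leNgt => /orP[h'|h'].
    by right; left.
  by right; right.
apply: le_trans (prob_le P mFE _ sub) _; first by apply: measurableU => //; exact: measurableU.
apply: le_trans (measureU2 _ mGU _) _; first exact: measurableU.
rewrite EFinD; apply: leeD; last first.
  apply: le_trans (measureU2 _ mBa mBb) _.
  by rewrite mulrDl mul1r EFinD; apply: leeD.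
apply: le_trans (prob_bigU P (index_enum _) mG) _.
apply: le_trans (_ : (\sum_(z : B) th%:E * P (S z) <= _)%E).
  apply: lee_sum => z _; rewrite /G; case: ifP => [/andP[g1 g2]|_].
    rewrite /F P_indep //; apply: lee_wpmul2r => //; exact: small.
  by rewrite measure0 mule_ge0.
by rewrite -ge0_sume_distrr // S_sum mule1.
Qed.

End Mixing.

(** * The edge at parameter 1/2 and the limit *)

Lemma edge_half (R : realType) (al : R) : 0 < al < 1 -> al <= 1 / 2 ->
  edge al (1 / 2) = 1 / 2 + sdev al.
Proof.
(* The boundary case al = 1/2 falls under [r_plus], since the test in [edge] is strict. *)
move=> /andP[a0 a1] ah; rewrite /edge ifF; last by apply/negP => h; lra.
rewrite /r_plus sqrrD !sqr_sqrtr; try by rewrite mulr_ge0 //; lra.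
rewrite -sqrtrM; last by rewrite mulr_ge0 //; lra.
have -> : al * (1 - 1 / 2) * (1 / 2 * (1 - al)) = (1 / 2) ^+ 2 * (al * (1 - al)) by field.
rewrite sqrtrM ?sqr_ge0 // sqrtr_sqr ger0_norm; last by lra.
rewrite -/(sdev al) -mulr_natl; by field.
Qed.

(** In dimension 0 there is no eigenvalue, and the supremum of the empty set is 0 by convention; the
    operator norm is the supremum of the singleton 0. *)
Lemma lambda_max_opnorm0 (R : realType) (X B : 'M[complex R]_0) :
  lambda_max X = opnorm B ^+ 2.
Proof.
have -> : lambda_max X = 0.
  rewrite /lambda_max (_ : [set _ | _] = set0) ?sup0 //.
  apply/seteqP; split=> x //= /eigenvalueP[v _]; by rewrite (thinmx0 v) eqxx.
have v0 (v : 'cV[complex R]_0) : vnorm v = 0 by rewrite vnormE /frob2 big_ord0 sqrtr0.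
rewrite /opnorm (_ : [set _ | _ in _] = [set 0]) ?sup1 ?expr0n //.
apply/seteqP; split=> x /=; first by move=> [v _ <-]; rewrite v0.
by move=> ->; exists 0; rewrite ?v0.
Qed.

Lemma prob_tendsto0 (R : realType) (p : nat -> \bar R) : (forall n, (0 <= p n)%E) ->
  (forall z : R, 0 < z -> exists N0, forall n, (N0 <= n)%N -> (p n <= z%:E)%E) ->
  p @ \oo --> 0%E.
Proof.
move=> p0 h; apply/fine_cvgP; split.
  have [N0 hN] := h 1 ltr01; exists N0 => // n /= /hN pn.
  by rewrite ge0_fin_numE //; apply: le_lt_trans pn _; rewrite ltry.
apply/cvgrPdist_le => e e0; have [N0 hN] := h e e0; exists N0 => // n /= /hN pn.
have fn : p n \is a fin_num.
  by rewrite ge0_fin_numE //; apply: le_lt_trans pn _; rewrite ltry.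
rewrite sub0r normrN ger0_norm; last by rewrite fine_ge0.
by rewrite -lee_fin fineK.
Qed.

Lemma count_bits (R : realType) n (x y : 'I_n.+1 -> bool) (al t : R) :
  al + 1 / 2 - 2 * t = 1 -> `|bit_frac x - al| < t -> `|bit_frac y - 1 / 2| < t ->
  (n.+1 < \sum_i x i + \sum_i y i)%N.
Proof.
move=> at1; rewrite !ltr_norml => /andP[hx _] /andP[hy _].
have N0 : 0 < n.+1%:R :> R by rewrite ltr0n.
rewrite -(ltr_nat R) natrD !natr_sum -(ltr_pM2l (_ : 0 < n.+1%:R^-1)) ?invr_gt0 //.
rewrite mulVf ?gt_eqF // mulrDr -/(bit_frac x) -/(bit_frac y); lra.
Qed.

(** The threshold N0 is fixed before the probability space is introduced, because the space may
    change with N. *)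
Lemma edge_deviation_bound (R : realType) (al eps zeta : R) : 0 < al < 1 -> 0 < eps ->
  0 < zeta -> exists N0, forall n, (N0 <= n)%N ->
  forall d (T : measurableType d) (P : probability T R) (U : T -> 'M[complex R]_n.+1)
    (a b : T -> 'I_n.+1 -> bool),
  haar_unitary P U -> (forall i, bernoulli_bit P al (fun w => a w i)) ->
  (forall i, bernoulli_bit P (1 / 2) (fun w => b w i)) -> indep_U_bits P U a b ->
  (P [set w | (eps <= `|lambda_max (xmat (a w) (b w) (U w)) - edge al (1 / 2)|)%R] <=
   zeta%:E)%E.
Proof.
move=> al01 e0 z0; have [a0 a1] := andP al01.
have al01' : 0 <= al <= 1 by rewrite !ltW.
have h01 : 0 <= (1 / 2 : R) <= 1 by lra.
have [alh|alh] := lerP al (1 / 2).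
  have s0 := sdev_gt0 al01; have sh := sdev_le al01.
  pose k0 : R := Num.max 1 `|kapp al|.
  have k01 : 1 <= k0 by rewrite le_max lexx.
  have kk : `|kapp al| <= k0 by rewrite le_max lexx orbT.
  pose del : R := Num.min eps 1.
  have d0 : 0 < del by rewrite lt_min e0 ltr01.
  have d1 : del <= 1 by rewrite ge_min lexx orbT.
  pose L := (Num.truncn (2 / del)).+1.
  have dL : 2 <= del * L%:R.
    by rewrite mulrC -ler_pdivrMr // ltW // truncnS_gt.
  pose Q : R := 3 * (L * L)%:R * ((L + 4)%:R * (L.*2 + 3)%:R * k0 ^+ 2).
  have Q0 : 0 < Q.
    rewrite /Q !mulr_gt0 ?exprn_gt0 ?ltr0n //; first [lra | by rewrite addn_gt0 orbT | by rewrite muln_gt0].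
  (* Half of the admissible error: the smallness condition of the lower edge then reads al / 2 <
     al. *)
  pose eta := al / (2 * Q).
  have eta0 : 0 < eta by rewrite divr_gt0 // mulr_gt0.
  have Leta : 3 * (L * L)%:R * ((L + 4)%:R * (L.*2 + 3)%:R * k0 ^+ 2 * eta) < al.
    rewrite mulrA -/Q /eta.
    have -> : Q * (al / (2 * Q)) = al / 2 by field; rewrite gt_eqF.
    lra.
  have [N0 hN] := parameter_choice L k01 s0 d0 eta0 z0.
  exists N0 => n nN d T P U a b haar ab bb ind.
  have [k [ep [/andP[ep0 ep1] epeta Keps Kq [Lk tot]]]] := hN n nN.
  have [mu [muE mu0 muinv]] := haar_law haar.
  set th1 := _ / (1 + del) ^+ _ in tot; set th2 := _ * (ep ^+ 2 / _) in tot.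
  (* The tolerance for both fractions: [gamm] divides it by the deviation s, and [omm] doubles it,
     which is harmless since 2 s <= 1. *)
  have t0 : 0 < sdev al * ep by rewrite mulr_gt0.
  have th0 : 0 <= th1 + th2.
    rewrite addr_ge0 // /th1 /th2; first by rewrite divr_ge0 ?mulr_ge0 ?exprn_ge0 //; lra.
    by rewrite mulr_ge0 // divr_ge0 // exprn_ge0 // ltW.
  have := @mixing_bound _ _ _ _ _ U a b al (1 / 2) al01' h01 haar ab bb ind
    (fun x y => [set M | eps <= `|lambda_max (xmat x y M) - edge al (1 / 2)|])
    (th1 + th2) (sdev al * ep) (fun x y => deviation_measurable _ _ _ _) th0 t0.
  move=> [x y gx gy|h _].
    rewrite -muE; last exact: deviation_measurable.
    have gam : `|gamm al x| <= ep.
      rewrite /gamm normrM normfV (gtr0_norm s0) ler_pdivrMr // mulrC ltW //.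
    have om : `|omm y| <= ep.
      have -> : omm y = 2 * (bit_frac y - 1 / 2) :> R by rewrite /omm; field.
      rewrite normrM ger0_norm //.
      have : sdev al * ep <= 1 / 2 * ep by rewrite ler_wpM2r // ltW.
      by move: (ltW gy); lra.
    apply: le_trans _ (@fixed_bits_bound R n al x y al01 alh mu mu0 muinv k L k0 ep eta del
      k01 kk ep0 ep1 epeta gam om Keps Kq Lk _ dL Leta); last by rewrite d0.
    apply: prob_le; [exact: deviation_measurable | exact: deviation_measurable |].
    by move=> M /=; rewrite edge_half //; apply: le_trans; rewrite ge_min lexx.
  by apply: le_trans h _; rewrite lee_fin.
(* Half of the excess of al + 1/2 over 1, so that both fractions may fall short by t and the ranks
   still add up to more than N. *)
pose t := (al - 1 / 2) / 2.
have t0 : 0 < t by rewrite /t; lra.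
exists (Num.truncn (2 / (zeta * t ^+ 2))) => n nN d T P U a b haar ab bb ind.
have E1 : edge al (1 / 2) = 1 by rewrite /edge ifT //; lra.
have [mu [muE mu0 muinv]] := haar_law haar.
have := @mixing_bound _ _ _ _ _ U a b al (1 / 2) al01' h01 haar ab bb ind
    (fun x y => [set M | eps <= `|lambda_max (xmat x y M) - edge al (1 / 2)|])
    0 t (fun x y => deviation_measurable _ _ _ _) (lexx _) t0.
move=> [x y gx gy|h _].
  rewrite -muE; last exact: deviation_measurable.
  rewrite -[X in (_ <= X)%E]mu0.
  apply: prob_le; [exact: deviation_measurable | apply: measurableC; exact: measurable_Uset |].
  move=> M /= h MU; move: h; rewrite E1 lambda_max_eq1 //; first by rewrite subrr normr0 leNgt e0.
  by apply: (count_bits _ gx gy); rewrite /t; field.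
apply: le_trans h _; rewrite lee_fin add0r.
have zt : 0 < zeta * t ^+ 2 by rewrite mulr_gt0 // exprn_gt0.
have N0 : 0 < n.+1%:R * t ^+ 2 by rewrite mulr_gt0 // ?ltr0n // exprn_gt0.
rewrite ler_pdivrMr //.
have : 2 / (zeta * t ^+ 2) <= n.+1%:R.
  apply: ltW; apply: lt_le_trans (truncnS_gt _) _; by rewrite ler_nat ltnS.
rewrite ler_pdivrMr // => h2; apply: le_trans h2 _.
by rewrite le_eqVlt; apply/orP; left; apply/eqP; ring.
Qed.

Lemma lambda_max_projections (R : realType) N (av bv : 'I_N -> bool) (U : 'M[complex R]_N) :
  lambda_max (bdiag av *m U *m bdiag bv *m adjmx U *m bdiag av) =
  opnorm (bdiag av *m U *m bdiag bv) ^+ 2.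
Proof.
case: N av bv U => [|n] av bv U; first exact: lambda_max_opnorm0.
by have := lambda_max_opnorm (pmat av bv U); rewrite -xmat_gram.
Qed.

Theorem theorem1p14 (R : realType) (alpha : R)
  (d : nat -> measure_display) (T : forall N : nat, measurableType (d N))
  (P : forall N : nat, probability (T N) R)
  (U : forall N : nat, T N -> 'M[complex R]_N)
  (a b : forall N : nat, T N -> 'I_N -> bool) :
  0 < alpha < 1 ->
  (forall N, haar_unitary (P N) (U N)) ->
  (forall N (i : 'I_N), bernoulli_bit (P N) alpha (fun w => a N w i)) ->
  (forall N (i : 'I_N), bernoulli_bit (P N) (1 / 2) (fun w => b N w i)) ->
  (forall N, indep_U_bits (P N) (U N) (a N) (b N)) ->
  let X N w := bdiag (a N w) *m U N w *m bdiag (b N w) *m adjmx (U N w) *m bdiag (a N w) in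
  (forall N w, lambda_max (X N w) = opnorm (bdiag (a N w) *m U N w *m bdiag (b N w)) ^+ 2) /\
  (forall eps : R, 0 < eps ->
     (fun N => P N [set w | eps <= `| lambda_max (X N w) - edge alpha (1 / 2) |]) @ \oo
       --> 0%E).
Proof.
move=> al01 haar ab bb ind X; split; first by move=> N w; exact: lambda_max_projections.
move=> eps e0; apply: prob_tendsto0 => [N|z z0]; first exact: measure_ge0.
have [N0 hN] := edge_deviation_bound al01 e0 z0.
(* The estimates live in dimension n.+1; the shifted threshold excludes N = 0. *)
by exists N0.+1 => -[//|n] nN; exact: hN.
Qed.
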